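(* Let $\boldsymbol{k}=(k_1,\dots,k_r)$ be an index with $r\geqslant1$, and let $K$ be a compact subset of $\{s\in\mathbb C:|\operatorname{Re}(s)|<\tfrac12\}\setminus\{0\}$. Then, as $N\to\infty$, uniformly for $s\in K$, $$\mathcal T_N(\boldsymbol{k};s)=C_0^{T_N}(\boldsymbol{k})+C_1^{T_N}(\boldsymbol{k})\,\mathcal T(1;s)+\sum_{j=1}^{r}\sum_{m=0}^{k_j-2}C_{j,m}^{T_N}(\boldsymbol{k})\,\mathcal T(k_j-m;s)+o_{\boldsymbol{k},K}(1).$$ If $k_j=1$, the corresponding inner sum is empty.
   Context: An index is a finite sequence $\boldsymbol{k}=(k_1,\dots,k_r)$ of positive integers, of weight $|\boldsymbol{k}|=k_1+\cdots+k_r$; the empty index is $\varnothing$ (weight $0$). Reversal: $\overleftarrow{\boldsymbol{k}}=(k_r,\dots,k_1)$. Write $\boldsymbol{k}_{(j,r]}=(k_{j+1},\dots,k_r)$, $\boldsymbol{k}_{[1,j)}=(k_1,\dots,k_{j-1})$, with $\boldsymbol{k}_{(r,r]}=\boldsymbol{k}_{[1,1)}=\varnothing$. An index is admissible if it is empty or its last entry is $\geqslant2$. For $N\geqslant1$, $\mathcal T_N(\boldsymbol{k};s)=\sum_{-N<n_1<\cdots<n_r<N}\prod_{i=1}^r(n_i+s)^{-k_i}$, and $T_N=\sum_{n=1}^{N-1}\frac1n$. Monotangents: $\mathcal T(k;s)=\sum_{n\in\mathbb Z}(n+s)^{-k}$ for $k\geqslant2$ and $\mathcal T(1;s)=\pi\cot(\pi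 s)$. Stuffle-regularized multiple zeta values. For a nonempty admissible index $\boldsymbol{a}=(a_1,\dots,a_d)$, $\zeta(\boldsymbol{a})=\sum_{0<n_1<\cdots<n_d}\prod_{i}n_i^{-a_i}$, and $\zeta(\varnothing)=1$. On the $\mathbb Q$-span of all indices, the stuffle product $*$ is bilinear with unit $\varnothing$ and $(a,\boldsymbol{\alpha})*(b,\boldsymbol{\beta})=(a,\boldsymbol{\alpha}*(b,\boldsymbol{\beta}))+(b,(a,\boldsymbol{\alpha})*\boldsymbol{\beta})+(a+b,\boldsymbol{\alpha}*\boldsymbol{\beta})$. It is known that every index of depth $r$ has a unique decomposition $\boldsymbol{k}=\sum_{l=0}^r\boldsymbol{u}_l*(1)^{*l}$ with each $\boldsymbol{u}_l$ in the span of admissible indices. Define the polynomial $\zeta_*^X(\boldsymbol{k})=\sum_{l=0}^r\zeta(\boldsymbol{u}_l)X^l$ (with $\zeta$ extended linearly), and, for $m\geqslant0$, $$\zeta_{*,m}^X(\boldsymbol{k})=\sum_{\substack{\lambda_1+\cdots+\lambda_r=m\\ \lambda_\nu\geqslant0}}\Bigl(\prod_{\nu=1}^r\tbinom{-k_\nu}{\lambda_\nu}\Bigr)\zeta_*^X(k_1+\lambda_1,\dots,k_r+\lambda_r),\qquad \zeta_{*,m}^X(\varnothing)=\delta_{m,0}.$$ Coefficients. For $1\leqslant j\leqslant r$, $0\leqslant m\leqslant k_j-1$, $$C_{j,m}^{X}(\boldsymbol{k})=\sum_{\substack{a+b=m\\ a,b\geqslant0}}(-1)^{|\boldsymbol{k}_{[1,j)}|+a}\zeta_{*,a}^{X}\bigl(\overleftarrow{\boldsymbol{k}_{[1,j)}}\bigr)\zeta_{*,b}^{X}\bigl(\boldsymbol{k}_{(j,r]}\bigr),$$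 $$\mathcal R_{\boldsymbol{k}}(X,Y)=\sum_{j=1}^{r}\sum_{\substack{a+b=k_j-1\\ a,b\geqslant0}}(-1)^{|\boldsymbol{k}_{[1,j)}|+a}\zeta_{*,a}^{X}\bigl(\overleftarrow{\boldsymbol{k}_{[1,j)}}\bigr)\zeta_{*,b}^{Y}\bigl(\boldsymbol{k}_{(j,r]}\bigr),\qquad C_1^X(\boldsymbol{k})=\mathcal R_{\boldsymbol{k}}(X,X)=\sum_{j=1}^rC_{j,k_j-1}^X(\boldsymbol{k}),$$ $$C_0^{X}(\boldsymbol{k})=\int_0^1\frac{\mathcal R_{\boldsymbol{k}}(X+\log(1+t),X+\log(1-t))-\mathcal R_{\boldsymbol{k}}(X+\log(1-t),X+\log(1+t))}{t}\,dt$$ (a convergent integral). *)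

(* Defs.v *)
From HB Require Import structures.
From mathcomp Require Import all_boot all_order all_algebra.
From mathcomp Require Import all_classical all_reals all_analysis.
From mathcomp Require Import complex.
From mathcomp Require Import finmap.
(* The notations of monalg are incompatible with those of MathComp-Analysis. *)
From mathcomp Require monalg.
Import -(notations) monalg.

Set Implicit Arguments.
Unset Strict Implicit.
Unset Printing Implicit Defensive.

Import Order.TTheory GRing.Theory Num.Theory.
Import numFieldNormedType.Exports.

Local Open Scope classical_set_scope.
Local Open Scope ring_scope.
Local Open Scope complex_scope.

Definition is_index (k : seq nat) : bool := all (fun n => 0 < n)%N k.

Definition admissible (k : seq nat) : bool := is_index k && (1 < last 2 k)%N.

(* The Q-vector space freely spanned by the finite sequences of naturals; the
   Q-span of all indices is the subspace supported on genuine indices. *)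
Notation qspan := (malg (seq nat) rat).

Definition monomial (c : rat) (k : seq nat) : qspan := mkmalgU k c.

(* The terms of the stuffle product of two indices, listed with multiplicity. *)
Fixpoint stuffle_terms (s : seq nat) : seq nat -> seq (seq nat) :=
  if s is a :: s' then
    fix aux (t : seq nat) : seq (seq nat) :=
      if t is b :: t' then
        map (cons a) (stuffle_terms s' t) ++ map (cons b) (aux t')
          ++ map (cons (a + b)%N) (stuffle_terms s' t')
      else [:: s]
  else fun t => [:: t].

Lemma stuffle_terms_cons a s b t :
  stuffle_terms (a :: s) (b :: t) =
  map (cons a) (stuffle_terms s (b :: t))
    ++ map (cons b) (stuffle_terms (a :: s) t)
    ++ map (cons (a + b)%N) (stuffle_terms s t).
Proof. by []. Qed.

Definition stuffle (u v : qspan) : qspan :=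
  \sum_(s <- msupp u) \sum_(t <- msupp v) \sum_(w <- stuffle_terms s t)
    monomial (mcoeff s u * mcoeff t v) w.

Definition stuffle_pow1 (l : nat) : qspan :=
  iter l (stuffle (monomial 1 [:: 1%N])) (monomial 1 [::]).

Definition in_admissible_span (u : qspan) : Prop :=
  forall a, a \in msupp u -> admissible a.

Definition is_reg_decomp (k : seq nat)
    (u : {ffun 'I_(size k).+1 -> qspan}) : Prop :=
  (forall l, in_admissible_span (u l)) /\
  monomial 1 k = \sum_(l < (size k).+1) stuffle (u l) (stuffle_pow1 l).

(* The decomposition exists and is unique for every index. *)
Definition reg_decomp (k : seq nat) : {ffun 'I_(size k).+1 -> qspan} :=
  xget [ffun=> 0] [set u | is_reg_decomp u].

Section RealDefs.
Variable R : realType.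

(* The summands are nonnegative, so the nested series is an unordered sum; the
   empty index gives 1. *)
Definition mzv (a : seq nat) : R :=
  fine (\esum_(n in [set n : (size a).-tuple nat | path ltn 0%N n])
          (\prod_(i < size a) ((tnth n i)%:R : R) ^- nth 0%N a i)%:E).

Definition mzv_lin (u : qspan) : R :=
  \sum_(a <- msupp u) ratr (mcoeff a u) * mzv a.

Definition zeta_star (k : seq nat) : {poly R} :=
  \sum_(l < (size k).+1) mzv_lin (reg_decomp k l) *: 'X^l.

Definition gbinom (x : R) (n : nat) : R :=
  (\prod_(i < n) (x - i%:R)) / n`!%:R.

Definition zeta_star_m (m : nat) (k : seq nat) : {poly R} :=
  if k is [::] then (m == 0%N)%:R
  else \sum_(l : {ffun 'I_(size k) -> 'I_m.+1} | (\sum_i l i)%N == m)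
    (\prod_(i < size k) gbinom (- (nth 0%N k i)%:R) (l i)) *:
      zeta_star [seq (nth 0 k i + l i)%N | i : 'I_(size k)].

(* Positions are numbered from 0: j stands for the (j+1)-st entry, so that
   [take j k] and [drop j.+1 k] are the parts of k before and after it. *)
Definition Cxy (k : seq nat) (j m : nat) (X Y : R) : R :=
  \sum_(a < m.+1)
    (-1) ^+ (sumn (take j k) + a)
      * (zeta_star_m a (rev (take j k))).[X]
      * (zeta_star_m (m - a) (drop j.+1 k)).[Y].

Definition C_ (k : seq nat) (j m : nat) (X : R) : R := Cxy k j m X X.

Definition calR (k : seq nat) (X Y : R) : R :=
  \sum_(j < size k) Cxy k j (nth 0%N k j).-1 X Y.

Definition C1 (k : seq nat) (X : R) : R := calR k X X.

Definition C0 (k : seq nat) (X : R) : R :=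
  (\int[lebesgue_measure]_(t in `]0%R, 1%R[)
    ((calR k (X + ln (1 + t)) (X + ln (1 - t))
      - calR k (X + ln (1 - t)) (X + ln (1 + t))) / t))%R.

Definition harmonicT (N : nat) : R := \sum_(1 <= n < N) n%:R^-1.

(* The map m |-> m + 1 - N is an increasing bijection from 'I_(2N-1) onto the
   integers strictly between -N and N. *)
Definition trunc_multitangent (N : nat) (k : seq nat) (s : R[i]) : R[i] :=
  \sum_(n : (size k).-tuple 'I_(2 * N).-1 | sorted ltn (map val n))
    \prod_(i < size k)
      (((tnth n i).+1%:Z - N%:Z)%:~R + s) ^- nth 0%N k i.

Definition expC (z : R[i]) : R[i] :=
  let: x +i* y := z in (expR x * cos y) +i* (expR x * sin y).

Definition iC : R[i] := 0 +i* 1.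

Definition cosC (z : R[i]) : R[i] := (expC (iC * z) + expC (- (iC * z))) / 2.

Definition sinC (z : R[i]) : R[i] :=
  (expC (iC * z) - expC (- (iC * z))) / (2 * iC).

Definition cotC (z : R[i]) : R[i] := cosC z / sinC z.

(* R[i]^o is R[i] with its normed-module topology. *)
Definition bilateral_sum (u : int -> R[i]) : R[i] :=
  limn (series (fun n => u n%:Z : R[i]^o))
  + limn (series (fun n => u (- n.+1%:Z) : R[i]^o)).

Definition monotangent (k : nat) (s : R[i]) : R[i] :=
  if k == 1%N then (pi : R)%:C * cotC ((pi : R)%:C * s)
  else bilateral_sum (fun n => (n%:~R + s) ^- k).

End RealDefs.

(* Main.v *)
Require Import Defs.
From HB Require Import structures.
From mathcomp Require Import all_boot all_order all_algebra.
From mathcomp Require Import all_classical all_reals all_analysis.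
From mathcomp Require Import measurable_realfun complex.
From mathcomp Require Import finmap.
From mathcomp Require Import ring lra zify.
From mathcomp Require monalg.
Import -(notations) monalg.

Import Order.TTheory GRing.Theory Num.Theory.
Import numFieldNormedType.Exports.

Local Open Scope classical_set_scope.
Local Open Scope ring_scope.
Local Open Scope complex_scope.

Set Implicit Arguments.
Unset Strict Implicit.
Unset Printing Implicit Defensive.


(** Each summand of the truncated multitangent is a product of powers of
    [(n_i + s)^-1] with distinct integers [n_i], so it splits into partial
    fractions in [s]. Collecting the terms with a given pole [- n] of order
    [k_j - m], the coefficient factors into two multiple harmonic sums, over the
    entries before and after position [j]; after translation by [n] they are sums
    up to the cutoffs [N + n] and [N - n]. This gives an exact formula
    ([trunc_multitangent_expansion]) in which the coefficients [Ctrunc] have the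
    shape of the coefficients [Cxy] of the theorem, with multiple harmonic sums
    in place of regularized zeta values.

    The truncated sum up to [M] is a character of the stuffle algebra, sends
    the index [1] to the harmonic number [H M], and converges on admissible
    indices. Therefore it agrees with the regularized value at [X = H M] up to
    [(log M)^c / sqrt M] ([zeta_star_approx], which rests on the existence of the
    regularization, [reg_decompP]). Hence the coefficient at the pole [- n] is
    [Cxy] at the pair [(H (N + n), H (N - n))], up to a small error.

    For poles of order at least two, the kernels decay quadratically in [n]; only
    small [n] matter, both arguments may be replaced by [H N], and the sum over
    [n] is the monotangent ([multiple_pole]). For simple poles one writes
    [1 / (s + n) = 1 / n + O(1 / n^2)] and
    [1 / (s - n) = - 1 / n + O(1 / n^2)]. The remainders are treated in
    the same way and, by Euler's expansion [cot_expansion], give the cotangent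
    with coefficient [C1] ([simple_pole]). The terms [1 / n] and [- 1 / n]
    contribute the sum of [(f(n) - f(-n)) / n], where [f] is the total
    coefficient of the simple poles. All [n] up to [N] matter here: since
    [H (N + n)] is close to [H N + ln (1 + n / N)], this is a Riemann sum with
    [N] cells of the integrand of [C0], up to a small error ([odd_part_C0]). The
    integrand is a combination of [ln (1 + t)^i * ln (1 - t)^l / t], reducible to
    monotone functions with logarithmic growth at [1]; for these, Riemann sums
    converge at the rate [1 / sqrt N] up to logarithms ([mono_riemann],
    [C0_riemann]).

    All errors are powers of [log N] times [1 / sqrt N], uniformly in [s] for
    bounded [s] in the strip that stay away from the origin. *)
(** * Sums over increasing sequences *)

(** Nested sums instead of sums indexed by increasing tuples: they can be cut
    at one entry, reflected and compared entry by entry. *)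
Fixpoint isum (V : nmodType) (r lo hi : nat) (F : seq nat -> V) : V :=
  if r is r'.+1 then \sum_(lo <= n < hi) isum r' n.+1 hi (fun t => F (n :: t))
  else F [::].

Lemma eq_isum (V : nmodType) r lo hi (F G : seq nat -> V) :
  (forall t, size t = r -> sorted ltn t ->
     all (fun n => lo <= n < hi)%N t -> F t = G t) ->
  isum r lo hi F = isum r lo hi G.
Proof.
elim: r lo F G => [|r IH] lo F G FG /=; first exact: FG.
apply: eq_big_nat => n /andP[len lnhi]; apply: IH => t st sot tb.
apply: FG => /=; first by rewrite st.
- rewrite path_min_sorted //; apply/allP => x xt.
  by have /andP[] := allP tb _ xt.
- rewrite len lnhi /=; apply/allP => x xt.
  have /andP[nx ->] := allP tb _ xt.
  by rewrite andbT (leq_trans len) // ltnW.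
Qed.

Lemma raddf_isum (V W : nmodType) (f : {additive V -> W}) r lo hi F :
  f (isum r lo hi F) = isum r lo hi (fun t => f (F t)).
Proof.
elim: r lo F => [//|r IH] lo F /=.
by rewrite raddf_sum; apply: eq_bigr => n _; rewrite IH.
Qed.

Lemma isum_big (V : nmodType) (I : Type) (s : seq I) (P : pred I) r lo hi
    (F : I -> seq nat -> V) :
  isum r lo hi (fun t => \sum_(i <- s | P i) F i t)
  = \sum_(i <- s | P i) isum r lo hi (F i).
Proof.
elim: r lo F => [//|r IH] lo F /=.
by rewrite exchange_big /=; apply: eq_bigr => n _; rewrite IH.
Qed.

Lemma isumZl (A : pzSemiRingType) r lo hi (a : A) F :
  isum r lo hi (fun t => a * F t) = a * isum r lo hi F.
Proof.
elim: r lo F => [//|r IH] lo F /=.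
by rewrite mulr_sumr; apply: eq_bigr => n _; rewrite IH.
Qed.

Lemma isumZr (A : pzSemiRingType) r lo hi (a : A) F :
  isum r lo hi (fun t => F t * a) = isum r lo hi F * a.
Proof.
elim: r lo F => [//|r IH] lo F /=.
by rewrite mulr_suml; apply: eq_bigr => n _; rewrite IH.
Qed.

Lemma isum_ge0 (R : numDomainType) r lo hi (F : seq nat -> R) :
  (forall t, 0 <= F t) -> 0 <= isum r lo hi F.
Proof.
by elim: r lo F => [|r IH] lo F F0 //=; apply: sumr_ge0 => n _; exact: IH.
Qed.

(** Once the entry in position [a] is chosen, the entries before it and those
    after it range independently. *)
Lemma isum_split (V : nmodType) a b lo hi (F : seq nat -> V) :
  isum (a + b.+1) lo hi F
  = \sum_(lo <= n < hi) isum a lo n (fun t1 =>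
      isum b n.+1 hi (fun t2 => F (t1 ++ n :: t2))).
Proof.
elim: a lo F => [|a IH] lo F; first by [].
rewrite addSn [LHS]/=.
under eq_bigr => n _ do rewrite IH.
rewrite /=.
transitivity (\sum_(lo <= n < hi) \sum_(lo <= m < hi | (n < m)%N)
  isum a n.+1 m (fun t1 => isum b m.+1 hi (fun t2 => F (n :: t1 ++ m :: t2)))).
  apply: eq_big_nat => n /andP[len nhi].
  rewrite [RHS](@big_cat_nat _ _ _ n.+1) //=; last exact: leqW.
  rewrite [X in _ = X + _]big_nat_cond [X in _ = X + _]big_pred0 ?add0r; last first.
    by move=> m; rewrite ltnS; case: (leqP m n); rewrite ?andbF.
  by rewrite big_nat_cond [RHS]big_nat_cond; apply: eq_bigl => m;
     case: (n < m)%N; rewrite ?andbT ?andbF.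
rewrite (exchange_big_dep_nat predT) //=.
apply: eq_big_nat => m /andP[lem mhi].
rewrite [LHS](@big_cat_nat _ _ _ m) //=; last exact: ltnW.
rewrite [X in _ + X]big_nat_cond [X in _ + X]big_pred0 ?addr0; last first.
  by move=> n; case: (leqP m n); rewrite ?andbF.
rewrite big_nat_cond [RHS]big_nat_cond; apply: eq_bigl => n.
by case: (n < m)%N; rewrite ?andbT ?andbF.
Qed.

Lemma isum_shift (V : nmodType) r lo hi c (F : seq nat -> V) :
  isum r (c + lo) (c + hi) F = isum r lo hi (fun t => F (map (addn c) t)).
Proof.
elim: r lo F => [//|r IH] lo F /=.
rewrite [(c + lo)%N]addnC big_addn [X in (X - _)%N]addnC addnK.
by apply: eq_bigr => n _; rewrite [(n + c)%N]addnC -addnS IH.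
Qed.

Lemma big_nat_reflect (V : nmodType) lo hi c (G : nat -> V) :
  (lo <= hi)%N -> (hi <= c.+1)%N ->
  \sum_(lo <= n < hi) G n = \sum_(c.+1 - hi <= p < c.+1 - lo) G (c - p)%N.
Proof.
move=> lohi hic.
rewrite -{1}[lo]add0n big_addn -[(c.+1 - hi)%N]add0n big_addn.
have -> : (c.+1 - lo - (c.+1 - hi) = hi - lo)%N by lia.
rewrite big_nat_rev; apply: eq_big_nat => i /andP[_ ih].
by congr G; lia.
Qed.

(** Reflecting the index set exchanges first and last entries, hence reverses
    the sequences. *)
Lemma isum_rev (V : nmodType) r lo hi c (F : seq nat -> V) : (hi <= c.+1)%N ->
  isum r lo hi F
  = isum r (c.+1 - hi) (c.+1 - lo) (fun t => F (rev (map (subn c) t))).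
Proof.
move=> hic; elim: r lo F => [//|r IH] lo F.
have [hilo|lohi] := leqP hi lo.
  by rewrite /= big_geq // big_geq // leq_sub2l.
rewrite -[r.+1 in RHS]addn1 isum_split [LHS]/=.
rewrite (big_nat_reflect _ (ltnW lohi) hic).
apply: eq_big_nat => p /andP[cp pc].
rewrite IH.
have -> : (c.+1 - (c - p).+1 = p)%N by lia.
apply: eq_isum => t _ _ _ /=.
by rewrite map_cat rev_cat.
Qed.

Lemma sum_tuple_cons (V : nmodType) (T : finType) r (P : pred (seq T))
    (F : seq T -> V) :
  \sum_(t : r.+1.-tuple T | P t) F t
  = \sum_x \sum_(t : r.-tuple T | P (x :: t)) F (x :: t).
Proof.
rewrite pair_big_dep /=.
rewrite (reindex (fun p : T * r.-tuple T => cons_tuple p.1 p.2)) //=.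
exists (fun t => (thead t, [tuple of behead t])) => [[x t] _|t _] /=.
  by rewrite theadE; congr pair; apply: val_inj.
by apply: val_inj; rewrite /= [in RHS](tuple_eta t).
Qed.

(** The lower bound [lo] is there for the induction on [r]: the tail of the
    tuple starts above its head. *)
Lemma sum_tuple_isum_ge (V : nmodType) r lo M (F : seq nat -> V) :
  \sum_(n : r.-tuple 'I_M | all (leq lo) (map val n) && sorted ltn (map val n))
     F (map val n)
  = isum r lo M F.
Proof.
elim: r lo F => [|r IH] lo G.
  rewrite (big_pred1 ([tuple] : 0.-tuple 'I_M)) // => t.
  by rewrite tuple0 /= eqxx.
rewrite (sum_tuple_cons r (fun t => all (leq lo) (map val t)
      && sorted ltn (map val t)) (fun t => G (map val t))) /=.
rewrite (big_nat_widenl _ 0) // big_mkord /=.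
rewrite [RHS]big_mkcond /=; apply: eq_bigr => x _.
have [lox|] := leqP lo x; last by rewrite big_pred0.
rewrite -IH; apply: eq_bigl => t.
rewrite path_sortedE; last exact: ltn_trans.
rewrite andbA; congr andb; apply/andP/idP => [[_ //]|xt]; split=> //.
by apply/allP => y /(allP xt) xy; rewrite (leq_trans lox) // ltnW.
Qed.

Lemma sum_tuple_isum (V : nmodType) r M (F : seq nat -> V) :
  \sum_(n : r.-tuple 'I_M | sorted ltn (map val n)) F (map val n)
  = isum r 0 M F.
Proof.
rewrite -sum_tuple_isum_ge; apply: eq_bigl => n.
by rewrite (_ : all _ _ = true) //; apply/allP.
Qed.

(** * Stuffle products and truncated zeta values *)

Definition prodz (A : pzSemiRingType) (f : nat -> nat -> A) (k t : seq nat) : A :=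
  \prod_(i < size k) f (nth 0%N k i) (nth 0%N t i).

Lemma prodz_cons (A : pzSemiRingType) (f : nat -> nat -> A) a k n t :
  prodz f (a :: k) (n :: t) = f a n * prodz f k t.
Proof. by rewrite /prodz big_ord_recl. Qed.

Lemma prodz_cat (A : pzSemiRingType) (f : nat -> nat -> A) k1 k2 t1 t2 :
  size t1 = size k1 ->
  prodz f (k1 ++ k2) (t1 ++ t2) = prodz f k1 t1 * prodz f k2 t2.
Proof.
elim: k1 t1 => [|a k1 IH] [|n t1] //=; first by rewrite {2}/prodz big_ord0 mul1r.
by move=> [/IH e]; rewrite !prodz_cons e mulrA.
Qed.

Lemma prodz_rev (A : comPzSemiRingType) (f : nat -> nat -> A) k t :
  size t = size k -> prodz f (rev k) (rev t) = prodz f k t.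
Proof.
elim: k t => [|a k IH] [|n t] //= [st].
rewrite !rev_cons -!cats1 prodz_cat ?size_rev // IH // !prodz_cons.
by rewrite {2}/prodz big_ord0 mulr1 mulrC.
Qed.

Lemma prodz_map (A : pzSemiRingType) (f : nat -> nat -> A) (g : nat -> nat) k t :
  size t = size k ->
  prodz f k (map g t) = prodz (fun a n => f a (g n)) k t.
Proof.
by move=> st; apply: eq_bigr => i _; rewrite (nth_map 0%N) // st.
Qed.

Lemma eq_prodz (A : pzSemiRingType) (f g : nat -> nat -> A) k t :
  (forall a n, a \in k -> n \in t -> f a n = g a n) -> size t = size k ->
  prodz f k t = prodz g k t.
Proof.
by move=> fg st; apply: eq_bigr => i _; apply: fg; rewrite mem_nth // st.
Qed.

Section TruncZeta.
Variable F : fieldType.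

(** Multiple harmonic sums. The lower cutoff makes them recursive in the first
    entry; the field is left open because real and complex values occur. *)
Definition tzeta (lo M : nat) (w : seq nat) : F :=
  isum (size w) lo M (prodz (fun a n => n%:R ^- a) w).

Lemma tzeta_nil lo M : tzeta lo M [::] = 1.
Proof. by rewrite /tzeta /= /prodz big_ord0. Qed.

Lemma tzeta_cons lo M a w :
  tzeta lo M (a :: w) = \sum_(lo <= n < M) n%:R ^- a * tzeta n.+1 M w.
Proof.
by apply: eq_bigr => n _; rewrite -isumZl; apply: eq_isum => t _ _ _;
   rewrite prodz_cons.
Qed.

Lemma mul_sum_nat (f g : nat -> F) lo M :
  (\sum_(lo <= n < M) f n) * (\sum_(lo <= n < M) g n)
  = \sum_(lo <= n < M) f n * (\sum_(n.+1 <= m < M) g m)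
    + \sum_(lo <= n < M) g n * (\sum_(n.+1 <= m < M) f m)
    + \sum_(lo <= n < M) f n * g n.
Proof.
have [lM|/ltnW Mlo] := leqP lo M; last first.
  by rewrite !(big_geq Mlo) mul0r !addr0.
rewrite -(subnKC lM); move: (M - lo)%N => d {lM}.
elim: d lo => [|d IH] lo; first by rewrite addn0 !(big_geq (leqnn _)) mul0r !addr0.
have h : (lo < lo + d.+1)%N by rewrite addnS ltnS leq_addr.
rewrite !(big_ltn h).
have := IH lo.+1; rewrite addSnnS.
set A := \sum_(_ <= _ < _) f _; set B := \sum_(_ <= _ < _) g _.
by rewrite mulrDl !mulrDr => ->; rewrite [A * g lo]mulrC; ring.
Qed.

(** Sorting the pairs of summation indices by their smallest entry gives the
    recursion of the stuffle product. *)
Lemma tzetaM lo M s t :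
  tzeta lo M s * tzeta lo M t = \sum_(w <- stuffle_terms s t) tzeta lo M w.
Proof.
elim: s t lo => [|a s IHs] t lo; first by rewrite /= tzeta_nil mul1r big_seq1.
elim: t lo => [|b t IHt] lo; first by rewrite /= tzeta_nil mulr1 big_seq1.
rewrite stuffle_terms_cons !big_cat !big_map /=.
under [in RHS]eq_bigr => w _ do rewrite tzeta_cons.
under [X in _ + (X + _)]eq_bigr => w _ do rewrite tzeta_cons.
under [X in _ + (_ + X)]eq_bigr => w _ do rewrite tzeta_cons.
rewrite ![\sum_(i <- _) \sum_(_ <= _ < _) _]exchange_big /=.
rewrite [tzeta lo M (a :: s)]tzeta_cons [tzeta lo M (b :: t)]tzeta_cons.
rewrite mul_sum_nat addrA; congr (_ + _ + _).
- apply: eq_bigr => n _; rewrite -mulr_sumr -IHs -tzeta_cons.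
  by rewrite -mulrA.
- apply: eq_bigr => n _; rewrite -mulr_sumr -IHt -tzeta_cons.
  by rewrite -mulrA [tzeta _ _ t * _]mulrC.
- apply: eq_bigr => n _; rewrite -mulr_sumr -IHs exprD invfM.
  by rewrite mulrACA.
Qed.

End TruncZeta.

Section Span.
Variable V : zmodType.
Variable F : rat -> seq nat -> V.
Hypothesis FD : forall c d s, F (c + d) s = F c s + F d s.

(** The map on the rational span determined by its values on multiples of basis
    elements. *)
Definition msum (u : qspan) : V := \sum_(s <- msupp u) F (mcoeff s u) s.

Let F0 s : F 0 s = 0.
Proof. by apply: (addIr (F 0 s)); rewrite -FD !add0r. Qed.

Lemma msumEw (d : {fset seq nat}) u : (msupp u `<=` d)%fset ->
  msum u = \sum_(s <- d) F (mcoeff s u) s.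
Proof.
move=> ud; rewrite /msum (big_fset_incl _ ud) // => s _.
by move/mcoeff_outdom => ->.
Qed.

Lemma msumD u v : msum (u + v) = msum u + msum v.
Proof.
rewrite (@msumEw (msupp u `|` msupp v)%fset u) ?fsubsetUl //.
rewrite (@msumEw (msupp u `|` msupp v)%fset v) ?fsubsetUr //.
rewrite (msumEw (msuppD_le u v)) -big_split /=.
by apply: eq_bigr => s _; rewrite mcoeffD FD.
Qed.

Lemma msumU c s : msum (monomial c s) = F c s.
Proof.
rewrite (msumEw msuppU_le) big_seq_fset1 mcoeffUU.
by [].
Qed.

Lemma msum0 : msum 0 = 0.
Proof. by apply: (addIr (msum 0)); rewrite -msumD !add0r. Qed.

Lemma msum_sum (I : Type) (r : seq I) (P : pred I) (G : I -> qspan) :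
  msum (\sum_(i <- r | P i) G i) = \sum_(i <- r | P i) msum (G i).
Proof. by rewrite (big_morph _ msumD msum0). Qed.

End Span.

Lemma monomialD c d s : monomial (c + d) s = monomial c s + monomial d s.
Proof. exact: monalgUD. Qed.

Lemma malgE (u : qspan) : u = \sum_(s <- msupp u) monomial (mcoeff s u) s.
Proof. exact: monalgE. Qed.

Lemma scale_monomial (a c : rat) s : a *: monomial c s = monomial (a * c) s.
Proof. by apply/malgP => t; rewrite mcoeffZ !mcoeffU mulrnAr. Qed.

Definition stuffle_basis c s d t : qspan :=
  \sum_(w <- stuffle_terms s t) monomial (c * d) w.

Lemma stuffle_basisDr c s d d' t :
  stuffle_basis c s (d + d') t = stuffle_basis c s d t + stuffle_basis c s d' t.
Proof.
by rewrite -big_split; apply: eq_bigr => w _; rewrite mulrDr monomialD.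
Qed.

Lemma stuffle_basisDl c c' s d t :
  stuffle_basis (c + c') s d t = stuffle_basis c s d t + stuffle_basis c' s d t.
Proof.
by rewrite -big_split; apply: eq_bigr => w _; rewrite mulrDl monomialD.
Qed.

Lemma stuffleE u v : stuffle u v = msum (fun c s => msum (stuffle_basis c s) v) u.
Proof. by []. Qed.

Lemma msum_basisDl v c d s : msum (stuffle_basis (c + d) s) v
  = msum (stuffle_basis c s) v + msum (stuffle_basis d s) v.
Proof.
by rewrite /msum -big_split; apply: eq_bigr => t _; rewrite stuffle_basisDl.
Qed.

Lemma stuffle_suml (I : Type) (r : seq I) (P : pred I) (G : I -> qspan) v :
  stuffle (\sum_(i <- r | P i) G i) v = \sum_(i <- r | P i) stuffle (G i) v.
Proof. by rewrite stuffleE msum_sum // => *; exact: msum_basisDl. Qed.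

Lemma stuffle_sumr (I : Type) (r : seq I) (P : pred I) (G : I -> qspan) u :
  stuffle u (\sum_(i <- r | P i) G i) = \sum_(i <- r | P i) stuffle u (G i).
Proof.
rewrite stuffleE /msum [RHS](exchange_big_dep predT) //=.
apply: eq_bigr => s _.
rewrite -[LHS]/(msum (stuffle_basis (mcoeff s u) s) _).
rewrite msum_sum; last by move=> *; exact: stuffle_basisDr.
by apply: eq_bigl => i; rewrite andbT.
Qed.

Lemma stuffleU c s d t :
  stuffle (monomial c s) (monomial d t)
  = \sum_(w <- stuffle_terms s t) monomial (c * d) w.
Proof.
rewrite stuffleE msumU; last by move=> *; exact: msum_basisDl.
by rewrite msumU // => *; exact: stuffle_basisDr.
Qed.

Lemma stuffleDl u u' v : stuffle (u + u') v = stuffle u v + stuffle u' v.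
Proof. by rewrite !stuffleE msumD // => *; exact: msum_basisDl. Qed.

Lemma stuffleZl a u v : stuffle (a *: u) v = a *: stuffle u v.
Proof.
rewrite (malgE u) scaler_sumr !stuffle_suml scaler_sumr.
apply: eq_bigr => s _; rewrite (malgE v) !stuffle_sumr.
rewrite scaler_sumr; apply: eq_bigr => t _.
rewrite scale_monomial !stuffleU scaler_sumr.
by apply: eq_bigr => w _; rewrite scale_monomial mulrA.
Qed.

Lemma stuffle_terms_nilr s : stuffle_terms s [::] = [:: s].
Proof. by case: s. Qed.

Section StuffleOne.
Variable V : zmodType.

Definition stuffle1_sum (f : seq nat -> V) w :=
  \sum_(x <- stuffle_terms [:: 1%N] w) f x.

Lemma stuffle1_sum_nil f : stuffle1_sum f [::] = f [:: 1%N].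
Proof. by rewrite /stuffle1_sum big_seq1. Qed.

Lemma stuffle1_sum_cons f c w : stuffle1_sum f (c :: w)
  = f [:: 1%N, c & w] + stuffle1_sum (fun x => f (c :: x)) w + f (c.+1 :: w).
Proof.
by rewrite /stuffle1_sum stuffle_terms_cons !big_cat !big_map /= !big_seq1 addrA.
Qed.

Lemma stuffle_sum_cons (f : seq nat -> V) a s b t :
  \sum_(w <- stuffle_terms (a :: s) (b :: t)) f w
  = \sum_(w <- stuffle_terms s (b :: t)) f (a :: w)
    + \sum_(w <- stuffle_terms (a :: s) t) f (b :: w)
    + \sum_(w <- stuffle_terms s t) f ((a + b)%N :: w).
Proof. by rewrite stuffle_terms_cons !big_cat !big_map /= addrA. Qed.

(** Both sides satisfy the same recursion. This fragment of the associativity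
    and commutativity of the stuffle product is all that the existence of the
    regularization requires. *)
Lemma stuffle1_comm (f : seq nat -> V) s t :
  \sum_(w <- stuffle_terms s t) stuffle1_sum f w
  = stuffle1_sum (fun w => \sum_(x <- stuffle_terms s w) f x) t.
Proof.
elim: s t f => [|a s IHs] t f.
  by rewrite big_seq1 /stuffle1_sum; apply: eq_bigr => w _; rewrite big_seq1.
elim: t f => [|b t IHt] f.
  rewrite stuffle_terms_nilr big_seq1 stuffle1_sum_nil stuffle1_sum_cons.
  rewrite stuffle_sum_cons !stuffle_terms_nilr !big_seq1 addn1.
  have := IHs [::] (fun x => f (a :: x)).
  rewrite stuffle_terms_nilr big_seq1 stuffle1_sum_nil => ->.
  by rewrite [f _ + _]addrC.
rewrite stuffle_sum_cons.
under eq_bigr => w _ do rewrite stuffle1_sum_cons.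
under [X in _ + X + _]eq_bigr => w _ do rewrite stuffle1_sum_cons.
under [X in _ + X]eq_bigr => w _ do rewrite stuffle1_sum_cons.
rewrite !big_split !IHs IHt !stuffle1_sum_cons !stuffle_sum_cons.
have -> : stuffle1_sum (fun w => \sum_(x <- stuffle_terms (a :: s) (b :: w)) f x) t
  = stuffle1_sum (fun w => \sum_(x <- stuffle_terms s (b :: w)) f (a :: x)) t
  + stuffle1_sum (fun w => \sum_(x <- stuffle_terms (a :: s) w) f (b :: x)) t
  + stuffle1_sum (fun w => \sum_(x <- stuffle_terms s w) f ((a + b)%N :: x)) t.
  by rewrite /stuffle1_sum -!big_split; apply: eq_bigr => w _;
     rewrite stuffle_sum_cons.
rewrite !addn1 !addnS.
by rewrite [LHS](AC (1*3*1*3*3) (2*(1*6*9)*5*(3*7*10)*(4*8*11))).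
Qed.

(** The terms of the product of the index [1] with [w ++ w'] in which the new
    entry does not pass beyond [w]. *)
Fixpoint insert1 (w : seq nat) : seq (seq nat) :=
  if w is c :: w' then
    [:: [:: 1%N, c & w'], c.+1 :: w' & map (cons c) (insert1 w')]
  else [::].

Lemma stuffle1_sum_cat f k w :
  stuffle1_sum f (k ++ w) = \sum_(x <- insert1 k) f (x ++ w)
    + stuffle1_sum (fun x => f (k ++ x)) w.
Proof.
elim: k f => [|c k IH] f; first by rewrite big_nil add0r.
rewrite cat_cons stuffle1_sum_cons IH !big_cons big_map /=.
by rewrite [LHS](AC (1*2*1) (1*(4*2)*3)).
Qed.

Lemma stuffle1_sum_ones f m :
  stuffle1_sum f (nseq m 1%N) = f (nseq m.+1 1%N) *+ m.+1
    + \sum_(i < m) f (nseq i 1%N ++ 2%N :: nseq (m.-1 - i) 1%N).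
Proof.
elim: m f => [|m IH] f; first by rewrite stuffle1_sum_nil big_ord0 addr0.
rewrite stuffle1_sum_cons IH big_ord_recl subn0 [_ *+ m.+2]mulrSr.
rewrite [LHS](AC (1*2*1) ((2*1)*(4*3))); do 2!congr (_ + _).
by apply: eq_bigr => i _; rewrite /= /bump; congr (f (_ :: (_ ++ _ :: nseq _ _))); case: (m) i => [[]//|m' i]; rewrite /= add1n subSS.
Qed.

End StuffleOne.

Lemma stuffle1_monomial c w : stuffle (monomial 1 [:: 1%N]) (monomial c w)
  = stuffle1_sum (monomial c) w.
Proof. by rewrite stuffleU mul1r. Qed.

Lemma stuffle_1left_comm u v :
  stuffle u (stuffle (monomial 1 [:: 1%N]) v)
  = stuffle (monomial 1 [:: 1%N]) (stuffle u v).
Proof.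
rewrite (malgE u) !stuffle_suml [RHS]stuffle_sumr; apply: eq_bigr => s _.
rewrite (malgE v) !stuffle_sumr; apply: eq_bigr => t _.
rewrite stuffle1_monomial stuffleU !stuffle_sumr.
under [RHS]eq_bigr => w _ do rewrite stuffle1_monomial.
by rewrite stuffle1_comm; apply: eq_bigr => w _; rewrite stuffleU.
Qed.

Lemma insert1_admissible k w : admissible k -> w \in insert1 k -> admissible w.
Proof.
elim: k w => [//|c k IH] w /andP[/= /andP[c0 ik] lk].
rewrite !inE => /or3P[/eqP->|/eqP->|/mapP[x xk ->]].
- by rewrite /admissible /= c0 ik lk.
- rewrite /admissible /= ik; case: k lk {IH ik} => //= lc.
- have k0 : k != [::] by case: (k) xk.
  have ak : admissible k by rewrite /admissible ik; case: (k) k0 lk.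
  have := IH _ ak xk; rewrite /admissible /= c0 /= => /andP[-> lx] /=.
  by case: x xk lx => // xk; case: (k) xk => //= ? ? /=; rewrite !inE => /or3P[//|//|/mapP[]].
Qed.

(** Regularizable with a polynomial of degree at most [n]. *)
Definition decomposable n (u : qspan) : Prop :=
  exists U : nat -> qspan, (forall l, in_admissible_span (U l)) /\
    u = \sum_(l < n.+1) stuffle (U l) (stuffle_pow1 l).

Lemma in_admissible_span0 : in_admissible_span 0.
Proof. by move=> a; rewrite msupp0. Qed.

Lemma in_admissible_spanD u v : in_admissible_span u -> in_admissible_span v ->
  in_admissible_span (u + v).
Proof.
move=> Au Av a /(fsubsetP (msuppD_le u v)); rewrite inE => /orP[]; [exact: Au|exact: Av].
Qed.

Lemma in_admissible_spanZ c u : in_admissible_span u -> in_admissible_span (c *: u).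
Proof. by move=> Au a /(fsubsetP (msuppZ_le c u)); exact: Au. Qed.

Lemma stuffle0l v : stuffle 0 v = 0.
Proof. by have := stuffleZl 0 0 v; rewrite !scale0r. Qed.

Lemma decomposable0 n : decomposable n 0.
Proof.
exists (fun=> 0); split=> [l|]; first exact: in_admissible_span0.
by rewrite big1 // => l _; rewrite stuffle0l.
Qed.

Lemma decomposableD n u v :
  decomposable n u -> decomposable n v -> decomposable n (u + v).
Proof.
move=> [U [AU ->]] [W [AW ->]]; exists (fun l => U l + W l); split.
  by move=> l; apply: in_admissible_spanD.
by rewrite -big_split; apply: eq_bigr => l _; rewrite stuffleDl.
Qed.

Lemma decomposable_sum n (I : eqType) (r : seq I) (G : I -> qspan) :
  (forall i, i \in r -> decomposable n (G i)) ->
  decomposable n (\sum_(i <- r) G i).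
Proof.
elim: r => [|i r IH] H; first by rewrite big_nil; apply: decomposable0.
rewrite big_cons; apply: decomposableD; first by apply: H; rewrite mem_head.
by apply: IH => j jr; apply: H; rewrite inE jr orbT.
Qed.

Lemma decomposableZ n c u : decomposable n u -> decomposable n (c *: u).
Proof.
move=> [U [AU ->]]; exists (fun l => c *: U l); split.
  by move=> l; apply: in_admissible_spanZ.
by rewrite scaler_sumr; apply: eq_bigr => l _; rewrite stuffleZl.
Qed.

Lemma decomposable_le n m u : (n <= m)%N -> decomposable n u -> decomposable m u.
Proof.
move=> nm [U [AU ->]]; exists (fun l => if (l <= n)%N then U l else 0); split.
  by move=> l; case: ifP => // _; exact: in_admissible_span0.
rewrite (big_ord_widen m.+1 (fun l => stuffle (U l) (stuffle_pow1 l))) //.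
rewrite big_mkcond /=; apply: eq_bigr => l _; rewrite ltnS.
by case: ifP; rewrite ?stuffle0l.
Qed.

Lemma decomposable_stuffle1 n u :
  decomposable n u -> decomposable n.+1 (stuffle (monomial 1 [:: 1%N]) u).
Proof.
move=> [U [AU ->]]; exists (fun l => if l is l'.+1 then U l' else 0); split.
  by case=> [|l //]; exact: in_admissible_span0.
rewrite [RHS]big_ord_recl stuffle0l add0r stuffle_sumr.
by apply: eq_bigr => l _; rewrite -stuffle_1left_comm.
Qed.

Lemma in_admissible_span_monomial c k : admissible k -> in_admissible_span (monomial c k).
Proof.
by move=> Ak a /(fsubsetP msuppU_le); rewrite inE => /eqP->.
Qed.

Lemma admissible_cat2 k i : admissible k ->
  admissible (k ++ nseq i 1%N ++ [:: 2%N]).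
Proof.
move=> /andP[ik _]; rewrite /admissible !last_cat /= andbT.
by rewrite /is_index !all_cat -/(is_index k) ik /= all_nseq orbT.
Qed.

(** Multiplying an index with [m] final ones by [1] gives [m + 1] times the
    index with one more final one, plus indices with at most [m] final ones. *)
Lemma decomposable_ones m k : admissible k ->
  decomposable m (monomial 1 (k ++ nseq m 1%N)).
Proof.
have [n] := ubnP m; elim: n m k => // n IH [|m] k mn Ak.
  exists (fun=> monomial 1 k); split; first by move=> _; apply: in_admissible_span_monomial.
  by rewrite big_ord1 stuffleU stuffle_terms_nilr big_seq1 mul1r cats0.
have := stuffle1_monomial 1 (k ++ nseq m 1%N).
rewrite stuffle1_sum_cat stuffle1_sum_ones.
set S1 := \sum_(x <- _) _; set S2 := \sum_(i < m) _; set u := stuffle _ _ => e.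
have -> : monomial 1 (k ++ nseq m.+1 1%N) = m.+1%:R^-1 *: (u + (-1) *: (S1 + S2)).
  rewrite scaleN1r e [S1 + _]addrCA addrK -scaler_nat scalerA.
  by rewrite mulVf ?scale1r // pnatr_eq0.
apply: decomposableZ; apply: decomposableD.
  by apply: decomposable_stuffle1; apply: IH.
apply: decomposableZ; apply: decomposableD.
  apply: decomposable_sum => x xk; apply: (@decomposable_le m) => //.
  by apply: IH => //; apply: insert1_admissible xk.
apply: decomposable_sum => i _; apply: (@decomposable_le (m.-1 - i)).
  by rewrite (leq_trans (leq_subr _ _)) // (leq_trans (leq_pred _)).
have -> : k ++ nseq i 1%N ++ 2%N :: nseq (m.-1 - i) 1%N
  = (k ++ nseq i 1%N ++ [:: 2%N]) ++ nseq (m.-1 - i) 1%N by rewrite -!catA.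
apply: IH; last exact: admissible_cat2.
by rewrite (leq_ltn_trans (leq_subr _ _)) // (leq_ltn_trans (leq_pred _)).
Qed.

Lemma admissible_ones_split k : is_index k ->
  exists k' m, admissible k' /\ k = k' ++ nseq m 1%N.
Proof.
elim/last_ind: k => [|k c IH]; first by exists [::], 0%N.
rewrite /is_index all_rcons => /andP[c0 /IH [k' [m [Ak' ek]]]].
case: (ltngtP c 1) c0 => // [c1 _|-> _].
  exists (rcons k c), 0%N; rewrite cats0 /admissible last_rcons c1 andbT.
  split=> //; rewrite /is_index all_rcons (ltnW c1) ek all_cat.
  by case/andP: Ak' => [ik _]; rewrite -/(is_index k') ik all_nseq orbT.
by exists k', m.+1; split=> //; rewrite ek -cats1 -catA -[m.+1]addn1 nseqD.
Qed.

(** The product with the index [1] raises the number of final ones by one, up to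
    a nonzero integer factor and terms with fewer final ones; so the final ones
    can be removed by induction. *)
Theorem reg_decompP k : is_index k -> is_reg_decomp (reg_decomp k).
Proof.
move=> /admissible_ones_split [k' [m [Ak' ek]]].
rewrite /reg_decomp; case: xgetP => [u _ //|/(_ _) noD].
have /(decomposable_le (m := size k)) [|U [AU eU]] := decomposable_ones m Ak'.
  by rewrite ek size_cat size_nseq leq_addl.
case: (noD [ffun l : 'I_(size k).+1 => U l]); split=> [l|]; first by rewrite ffunE.
by rewrite {1}ek eU; apply: eq_bigr => l _; rewrite ffunE.
Qed.

(** * Partial fractions *)

Section CoefEq.
Variable A : comNzRingType.

(** Congruence modulo [X^B]. *)
Definition ceq B (p q : {poly A}) := forall i, (i < B)%N -> p`_i = q`_i.

Lemma ceqxx B p : ceq B p p. Proof. by []. Qed.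

Lemma ceq_trans B p q r : ceq B p q -> ceq B q r -> ceq B p r.
Proof. by move=> pq qr i iB; rewrite pq // qr. Qed.

Lemma ceqM B p p' q q' : ceq B p p' -> ceq B q q' -> ceq B (p * q) (p' * q').
Proof.
move=> pp qq i iB; rewrite !coefM; apply: eq_bigr => j _.
rewrite pp; last by rewrite (leq_ltn_trans _ iB) // -ltnS.
by rewrite qq // (leq_ltn_trans (leq_subr _ _) iB).
Qed.

Lemma ceq_prod B (I : Type) (r : seq I) (P : pred I) (p q : I -> {poly A}) :
  (forall i, P i -> ceq B (p i) (q i)) ->
  ceq B (\prod_(i <- r | P i) p i) (\prod_(i <- r | P i) q i).
Proof.
move=> pq; elim/big_rec2: _ => [|i x y Pi xy]; first exact: ceqxx.
by apply: ceqM => //; exact: pq.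
Qed.

Lemma ceq_take B (p : {poly A}) : ceq B (take_poly B p) p.
Proof. by move=> i iB; rewrite coef_take_poly iB. Qed.

Lemma coef_prod_ffun (r m : nat) (p : 'I_r -> {poly A}) :
  (\prod_(i < r) p i)`_m
  = \sum_(l : {ffun 'I_r -> 'I_m.+1} | (\sum_i l i)%N == m)
      \prod_(i < r) (p i)`_(l i).
Proof.
have -> : (\prod_(i < r) p i)`_m = (\prod_(i < r) take_poly m.+1 (p i))`_m.
  by apply: (@ceq_prod m.+1) => // i _ j jm; rewrite ceq_take.
under eq_bigr => i _.
  rewrite /take_poly poly_def. over.
rewrite bigA_distr_bigA coef_sum [RHS]big_mkcond /=.
apply: eq_bigr => l _.
have -> : \prod_(i < r) ((p i)`_(l i) *: 'X^(l i) : {poly A})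
  = (\prod_(i < r) (p i)`_(l i)) *: 'X^(\sum_i l i).
  by rewrite scaler_prod; congr (_ *: _); rewrite expr_sum.
by rewrite coefZ coefXn eq_sym; case: eqP; rewrite ?mulr1 ?mulr0.
Qed.

End CoefEq.

Section PartialFractions.
Variable F : fieldType.

(** The binomial coefficient of [-k] over [l], written so that it makes sense
    in every ring. *)
Definition nbin (k l : nat) : F := (-1) ^+ l * 'C((k + l).-1, l)%:R.

Lemma nbinS k l : nbin k.+1 l.+1 + nbin k.+1 l = nbin k l.+1.
Proof.
rewrite /nbin (_ : (k.+1 + l.+1).-1 = (k + l).+1)%N; last by lia.
rewrite (_ : (k.+1 + l).-1 = (k + l))%N; last by lia.
rewrite (_ : (k + l.+1).-1 = (k + l))%N; last by lia.
rewrite binS natrD exprS.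
by ring.
Qed.

Lemma nbin0r k : nbin k 0 = 1.
Proof. by rewrite /nbin bin0 mulr1. Qed.

(** The expansion of [(a + X) ^- k] modulo [X^B]. *)
Definition bser (B k : nat) (a : F) : {poly F} :=
  \poly_(l < B) (nbin k l * a ^- (k + l)).

Lemma bser_mul B k a : a != 0 -> ceq B (bser B k.+1 a * (a%:P + 'X)) (bser B k a).
Proof.
move=> a0 i iB; rewrite mulrDr coefD coefMC coefMX !coef_poly iB.
case: i iB => [|i] iB /=.
  rewrite !nbin0r !addn0 !mul1r addr0 exprS invfM mulrAC mulVf ?mul1r //.
have e1 : a ^- (k.+1 + i.+1) * a = a ^- (k + i.+1).
  by rewrite addSn exprS invfM mulrAC mulVf // mul1r.
by rewrite (ltn_trans _ iB) // -(nbinS k) [RHS]mulrDl -mulrA e1 addSnnS.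
Qed.

Lemma bserP B k a : a != 0 -> ceq B (bser B k a * (a%:P + 'X) ^+ k) 1.
Proof.
move=> a0; elim: k => [|k IH].
  move=> i iB; rewrite expr0 mulr1 coef_poly iB coef1 /nbin add0n.
  case: i {iB} => [|i]; first by rewrite !expr0 invr1 !mulr1.
  by rewrite bin_small // mulr0 mul0r.
apply: ceq_trans IH; rewrite exprS mulrA; apply: ceqM => //.
exact: bser_mul.
Qed.

Lemma dvdp_prod_coprime (I : eqType) (r : seq I) (p : I -> {poly F}) q :
  uniq r -> {in r &, forall i j, i != j -> coprimep (p i) (p j)} ->
  (forall i, i \in r -> p i %| q) -> \prod_(i <- r) p i %| q.
Proof.
elim: r => [|i r IH] /=; first by rewrite big_nil dvd1p.
move=> /andP[ir ur] cop dv; rewrite big_cons Gauss_dvdp.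
  rewrite dv ?mem_head //= IH // => [j l jr lr|j jr]; last first.
    by apply: dv; rewrite inE jr orbT.
  by apply: cop; rewrite inE ?jr ?lr orbT.
rewrite big_seq; elim/big_rec: _ => [|j x jr cx]; first exact: coprimep1.
rewrite coprimepMr cx andbT; apply: cop; rewrite ?mem_head ?inE ?jr ?orbT //.
by apply: contraNneq ir => ->.
Qed.

Variables (r : nat) (x : 'I_r -> F) (k : 'I_r -> nat).

(** The expansion at the pole [- x l] of the product of the other factors. *)
Definition pf_coef (l : 'I_r) : {poly F} :=
  \prod_(i < r | i != l) bser (k l) (k i) (x i - x l).

Hypothesis x_inj : injective x.
Hypothesis k_gt0 : forall i, (0 < k i)%N.
Hypothesis r_gt0 : (0 < r)%N.

Let D l : {poly F} := \prod_(i < r | i != l) ('X + (x i)%:P) ^+ k i.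
Let P l := take_poly (k l) (pf_coef l) \Po ('X + (x l)%:P).

Let XD_sub (a : F) : 'X + a%:P = 'X - (- a)%:P.
Proof. by rewrite polyCN opprK. Qed.

Let P_dvd l : ('X + (x l)%:P) ^+ k l %| P l * D l - 1.
Proof.
pose D' := \prod_(i < r | i != l) ((x i - x l)%:P + 'X) ^+ k i.
have eD : D l = D' \Po ('X + (x l)%:P).
  rewrite /D' rmorph_prod; apply: eq_bigr => i _.
  rewrite rmorphXn rmorphD /= comp_polyC comp_polyX; congr (_ ^+ _).
  by rewrite polyCB [RHS]addrCA subrK.
have : 'X^(k l) %| take_poly (k l) (pf_coef l) * D' - 1.
  set p := (X in _ %| X).
  suff t0 : take_poly (k l) p = 0.
    by rewrite -(poly_take_drop (k l) p) t0 add0r dvdp_mull.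
  apply/polyP => i; rewrite coef_take_poly coef0; case: ifP => // ik.
  rewrite coefB; apply/eqP; rewrite subr_eq0; apply/eqP.
  suff H : ceq (k l) (pf_coef l * D') 1.
    by rewrite -H //; apply: ceqM ik => //; exact: ceq_take.
  rewrite /pf_coef /D' -big_split /=.
  elim/big_rec: _ => [|j q jl cq]; first exact: ceqxx.
  apply: (@ceq_trans _ _ _ (1 * 1)); last by rewrite mulr1.
  apply: ceqM cq; apply: bserP.
  by rewrite subr_eq0 (inj_eq x_inj).
move=> /dvdpP [q e].
have -> : P l * D l - 1 = (q \Po ('X + (x l)%:P)) * ('X + (x l)%:P) ^+ k l.
  rewrite -[in _ ^+ k l](comp_polyX ('X + (x l)%:P)) -rmorphXn -rmorphM /= -e.
  by rewrite rmorphB rmorphM /= rmorph1 eD.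
exact: dvdp_mull.
Qed.

Let size_XDe (a : F) n : size (('X + a%:P) ^+ n) = n.+1.
Proof. by rewrite XD_sub size_exp_XsubC. Qed.

Let XDe_neq0 (a : F) n : ('X + a%:P) ^+ n != 0.
Proof. by rewrite -size_poly_eq0 size_XDe. Qed.

Let size_prod_XDe (Q : pred 'I_r) :
  size (\prod_(i < r | Q i) ('X + (x i)%:P) ^+ k i) = (\sum_(i < r | Q i) k i).+1.
Proof.
elim/big_rec2: _ => [|i n p _ sp]; first by rewrite size_poly1.
rewrite size_mul ?XDe_neq0 -?size_poly_eq0 ?sp //.
by rewrite size_XDe addnS.
Qed.

Lemma partial_fractions_poly : \sum_l P l * D l = 1.
Proof.
pose S : {poly F} := \sum_l P l * D l - 1.
suff : S == 0 by rewrite subr_eq0 => /eqP.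
pose Dt : {poly F} := \prod_(i < r) ('X + (x i)%:P) ^+ k i.
have DS : Dt %| S.
  apply: dvdp_prod_coprime => [|i j _ _ ij|l _].
  - exact: index_enum_uniq.
  - apply/coprimep_expl/coprimep_expr; rewrite !XD_sub coprimep_XsubC2 //.
    by rewrite opprK addrC subr_eq0 (inj_eq x_inj).
  - rewrite /S (bigD1 l) //= addrAC dvdp_addr; last exact: P_dvd.
    elim/big_ind: _ => [|p q|i il]; [exact: dvdp0|exact: dvdp_add|].
    by apply: dvdp_mull; rewrite /D (bigD1 l) 1?eq_sym //= dvdp_mulIl.
(* The degree of [S] is less than that of [Dt]. *)
apply: contraTT DS => S0; rewrite gtNdvdp //.
rewrite /Dt size_prod_XDe ltnS.
rewrite (leq_trans (size_polyD _ _)) // geq_max; apply/andP; split; last first.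
  rewrite size_polyN size_poly1 (bigD1 (Ordinal r_gt0)) //=.
  by rewrite (leq_trans (k_gt0 (Ordinal r_gt0))) ?leq_addr.
apply: (leq_trans (size_sum _ _ _)); apply/bigmax_leqP => l _.
rewrite (leq_trans (size_polyMleq _ _)) // size_prod_XDe addnS /=.
rewrite [leqRHS](bigD1 l) //= leq_add2r.
rewrite size_comp_poly2; first exact: size_take_poly.
by rewrite -[_ + _]expr1 size_XDe.
Qed.

(** For each [l], the numerators [P l] agree with the inverse of the remaining
    factors to order [k l] at [- x l]; by the Chinese remainder theorem and a
    degree count, the identity holds after clearing the denominators. *)
Theorem partial_fractions (y : F) : (forall i, x i + y != 0) ->
  \prod_(i < r) (x i + y) ^- k i
  = \sum_(l < r) \sum_(m < k l) (pf_coef l)`_m * (x l + y) ^- (k l - m).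
Proof.
move=> xy0.
have := congr1 (fun p => p.[y]) partial_fractions_poly; rewrite /= hornerC.
rewrite horner_sum => e1.
have hX i n : (('X + (x i)%:P) ^+ n).[y] = (x i + y) ^+ n.
  by rewrite horner_exp hornerD hornerX hornerC addrC.
rewrite -[LHS]mul1r -{1}e1 mulr_suml; apply: eq_bigr => l _.
rewrite (bigD1 l) //= hornerM mulrACA -[RHS]mulr1; congr (_ * _); last first.
  rewrite /D horner_prod -big_split big1 //= => i il.
  by rewrite hX mulfV // expf_neq0.
rewrite /P horner_comp hornerD hornerX hornerC horner_poly mulr_suml.
apply: eq_bigr => m _; rewrite -mulrA; congr (_ * _).
rewrite [y + _]addrC.
case: m => m /= /ltnW /subnK; move: (k l - m)%N => d <-.
by rewrite exprD invfM mulrC -mulrA mulVf ?mulr1 // expf_neq0.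
Qed.

End PartialFractions.

Lemma bser_opp (F : fieldType) B k (a : F) i :
  (bser B k (- a))`_i = (-1) ^+ (k + i) * (bser B k a)`_i.
Proof.
rewrite !coef_poly; case: ifP => _; last by rewrite mulr0.
by rewrite [(- a) ^+ _]exprNn invfM -exprVn invrN1 mulrCA.
Qed.


(** * The exact expansion of the truncated multitangent *)

Lemma sum_nth_sumn (k : seq nat) : (\sum_(i < size k) nth 0 k i)%N = sumn k.
Proof. by rewrite sumnE (big_nth 0%N) big_mkord. Qed.

Section TruncCoef.
Variable F : fieldType.

(** Generating polynomial, modulo [X^B], of the sums [tzeta_m] below. *)
Definition zpoly (B lo M : nat) (k : seq nat) : {poly F} :=
  isum (size k) lo M (prodz (fun a n => bser B a n%:R) k).

(** The counterpart of [zeta_star_m] with multiple harmonic sums in place of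
    regularized zeta values. *)
Definition tzeta_m (M m : nat) (k : seq nat) : F :=
  \sum_(l : {ffun 'I_(size k) -> 'I_m.+1} | (\sum_i l i)%N == m)
    (\prod_(i < size k) nbin F (nth 0%N k i) (l i))
      * tzeta F 1 M [seq (nth 0 k i + l i)%N | i : 'I_(size k)].

Lemma coef_zpoly B M m k : (m < B)%N -> (zpoly B 1 M k)`_m = tzeta_m M m k.
Proof.
move=> mB; rewrite /zpoly -[LHS]/(coefp m _) raddf_isum /=.
rewrite (eq_isum (G := fun t => \sum_(l : {ffun 'I_(size k) -> 'I_m.+1} |
   (\sum_i l i)%N == m) (\prod_(i < size k) nbin F (nth 0%N k i) (l i))
    * \prod_(i < size k) (nth 0%N t i)%:R ^- (nth 0 k i + l i))).
  rewrite isum_big; apply: eq_bigr => l _; rewrite isumZl; congr (_ * _).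
  rewrite /tzeta size_map size_enum_ord; apply: eq_isum => t _ _ _.
  rewrite /prodz size_map size_enum_ord; apply: eq_bigr => i _.
  by rewrite (nth_map i) ?size_enum_ord // nth_ord_enum.
move=> t _ _ _; rewrite /prodz coef_prod_ffun; apply: eq_bigr => l _.
rewrite -big_split; apply: eq_bigr => i _.
by rewrite coef_poly (leq_trans _ mB).
Qed.

Lemma coef_prodz_opp B k t m :
  (prodz (fun a n => bser B a (- n%:R : F)) k t)`_m
  = (-1) ^+ (sumn k + m) * (prodz (fun a n => bser B a n%:R) k t)`_m.
Proof.
rewrite /prodz !coef_prod_ffun mulr_sumr; apply: eq_bigr => l /eqP lm.
under eq_bigr => i _ do rewrite bser_opp.
rewrite big_split; congr (_ * _); rewrite -expr_sum; congr (_ ^+ _).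
by rewrite big_split /= sum_nth_sumn lm.
Qed.

Lemma prodz_skip (A : comPzSemiRingType) (f : nat -> nat -> A) k t1 n t2
    (l : 'I_(size k)) : size t1 = l ->
  \prod_(i < size k | i != l) f (nth 0%N k i) (nth 0%N (t1 ++ n :: t2) i)
  = prodz f (take l k) t1 * prodz f (drop l.+1 k) t2.
Proof.
move=> st1.
rewrite -(big_mkord (fun i => i != l :> nat)
   (fun i => f (nth 0%N k i) (nth 0%N (t1 ++ n :: t2) i))).
rewrite (@big_cat_nat _ _ _ l) //=; last exact: ltnW.
rewrite big_nat_cond (eq_bigl (fun i => (0 <= i < l)%N && true)) -?big_nat_cond; last first.
  by move=> i /=; rewrite andbT; case: ltngtP.
congr (_ * _).
  rewrite big_mkord /prodz size_takel; last exact: ltnW.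
  by apply: eq_bigr => i _; rewrite nth_take // nth_cat st1 ltn_ord.
rewrite big_ltn_cond // eqxx /= /prodz size_drop.
rewrite -{1}[l.+1]add0n big_addn big_mkord big_mkcond /=.
apply: eq_bigr => i _; rewrite (_ : (i + l.+1 != l)%N); last by lia.
rewrite nth_drop nth_cat st1 ltnNge [(l <= _)%N](_ : _ = true) /=; last by lia.
by rewrite addnC (_ : (l.+1 + i - l = i.+1)%N) //; lia.
Qed.

End TruncCoef.

Section Multitangent.
Variable R : realType.
Notation C := R[i].

(** The counterpart of [Cxy] for sums up to a cutoff. The two variables become
    two cutoffs because a pole off the origin sees unequally many terms on its
    two sides. *)
Definition Ctrunc (k : seq nat) (j m P Q : nat) : R :=
  \sum_(a < m.+1) (-1) ^+ (sumn (take j k) + a)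
    * tzeta_m R P a (rev (take j k)) * tzeta_m R Q (m - a) (drop j.+1 k).

Lemma tzeta_C lo M w : tzeta C lo M w = (tzeta R lo M w)%:C.
Proof.
rewrite /tzeta raddf_isum; apply: eq_isum => t _ _ _.
rewrite /prodz /= rmorph_prod; apply: eq_bigr => i _.
by rewrite fmorphV rmorphXn /= rmorph_nat.
Qed.

Lemma nbin_C k l : nbin C k l = (nbin R k l)%:C.
Proof. by rewrite /nbin rmorphM rmorphXn rmorphN1 rmorph_nat. Qed.

Lemma tzeta_m_C M m k : tzeta_m C M m k = (tzeta_m R M m k)%:C.
Proof.
rewrite /tzeta_m rmorph_sum; apply: eq_bigr => l _.
rewrite rmorphM rmorph_prod tzeta_C; congr (_ * _).
by apply: eq_bigr => i _; rewrite nbin_C.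
Qed.

Definition shift_int (N n : nat) : int := n.+1%:Z - N%:Z.

Lemma trunc_multitangentE N k s :
  trunc_multitangent N k s = isum (size k) 0 (2 * N).-1
    (prodz (fun a n => ((shift_int N n)%:~R + s : C) ^- a) k).
Proof.
rewrite -sum_tuple_isum; apply: eq_bigr => n _; apply: eq_bigr => i _.
by rewrite (nth_map (tnth n i)) ?size_tuple // -tnth_nth.
Qed.

Lemma left_sum B K n : forall N m, (m < B)%N ->
  (isum (size K) 0 n (prodz (fun a p =>
     bser B a ((shift_int N p)%:~R - (shift_int N n)%:~R : C)) K))`_m
  = (-1) ^+ (sumn K + m) * tzeta_m C n.+1 m (rev K).
Proof.
move=> N m mB; rewrite (@isum_rev _ _ _ _ n) // subSnn subn0.
rewrite -(coef_zpoly _ _ _ mB) /zpoly size_rev -[LHS]/(coefp m _) raddf_isum.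
rewrite -[in RHS]/(coefp m _) raddf_isum -isumZl; apply: eq_isum => t st _ bt /=.
rewrite -{1}[K]revK prodz_rev ?size_map ?size_rev // prodz_map ?size_rev //.
rewrite -sumn_rev -coef_prodz_opp; congr (_`_m).
apply: (congr1 (@polyseq _)); apply: eq_prodz; last by rewrite size_rev.
move=> a p _ /(allP bt) /andP[p1 pn]; congr bser.
rewrite /shift_int -rmorphB /= -[p%:R]/(p%:Z%:~R) -rmorphN; congr (_%:~R).
by rewrite opprB addrA subrK; lia.
Qed.

Lemma right_sum B K n M : forall N m, (n < M)%N -> (m < B)%N ->
  (isum (size K) n.+1 M (prodz (fun a p =>
     bser B a ((shift_int N p)%:~R - (shift_int N n)%:~R : C)) K))`_m
  = tzeta_m C (M - n) m K.
Proof.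
move=> N m nM mB; rewrite -{1}(subnKC (ltnW nM)) -addn1 isum_shift.
rewrite -(coef_zpoly _ _ _ mB) /zpoly; congr (_`_m).
apply: (congr1 (@polyseq _)).
apply: eq_isum => t st _ _; rewrite prodz_map //; apply: eq_prodz => // a p _ _.
congr bser; rewrite /shift_int -rmorphB /= -[p%:R]/(p%:Z%:~R); congr (_%:~R).
by rewrite opprB addrA subrK; lia.
Qed.

(** Summing the partial fractions of the individual terms, each coefficient
    factors through the terms before and after the one producing the pole. *)
Theorem trunc_multitangent_expansion N k (s : C) :
  is_index k -> (0 < size k)%N ->
  (forall n, (n < (2 * N).-1)%N -> (shift_int N n)%:~R + s != 0) ->
  trunc_multitangent N k s
  = \sum_(j < size k) \sum_(m < nth 0%N k j) \sum_(n < (2 * N).-1)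
      (Ctrunc k j m n.+1 ((2 * N).-1 - n))%:C
        * ((shift_int N n)%:~R + s) ^- (nth 0%N k j - m).
Proof.
move=> ik k0 sN; rewrite trunc_multitangentE.
set M := (2 * N).-1 in sN *.
pose X n : C := (shift_int N n)%:~R.
rewrite (eq_isum (G := fun t => \sum_(l < size k) \sum_(m < nth 0%N k l)
  (\prod_(i < size k | i != l) bser (nth 0%N k l) (nth 0%N k i)
     (X (nth 0%N t i) - X (nth 0%N t l)))`_m
   * (X (nth 0%N t l) + s) ^- (nth 0%N k l - m))); last first.
  move=> t st sot bt.
  rewrite -(@partial_fractions _ _ (fun i : 'I_(size k) => X (nth 0%N t i))
     (fun i => nth 0%N k i)) // => [i j /eqP||i].
  - rewrite /X eqr_int /shift_int (inj_eq (addIr _)) eqz_nat eqSS.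
    by rewrite nth_uniq ?st // => [/eqP/val_inj//|]; apply: sorted_uniq sot;
       [exact: ltn_trans|exact: ltnn].
  - by move=> i; apply: (allP ik); apply: mem_nth.
  - have := allP bt (nth 0%N t i); rewrite mem_nth ?st // => /(_ isT) /= h.
    exact: sN.
rewrite isum_big; apply: eq_bigr => j _.
have szk : size k = (size (take j k) + (size (drop j.+1 k)).+1)%N.
  by rewrite size_takel ?(ltnW (ltn_ord j)) // size_drop; have := ltn_ord j; lia.
set Fj := (X in isum _ _ _ X = _); rewrite [X in isum X _ _ _ = _]szk.
rewrite isum_split big_mkord exchange_big /=; apply: eq_bigr => n _.
rewrite /Fj => {Fj}.
pose G a p := bser (nth 0%N k j) a (X p - X n).
transitivity (\sum_(m < nth 0%N k j)
  (isum (size (take j k)) 0 n (prodz G (take j k))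
   * isum (size (drop j.+1 k)) n.+1 M (prodz G (drop j.+1 k)))`_m
   * (X n + s) ^- (nth 0%N k j - m)); last first.
  apply: eq_bigr => m _; rewrite /X; congr (_ * _).
  rewrite coefM rmorph_sum; apply: eq_bigr => a _.
  rewrite /= left_sum; last by rewrite (leq_ltn_trans _ (ltn_ord m)) // -ltnS.
  rewrite right_sum ?tzeta_m_C ?rmorphM ?rmorphXn ?rmorphN1 //.
  by rewrite (leq_ltn_trans (leq_subr _ _) (ltn_ord m)).
transitivity (isum (size (take j k)) 0 n (fun t1 =>
    isum (size (drop j.+1 k)) n.+1 M (fun t2 => \sum_(m < nth 0%N k j)
  (prodz G (take j k) t1 * prodz G (drop j.+1 k) t2)`_m
   * (X n + s) ^- (nth 0%N k j - m)))).
  apply: eq_isum => t1 st1 _ _; apply: eq_isum => t2 st2 _ _.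
  have e : size t1 = j by rewrite st1 size_takel // ltnW.
  have en : nth 0%N (t1 ++ (n : nat) :: t2) j = n by rewrite nth_cat e ltnn subnn.
  rewrite en; apply: eq_bigr => m _; congr (_`_m * _).
  apply: (congr1 (@polyseq _)); exact: (@prodz_skip _ (fun a p => bser (nth 0%N k j) a (X p - X n))).
under eq_isum => t1 _ _ _ do rewrite isum_big.
rewrite isum_big; apply: eq_bigr => m _.
rewrite -isumZr -[in RHS]/(coefp m _) raddf_isum -isumZr.
apply: eq_isum => t1 _ _ _; rewrite isumZr; congr (_ * _).
by rewrite -isumZl -[in RHS]/(coefp m _) raddf_isum.
Qed.

End Multitangent.

(** * Harmonic numbers and the size of truncated zeta values *)

Section Harmonic.
Variable R : realType.
Implicit Types (M N c : nat).
Local Notation H := (harmonicT R).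

Lemma natr_gt0R M : (0 < M)%N -> 0 < M%:R :> R.
Proof. by rewrite ltr0n. Qed.

Lemma harmonic1 : H 1 = 0. Proof. by rewrite /harmonicT big_geq. Qed.

Lemma harmonicS M : (0 < M)%N -> H M.+1 = H M + M%:R^-1.
Proof. by move=> M0; rewrite /harmonicT big_nat_recr. Qed.

Lemma ln_succ_le M : (0 < M)%N -> ln M.+1%:R - ln M%:R <= M%:R^-1 :> R.
Proof.
move=> M0; have M0R := natr_gt0R M0.
rewrite -ln_div ?posrE ?ltr0n // -natr1 mulrDl mulfV ?gt_eqF // mul1r.
by apply: le_ln1Dx; rewrite (lt_trans (ltrN10 R)) // invr_gt0.
Qed.

Lemma ln_succ_ge M : (0 < M)%N -> M.+1%:R^-1 <= ln M.+1%:R - ln M%:R :> R.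
Proof.
move=> M0; have M0R := natr_gt0R M0.
rewrite -lerN2 opprB -ln_div ?posrE ?ltr0n //.
have -> : M%:R / M.+1%:R = 1 + - M.+1%:R^-1 :> R.
  by rewrite -[M%:R](addrK 1) natr1 mulrBl mul1r mulfV ?pnatr_eq0.
apply: le_ln1Dx; rewrite ltrN2 invf_lt1 ?ltr0n // ltr1n ltnS //.
Qed.

(** Euler's constant is approached monotonically, with error at most [1 / M]. *)
Lemma harmonic_ln_diff M N : (0 < M)%N -> (M <= N)%N ->
  0 <= (H N - ln N%:R) - (H M - ln M%:R) <= M%:R^-1 - N%:R^-1.
Proof.
move=> M0 /subnKC <-; elim: (N - M)%N => [|d IH].
  by rewrite addn0 !subrr lexx.
have Md0 : (0 < M + d)%N by rewrite addn_gt0 M0.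
rewrite addnS harmonicS //.
have := ln_succ_le Md0; have := ln_succ_ge Md0; move: IH.
move: (_^-1) (_^-1) (_^-1) (ln _) (ln _) (ln _) (H _) (H _) => a b c d1 d2 d3 e f.
by move=> /andP[? ?] ? ?; apply/andP; split; lra.
Qed.

Lemma harmonic_ge_ln M : (0 < M)%N -> ln M%:R <= H M.
Proof.
move=> M0; have /andP[+ _] := harmonic_ln_diff (ltn0Sn 0) M0.
by rewrite harmonic1 ln1 !subr0 subr_ge0.
Qed.

Lemma harmonic_le_ln M : (0 < M)%N -> H M <= 1 + ln M%:R.
Proof.
move=> M0; have /andP[_] := harmonic_ln_diff (ltn0Sn 0) M0.
rewrite harmonic1 ln1 !subr0 invr1.
have : 0 < M%:R^-1 :> R by rewrite invr_gt0 ltr0n.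
by lra.
Qed.

Lemma harmonic_ge0 M : 0 <= H M.
Proof. by apply: sumr_ge0 => n _; rewrite invr_ge0. Qed.

Lemma harmonic_le M N : (M <= N)%N -> H M <= H N.
Proof.
move=> MN; have [M0|M0] := leqP M 0.
  by rewrite {1}/harmonicT big_geq ?harmonic_ge0 // (leq_trans M0).
rewrite /harmonicT [leRHS](@big_cat_nat _ _ _ M) //= lerDl.
by apply: sumr_ge0 => n _; rewrite invr_ge0.
Qed.

(** The logarithmic scale in which error terms are measured. *)
Definition lscale M : R := 1 + H M.

Lemma lscale_ge1 M : 1 <= lscale M.
Proof. by rewrite lerDl harmonic_ge0. Qed.

Lemma lscale_ge0 M : 0 <= lscale M.
Proof. by rewrite (le_trans ler01) // lscale_ge1. Qed.

Lemma lscale_le M N : (M <= N)%N -> lscale M <= lscale N.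
Proof. by move=> MN; rewrite lerD2l harmonic_le. Qed.

Lemma exprn_le_expR c (x : R) : 0 <= x -> x ^+ c <= c`!%:R * expR x.
Proof.
case: c => [|c] x0.
  by rewrite expr0 fact0 mul1r; apply: le_trans (expR_ge1Dx _); rewrite lerDl.
rewrite -ler_pdivrMl ?ltr0n ?fact_gt0 // [leLHS]mulrC.
by apply: le_trans (expR_ge1Dxn c x0); rewrite lerDr.
Qed.

(** [lscale M] is at most [2 + ln M], and a power is dominated by the
    exponential. *)
Lemma lscale_exp_le c M : (0 < M)%N ->
  lscale M ^+ c <= c`!%:R * expR 2 * M%:R.
Proof.
move=> M0; apply: (le_trans (exprn_le_expR c (lscale_ge0 M))).
rewrite -mulrA ler_wpM2l //.
rewrite -[in leRHS](@lnK _ M%:R) ?posrE ?ltr0n // -expRD ler_expR.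
by have := harmonic_le_ln M0; rewrite /lscale; lra.
Qed.

Lemma lscale_exp_le_sqrt c : exists C : R, 0 <= C /\
  forall M, (0 < M)%N -> lscale M ^+ c <= C * Num.sqrt M%:R.
Proof.
exists (Num.sqrt ((c * 2)`!%:R * expR 2)); split=> [|M M0]; first exact: sqrtr_ge0.
rewrite -sqrtrM ?mulr_ge0 ?expR_ge0 //.
rewrite -[leLHS]ger0_norm ?exprn_ge0 ?lscale_ge0 // -sqrtr_sqr -exprM.
by rewrite ler_wsqrtr // lscale_exp_le.
Qed.

Lemma sqrtn_gt0 M : (0 < M)%N -> 0 < Num.sqrt M%:R :> R.
Proof. by move=> M0; rewrite sqrtr_gt0 ltr0n. Qed.

Lemma sqrtn_sqr M : Num.sqrt M%:R * Num.sqrt M%:R = M%:R :> R.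
Proof. by rewrite -expr2 sqr_sqrtr. Qed.

(** The telescoping majorant of the series with exponent [3 / 2]. *)
Lemma inv_sqrt3_le n : (0 < n)%N ->
  (n%:R * Num.sqrt n%:R)^-1 <= 6 * ((Num.sqrt n%:R)^-1 - (Num.sqrt n.+1%:R)^-1) :> R.
Proof.
move=> n0; have a0 := sqrtn_gt0 n0; have b0 := sqrtn_gt0 (ltn0Sn n).
have ea := sqrtn_sqr n.
have eb : Num.sqrt n.+1%:R * Num.sqrt n.+1%:R = n%:R + 1 :> R by rewrite sqrtn_sqr natr1.
have n1 : 1 <= n%:R :> R by rewrite ler1n.
rewrite -[X in X * _]ea; move: ea eb.
set a := Num.sqrt n%:R in a0 *; set b := Num.sqrt n.+1%:R in b0 *; move=> ea eb.
have b2a : b <= 2 * a by nra.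
have eab : a^-1 - b^-1 = (a * b * (a + b))^-1.
  have h : b * b - a * a = 1 by rewrite ea eb addrAC subrr add0r.
  have -> : (a * b * (a + b))^-1 = (b * b - a * a) / (a * b * (a + b)).
    by rewrite h mul1r.
  by field; rewrite !gt_eqF //= addr_gt0.
have p1 : 0 < a * b * (a + b) by rewrite !mulr_gt0 ?addr_gt0.
have p2 : 0 < a * a * a by rewrite !mulr_gt0.
rewrite eab -[leLHS]mul1r ler_pdivrMr // mulrAC ler_pdivlMr // mul1r.
have h : b * (a + b) <= 6 * (a * a) by nra.
by have := ler_wpM2l (ltW a0) h; lra.
Qed.

Lemma sum_inv_sqrt3 M N : (0 < M)%N -> (M <= N)%N ->
  \sum_(M <= n < N) (n%:R * Num.sqrt n%:R)^-1 <= 6 * (Num.sqrt M%:R)^-1 :> R.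
Proof.
move=> M0 MN.
suff : \sum_(M <= n < N) (n%:R * Num.sqrt n%:R)^-1
   <= 6 * ((Num.sqrt M%:R)^-1 - (Num.sqrt N%:R)^-1) :> R.
  move=> h; apply: (le_trans h); rewrite ler_wpM2l // gerBl invr_ge0.
  exact: sqrtr_ge0.
move: MN => /subnKC <-; elim: (N - M)%N => [|d IH].
  by rewrite addn0 big_geq // subrr mulr0.
rewrite addnS big_nat_recr ?leq_addr //=.
have Md0 : (0 < M + d)%N by rewrite addn_gt0 M0.
have := inv_sqrt3_le Md0; move: IH; lra.
Qed.

Lemma tzeta_ge0 lo M w : 0 <= tzeta R lo M w.
Proof.
by apply: isum_ge0 => t; apply: prodr_ge0 => i _; rewrite invr_ge0 exprn_ge0.
Qed.

Lemma invXn_le n a : (0 < n)%N -> (0 < a)%N -> n%:R ^- a <= n%:R^-1 :> R.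
Proof.
move=> n0 a0; rewrite lef_pV2 ?posrE ?exprn_gt0 ?ltr0n //.
by rewrite -[leLHS]expr1 ler_weXn2l // ler1n.
Qed.

Lemma tzeta_le lo M w : is_index w -> (0 < lo)%N -> tzeta R lo M w <= H M ^+ size w.
Proof.
elim: w lo => [|a w IH] lo /=; first by rewrite tzeta_nil.
move=> /andP[a0 iw] lo0; rewrite tzeta_cons exprS.
have [Mlo|loM] := leqP M lo; first by rewrite big_geq // mulr_ge0 ?exprn_ge0 ?harmonic_ge0.
apply: (@le_trans _ _ (\sum_(lo <= n < M) n%:R^-1 * H M ^+ size w)).
  rewrite big_nat [leRHS]big_nat; apply: ler_sum => n /andP[lon _].
  have n0 := leq_trans lo0 lon.
  by rewrite ler_pM ?invr_ge0 ?exprn_ge0 ?tzeta_ge0 ?invXn_le ?IH.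
rewrite -mulr_suml ler_wpM2r ?exprn_ge0 ?harmonic_ge0 //.
rewrite [leRHS](@big_cat_nat _ _ _ lo) //=; last exact: ltnW.
by rewrite lerDr; apply: sumr_ge0 => n _; rewrite invr_ge0.
Qed.

Lemma tzeta_rcons lo M w a :
  tzeta R lo M (rcons w a) = \sum_(lo <= n < M) tzeta R lo n w * n%:R ^- a.
Proof.
rewrite /tzeta size_rcons -addn1 isum_split; apply: eq_bigr => n _.
rewrite -isumZr; apply: eq_isum => t st _ _ /=.
by rewrite -cats1 prodz_cat // /prodz big_ord1.
Qed.

Lemma tzeta_ones M : tzeta R 1 M [:: 1%N] = H M.
Proof.
by rewrite tzeta_cons; apply: eq_bigr => n _; rewrite tzeta_nil mulr1 expr1.
Qed.

(** The inner sum is a power of a logarithm, at most the square root of its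
    cutoff; so the outer sum is dominated by the series with exponent [3 / 2]. *)
Lemma tzeta_admissible_tail w : admissible w -> exists C : R, 0 <= C /\
  forall M N, (0 < M)%N -> (M <= N)%N ->
  tzeta R 1 M w <= tzeta R 1 N w <= tzeta R 1 M w + C / Num.sqrt M%:R.
Proof.
case/lastP: w => [|w a] /andP[].
  by move=> _ _; exists 0; split=> // M N _ _; rewrite !tzeta_nil mul0r addr0 lexx.
rewrite /is_index all_rcons last_rcons => /andP[_ iw] a1.
have [C [C0 hC]] := lscale_exp_le_sqrt (size w).
exists (C * 6); split=> [|M N M0 MN]; first by rewrite mulr_ge0.
rewrite !tzeta_rcons (@big_cat_nat _ _ _ M 1 N) //= lerDl lerD2l.
apply/andP; split.
  by apply: sumr_ge0 => n _; rewrite mulr_ge0 ?tzeta_ge0 ?invr_ge0 ?exprn_ge0.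
apply: (@le_trans _ _ (\sum_(M <= n < N) C * (n%:R * Num.sqrt n%:R)^-1)); last first.
  by rewrite -mulr_sumr -mulrA ler_wpM2l // sum_inv_sqrt3.
rewrite big_nat [leRHS]big_nat; apply: ler_sum => n /andP[Mn _].
have n0 := leq_trans M0 Mn; have s0 := sqrtn_gt0 n0.
have h : tzeta R 1 n w <= C * Num.sqrt n%:R.
  apply: (le_trans (tzeta_le _ iw _)) => //; apply: le_trans (hC _ n0).
  by rewrite lerXn2r ?nnegrE ?harmonic_ge0 ?lscale_ge0 // lerDr.
have h2 : n%:R ^- a <= (n%:R * n%:R)^-1 :> R.
  rewrite lef_pV2 ?posrE ?exprn_gt0 ?mulr_gt0 ?ltr0n //.
  by rewrite -expr2 ler_weXn2l // ler1n.
have -> : C * (n%:R * Num.sqrt n%:R)^-1 = C * Num.sqrt n%:R * (n%:R * n%:R)^-1.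
  move: (sqrtn_sqr n) s0; set q := Num.sqrt _ => <- q0.
  by field; rewrite gt_eqF.
by rewrite ler_pM ?tzeta_ge0 ?invr_ge0 ?exprn_ge0.
Qed.

End Harmonic.

(** * Error terms *)

Section ErrorTerms.
Variables (R : realType) (I : Type) (D : I -> Prop) (L : I -> R).
Hypothesis L_ge1 : forall i, D i -> 1 <= L i.
Implicit Types w F G : I -> R.

(** Big-O of [w] up to powers of [L], uniformly on [D]. A single integer
    serves both as constant and as exponent, so that estimates combine without
    keeping track of either. *)
Definition plog w F := exists c : nat, forall i, D i ->
  `|F i| <= c%:R * L i ^+ c * w i.

Let L_ge0 i : D i -> 0 <= L i.
Proof. by move=> Di; rewrite (le_trans ler01) // L_ge1. Qed.

Lemma plogP w F (C : R) (c : nat) : (forall i, D i -> 0 <= w i) ->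
  (forall i, D i -> `|F i| <= C * L i ^+ c * w i) -> plog w F.
Proof.
move=> w0 H; pose b := (Num.truncn C).+1; exists (b + c)%N => i Di.
apply: (le_trans (H i Di)); apply: ler_wpM2r; first exact: w0.
apply: (@le_trans _ _ ((b + c)%:R * L i ^+ c)).
  rewrite ler_wpM2r ?exprn_ge0 ?L_ge0 //.
  rewrite (le_trans (ltW (truncnS_gt C))) // ler_nat leq_addr //.
by rewrite ler_wpM2l // ler_weXn2l ?leq_addl // L_ge1.
Qed.

Lemma eq_plog w F G : (forall i, D i -> F i = G i) -> plog w F -> plog w G.
Proof. by move=> FG [c H]; exists c => i Di; rewrite -FG ?H. Qed.

Lemma plog_le w F G : (forall i, D i -> `|G i| <= `|F i|) -> plog w F -> plog w G.
Proof. by move=> FG [c H]; exists c => i Di; rewrite (le_trans (FG i Di)) ?H. Qed.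

Lemma plog_weight w w' F (C : R) : (forall i, D i -> 0 <= w i) ->
  (forall i, D i -> 0 <= w' i) -> (forall i, D i -> w i <= C * w' i) ->
  plog w F -> plog w' F.
Proof.
move=> w0 w0' ww' [c H]; apply: (@plogP _ _ (c%:R * C) c) => // i Di.
apply: (le_trans (H i Di)); rewrite -mulrA -[leRHS]mulrA -[leRHS]mulrA.
rewrite ler_wpM2l // mulrCA ler_wpM2l ?exprn_ge0 ?L_ge0 //.
exact: ww'.
Qed.

Lemma plogD w F G : (forall i, D i -> 0 <= w i) ->
  plog w F -> plog w G -> plog w (fun i => F i + G i).
Proof.
move=> w0 [a Ha] [b Hb]; apply: (@plogP _ _ (a + b)%:R (a + b)) => // i Di.
apply: (le_trans (ler_normD _ _)).
rewrite (le_trans (lerD (Ha i Di) (Hb i Di))) // -mulrDl ler_wpM2r ?w0 //.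
rewrite natrD mulrDl lerD // ler_wpM2l // ler_weXn2l ?L_ge1 //.
  exact: leq_addr.
exact: leq_addl.
Qed.

Lemma plogM w w' F G : (forall i, D i -> 0 <= w i) ->
  (forall i, D i -> 0 <= w' i) ->
  plog w F -> plog w' G -> plog (fun i => w i * w' i) (fun i => F i * G i).
Proof.
move=> w0 w0' [a Ha] [b Hb]; apply: (@plogP _ _ (a * b)%:R (a + b)) => [i Di|i Di].
  by rewrite mulr_ge0 ?w0 ?w0'.
rewrite normrM (le_trans (ler_pM _ _ (Ha i Di) (Hb i Di))) //.
by rewrite natrM exprD le_eqVlt; apply/orP; left; apply/eqP; ring.
Qed.

Lemma plog_cst (a : R) : plog (fun=> 1) (fun=> a).
Proof.
by apply: (@plogP _ _ `|a| 0) => // i Di; rewrite expr0 !mulr1.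
Qed.

Lemma plog0 w : (forall i, D i -> 0 <= w i) -> plog w (fun=> 0).
Proof. by move=> w0; exists 0%N => i Di; rewrite normr0 !mul0r. Qed.

Lemma plogMl w F G : (forall i, D i -> 0 <= w i) ->
  plog (fun=> 1) F -> plog w G -> plog w (fun i => F i * G i).
Proof.
move=> w0 HF HG; have [c H] := plogM (fun _ _ => ler01) w0 HF HG.
by exists c => i Di; rewrite (le_trans (H i Di)) // mul1r.
Qed.

Lemma plogMr w F G : (forall i, D i -> 0 <= w i) ->
  plog w F -> plog (fun=> 1) G -> plog w (fun i => F i * G i).
Proof.
by move=> w0 HF HG; apply: (eq_plog (F := fun i => G i * F i)) (plogMl w0 HG HF) => i _;
   rewrite mulrC.
Qed.

Lemma plogZ w F (a : R) : (forall i, D i -> 0 <= w i) ->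
  plog w F -> plog w (fun i => a * F i).
Proof. by move=> w0; apply: plogMl => //; exact: plog_cst. Qed.

Lemma plogN w F : plog w F -> plog w (fun i => - F i).
Proof. by move=> [c H]; exists c => i Di; rewrite normrN H. Qed.

Lemma plogB w F G : (forall i, D i -> 0 <= w i) ->
  plog w F -> plog w G -> plog w (fun i => F i - G i).
Proof. by move=> w0 HF /plogN; exact: plogD. Qed.

Lemma plog_sum w (J : Type) (r : seq J) (P : pred J) (F : J -> I -> R) :
  (forall i, D i -> 0 <= w i) -> (forall j, P j -> plog w (F j)) ->
  plog w (fun i => \sum_(j <- r | P j) F j i).
Proof.
move=> w0 HF; elim: r => [|j r IH].
  by apply: eq_plog (plog0 w0) => i _; rewrite big_nil.
case Pj: (P j); last by apply: eq_plog IH => i _; rewrite big_cons Pj.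
apply: eq_plog (plogD w0 (HF j Pj) IH) => i _; by rewrite big_cons Pj.
Qed.

Lemma plog_exp F n : plog (fun=> 1) F -> plog (fun=> 1) (fun i => F i ^+ n).
Proof.
move=> HF; elim: n => [|n IH]; first by apply: eq_plog (plog_cst 1) => i _; rewrite expr0.
by apply: eq_plog (plogMl (fun _ _ => ler01) HF IH) => i _; rewrite exprS.
Qed.

Lemma plog_horner (p : {poly R}) F :
  plog (fun=> 1) F -> plog (fun=> 1) (fun i => p.[F i]).
Proof.
move=> HF; apply: eq_plog (plog_sum (w := fun=> 1) (index_enum 'I_(size p))
   (P := xpredT) (F := fun j i => p`_j * F i ^+ j) _ _) => [i _|i _|j _].
- by rewrite horner_coef.
- exact: ler01.
- by apply: plogZ => [i _|]; [exact: ler01|exact: plog_exp].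
Qed.

Lemma plog_mul_sub w F F' G G' : (forall i, D i -> 0 <= w i) ->
  plog (fun=> 1) F' -> plog (fun=> 1) G ->
  plog w (fun i => F i - F' i) -> plog w (fun i => G i - G' i) ->
  plog w (fun i => F i * G i - F' i * G' i).
Proof.
move=> w0 HF' HG HF HGG.
apply: eq_plog (plogD w0 (plogMr w0 HF HG) (plogMl w0 HF' HGG)) => i _.
by ring.
Qed.

Lemma plog_exp_sub w F G n : (forall i, D i -> 0 <= w i) ->
  plog (fun=> 1) F -> plog (fun=> 1) G -> plog w (fun i => F i - G i) ->
  plog w (fun i => F i ^+ n - G i ^+ n).
Proof.
move=> w0 HF HG HFG; elim: n => [|n IH].
  by apply: eq_plog (plog0 w0) => i _; rewrite !expr0 subrr.
apply: (eq_plog (F := fun i => F i * F i ^+ n - G i * G i ^+ n)).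
  by move=> i _; rewrite !exprS.
by apply: plog_mul_sub => //; exact: plog_exp.
Qed.

(** Polynomials are Lipschitz up to powers of the logarithmic scale. *)
Lemma plog_horner_sub w (p : {poly R}) F G : (forall i, D i -> 0 <= w i) ->
  plog (fun=> 1) F -> plog (fun=> 1) G -> plog w (fun i => F i - G i) ->
  plog w (fun i => p.[F i] - p.[G i]).
Proof.
move=> w0 HF HG HFG; apply: eq_plog (plog_sum (index_enum 'I_(size p))
   (P := xpredT) (F := fun j i => p`_j * (F i ^+ j - G i ^+ j)) w0 _) => [i _|j _].
  rewrite !horner_coef -sumrB; apply: eq_bigr => j _; exact: mulrBr.
by apply: plogZ => //; exact: plog_exp_sub.
Qed.

Lemma plog_trans w F G H : (forall i, D i -> 0 <= w i) ->
  plog w (fun i => F i - G i) -> plog w (fun i => G i - H i) ->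
  plog w (fun i => F i - H i).
Proof.
by move=> w0 FG GH; apply: eq_plog (plogD w0 FG GH) => i _; rewrite addrA subrK.
Qed.

Lemma plog_bounded_sub F G : plog (fun=> 1) G ->
  plog (fun=> 1) (fun i => F i - G i) -> plog (fun=> 1) F.
Proof.
move=> HG HFG; apply: eq_plog (plogD (fun _ _ => ler01) HFG HG) => i _.
by rewrite subrK.
Qed.

End ErrorTerms.

Lemma plog_comp (R : realType) (I J : Type) (D : I -> Prop) (D' : J -> Prop)
    (L : I -> R) (L' : J -> R) (phi : J -> I) w F :
  (forall j, D' j -> D (phi j)) ->
  (forall j, D' j -> 0 <= L (phi j) <= L' j) ->
  (forall j, D' j -> 0 <= w (phi j)) ->
  plog D L w F -> plog D' L' (fun j => w (phi j)) (fun j => F (phi j)).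
Proof.
move=> DD LL w0 [c H]; exists c => j Dj.
have /andP[L0 LL'] := LL j Dj.
apply: (le_trans (H _ (DD j Dj))); rewrite ler_wpM2r ?w0 // ler_wpM2l //.
by rewrite lerXn2r // nnegrE // (le_trans L0).
Qed.

(** * Truncated and regularized zeta values *)

Section ZetaApprox.
Variable R : realType.
Local Notation H := (harmonicT R).
Local Notation plogn := (plog (fun M => (0 < M)%N) (@lscale R)).

(** The rate of every approximation below: half of the true exponent [1] is
    given away to absorb logarithms. *)
Definition sqrtw (M : nat) : R := (Num.sqrt M%:R)^-1.

Lemma sqrtw_ge0 M : (0 < M)%N -> 0 <= sqrtw M.
Proof. by move=> _; rewrite invr_ge0 sqrtr_ge0. Qed.

Lemma sqrtw_le1 M : (0 < M)%N -> sqrtw M <= 1.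
Proof.
move=> M0; rewrite invf_le1 ?sqrtn_gt0 // -[leLHS]sqrtr1 ler_wsqrtr // ler1n //.
Qed.

Let f (w : seq nat) (n : (size w).-tuple nat) : \bar R :=
  (\prod_(i < size w) ((tnth n i)%:R : R) ^- nth 0%N w i)%:E.

Let f_ge0 w n : (0 <= f (w := w) n)%E.
Proof. by rewrite lee_fin; apply: prodr_ge0 => i _; rewrite invr_ge0 exprn_ge0. Qed.

Let box r M : seq (r.-tuple nat) :=
  [seq map_tuple (val : 'I_M -> nat) n |
    n <- enum [pred n : r.-tuple 'I_M | path ltn 0%N (map val n)]].

Let box_uniq r M : uniq (box r M).
Proof.
rewrite map_inj_uniq ?enum_uniq // => n n' /(congr1 val) /= e.
by apply: val_inj; apply: (inj_map val_inj).
Qed.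

Let mem_box r M (n : r.-tuple nat) : path ltn 0%N n ->
  all (fun x => x < M)%N n -> n \in box r M.
Proof.
move=> pn bn; apply/mapP.
case: M bn => [|M] bn.
  case: n pn bn => -[|x t] st // _ _; move: st; rewrite /= => st.
  have r0 : r = 0%N by case: (r) st.
  subst r; exists [tuple]; first by rewrite mem_enum.
  by apply: val_inj.
exists (map_tuple (@inord M) n).
  rewrite mem_enum inE /= -map_comp map_id_in // => x xn /=.
  by rewrite inordK // (allP bn).
apply: val_inj; rewrite /= -map_comp map_id_in // => x xn /=.
by rewrite inordK // (allP bn).
Qed.

Let sum_box w M : (\sum_(n <- box (size w) M) f n = (tzeta R 1 M w)%:E)%E.
Proof.
rewrite sumEFin; congr (_%:E); rewrite big_map big_enum_cond /=.
rewrite /tzeta -sum_tuple_isum_ge; apply: eq_big => [n|n _].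
  rewrite inE andbT path_sortedE //; exact: ltn_trans.
apply: eq_bigr => i _; rewrite /= tnth_map (nth_map (tnth n i)) ?size_tuple //.
by rewrite -tnth_nth.
Qed.

Lemma mzv_approx w : admissible w -> exists C : R, 0 <= C /\
  forall M, (0 < M)%N -> `|tzeta R 1 M w - mzv R w| <= C * sqrtw M.
Proof.
move=> Aw; have [C [C0 hC]] := tzeta_admissible_tail R Aw.
exists C; split=> // M M0.
have lo N : ((tzeta R 1 N w)%:E <= \esum_(n in [set n : (size w).-tuple nat | path ltn 0%N n]) f n)%E.
  apply: esum_ge; exists [set` box (size w) N].
    split; first exact: finite_seq.
    move=> n /= /mapP[n' n'P ->]; by move: n'P; rewrite mem_enum.
  by rewrite -fsbig_seq ?sum_box // box_uniq.
have up : (\esum_(n in [set n : (size w).-tuple nat | path ltn 0%N n]) f n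
    <= (tzeta R 1 M w + C * sqrtw M)%:E)%E.
  apply: ub_ereal_sup => _ [X [finX XS] <-].
  (* A cutoff beyond all entries of the tuples in [X]. *)
  pose N := maxn M (\max_(n <- fset_set X) \max_(x <- n) x).+1.
  have XN : {subset X <= [set` box (size w) N]}.
    move=> n nX; apply/mem_set; move/set_mem: (nX) => Xn /=.
    apply: mem_box; first exact: XS.
    apply/allP => x xn; rewrite /N leq_max; apply/orP; right; rewrite ltnS.
    apply: (@leq_trans (\max_(x <- n) x)); first exact: (@leq_bigmax_seq _ _ xpredT id).
    apply: (@leq_bigmax_seq _ _ xpredT
      (fun n : (size w).-tuple nat => \max_(x <- n) x)%N) => //.
    by rewrite in_fset_set.
  apply: (@le_trans _ _ (\sum_(n \in [set` box (size w) N]) f n)).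
    apply: lee_fsum_nneg_subset => //; first exact: finite_seq.
  rewrite -fsbig_seq ?box_uniq // sum_box lee_fin.
  have MN : (M <= N)%N by rewrite leq_max leqnn.
  by have /andP[] := hC _ _ M0 MN.
have fin : (\esum_(n in [set n : (size w).-tuple nat | path ltn 0%N n]) f n) \is a fin_num.
  rewrite fin_numE; apply/andP; split.
    by rewrite gt_eqF // (lt_le_trans _ (lo 0%N)) ?ltNyr.
  by rewrite lt_eqF // (le_lt_trans up) ?ltry.
have l1 : tzeta R 1 M w <= mzv R w by rewrite -lee_fin fineK.
have l2 : mzv R w <= tzeta R 1 M w + C * sqrtw M by rewrite -lee_fin fineK.
by rewrite ler_distlC; apply/andP; split; move: l1 l2; have := mulr_ge0 C0 (sqrtw_ge0 M0); lra.
Qed.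

End ZetaApprox.

Section ZetaStarApprox.
Variable R : realType.
Local Notation H := (harmonicT R).
Local Notation plogn := (plog (fun M => (0 < M)%N) (@lscale R)).
Local Notation sqrtw := (@sqrtw R).

Let L1 M : (0 < M)%N -> 1 <= lscale R M. Proof. by move=> _; exact: lscale_ge1. Qed.

Let s0 := @sqrtw_ge0 R.

Definition tzeta_lin M (u : qspan) : R :=
  msum (fun c s => ratr c * tzeta R 1 M s) u.

Let linD (g : seq nat -> R) (c d : rat) s :
  ratr (c + d) * g s = ratr c * g s + ratr d * g s.
Proof. by rewrite rmorphD mulrDl. Qed.

Lemma tzeta_linU M c s : tzeta_lin M (monomial c s) = ratr c * tzeta R 1 M s.
Proof. by rewrite /tzeta_lin (msumU (linD _)). Qed.

Lemma tzeta_lin_sum M (I : Type) (r : seq I) (P : pred I) (G : I -> qspan) :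
  tzeta_lin M (\sum_(i <- r | P i) G i) = \sum_(i <- r | P i) tzeta_lin M (G i).
Proof. exact: (msum_sum (linD _)). Qed.

Lemma tzeta_lin_stuffle M u v :
  tzeta_lin M (stuffle u v) = tzeta_lin M u * tzeta_lin M v.
Proof.
rewrite tzeta_lin_sum mulr_suml; apply: eq_bigr => s _.
rewrite tzeta_lin_sum mulr_sumr; apply: eq_bigr => t _.
rewrite tzeta_lin_sum mulrACA tzetaM mulr_sumr; apply: eq_bigr => w _.
by rewrite tzeta_linU rmorphM.
Qed.

Lemma tzeta_lin_pow1 M l : tzeta_lin M (stuffle_pow1 l) = H M ^+ l.
Proof.
elim: l => [|l IH]; first by rewrite tzeta_linU tzeta_nil rmorph1 mulr1.
rewrite exprS -IH -[stuffle_pow1 l.+1]/(stuffle _ (stuffle_pow1 l)).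
by rewrite tzeta_lin_stuffle tzeta_linU rmorph1 mul1r tzeta_ones.
Qed.

Lemma plog_harmonic : plogn (fun=> 1) H.
Proof.
exists 1%N => M _; rewrite mul1r expr1 mulr1 ger0_norm ?harmonic_ge0 //.
by rewrite lerDr.
Qed.

Lemma tzeta_lin_approx u : in_admissible_span u ->
  plogn sqrtw (fun M => tzeta_lin M u - mzv_lin R u).
Proof.
move=> Au; apply: (eq_plog (F := fun M => \sum_(s <- msupp u | s \in msupp u)
    ratr (mcoeff s u) * (tzeta R 1 M s - mzv R s))).
  move=> M _; rewrite -big_seq /tzeta_lin /msum /mzv_lin -sumrB.
  by apply: eq_bigr => s _; rewrite mulrBr.
apply: plog_sum => // s su; apply: plogZ => //.
have [C [C0 hC]] := mzv_approx R (Au s su).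
by apply: (@plogP _ _ _ _ L1 _ _ C 0) => // M M0; rewrite expr0 mulr1 hC.
Qed.

(** Truncation at [M] is a character of the stuffle algebra sending [1] to the
    harmonic number, and its values at admissible indices converge; hence it
    follows the regularization with [X] specialized to the harmonic number. *)
Theorem zeta_star_approx k : is_index k ->
  plogn sqrtw (fun M => tzeta R 1 M k - (zeta_star R k).[H M]).
Proof.
move=> /reg_decompP [AU eU]; set U := reg_decomp k in AU eU.
apply: (eq_plog (F := fun M => \sum_(l < (size k).+1)
    (tzeta_lin M (U l) - mzv_lin R (U l)) * H M ^+ l)).
  move=> M _.
  have -> : tzeta R 1 M k = tzeta_lin M (monomial 1 k).
    by rewrite tzeta_linU rmorph1 mul1r.
  rewrite eU tzeta_lin_sum horner_sum -sumrB; apply: eq_bigr => l _.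
  by rewrite tzeta_lin_stuffle tzeta_lin_pow1 hornerZ hornerXn mulrBl.
apply: plog_sum => // l _; apply: plogMr => //.
  exact: tzeta_lin_approx.
by apply: plog_exp => //; exact: plog_harmonic.
Qed.

Lemma gbinomN k l : gbinom (- k%:R : R) l = nbin R k l.
Proof.
rewrite /gbinom; have f0 n : n`!%:R != 0 :> R by rewrite pnatr_eq0 -lt0n fact_gt0.
apply: (canLR (mulfK (f0 l))).
elim: l => [|l IH]; first by rewrite big_ord0 nbin0r mulr1.
rewrite big_ord_recr /= IH /nbin factS natrM exprS addnS [(k + l).+1.-1]/=.
have := congr1 (fun n => n%:R : R) (mul_bin_diag (k + l) l).
rewrite !natrM natrD => e.
transitivity (- ((-1) ^+ l * l`!%:R * ((k%:R + l%:R) * 'C((k + l).-1, l)%:R)) : R).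
  by ring.
by rewrite e; ring.
Qed.

Lemma index_shift k m (l : {ffun 'I_(size k) -> 'I_m}) : is_index k ->
  is_index [seq (nth 0 k i + l i)%N | i : 'I_(size k)].
Proof.
move=> ik; apply/allP => _ /mapP[i _ ->].
by rewrite addn_gt0 (allP ik) // mem_nth.
Qed.

Lemma zeta_star_m_approx m k : is_index k ->
  plogn sqrtw (fun M => tzeta_m R M m k - (zeta_star_m R m k).[H M]).
Proof.
move=> ik; case: (eqVneq k [::]) => [->|k0].
  apply: (eq_plog (F := fun=> 0)); last exact: plog0.
  move=> M _; rewrite /tzeta_m.
  transitivity ((m == 0%N)%:R - (m == 0%N)%:R : R); first by rewrite subrr.
  congr (_ - _); last first.
    by rewrite /zeta_star_m; case: (m == 0%N); rewrite ?hornerC ?horner0.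
  case: m => [|m].
    rewrite (big_pred1 (finfun (fun i : 'I_0 => ord0))) /=.
      rewrite big_ord0 mul1r (_ : [seq _ | _ : 'I_0] = [::]) ?tzeta_nil //.
      by apply: size0nil; rewrite size_map size_enum_ord.
    move=> l; rewrite big_ord0 /=; symmetry; apply/eqP; apply/ffunP => -[? //].
  by rewrite big_pred0 // => l; rewrite big_ord0.
have -> : zeta_star_m R m k = \sum_(l : {ffun 'I_(size k) -> 'I_m.+1} | (\sum_i l i)%N == m)
    (\prod_(i < size k) gbinom (- (nth 0%N k i)%:R) (l i)) *:
      zeta_star R [seq (nth 0 k i + l i)%N | i : 'I_(size k)].
  by case: (k) k0.
apply: (eq_plog (F := fun M => \sum_(l : {ffun 'I_(size k) -> 'I_m.+1} | (\sum_i l i)%N == m)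
    (\prod_(i < size k) nbin R (nth 0%N k i) (l i)) *
    (tzeta R 1 M [seq (nth 0 k i + l i)%N | i : 'I_(size k)]
      - (zeta_star R [seq (nth 0 k i + l i)%N | i : 'I_(size k)]).[H M]))).
  move=> M _; rewrite /tzeta_m horner_sum -sumrB; apply: eq_bigr => l _.
  rewrite hornerZ mulrBr; congr (_ - _ * _).
  by apply: eq_bigr => i _; rewrite gbinomN.
apply: plog_sum => // l _; apply: plogZ => //.
by apply: zeta_star_approx; exact: index_shift.
Qed.

Lemma plog_zeta_star_m m k : plogn (fun=> 1) (fun M => (zeta_star_m R m k).[H M]).
Proof. by apply: plog_horner => //; exact: plog_harmonic. Qed.

Lemma plog_tzeta_m m k : is_index k -> plogn (fun=> 1) (fun M => tzeta_m R M m k).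
Proof.
move=> ik; apply: (plog_bounded_sub L1 (plog_zeta_star_m m k)).
apply: (plog_weight L1 (C := 1)) (zeta_star_m_approx m ik) => // M M0.
by rewrite mulr1 sqrtw_le1.
Qed.

End ZetaStarApprox.

(** * The truncated coefficients *)

Section CtruncApprox.
Variable R : realType.
Local Notation H := (harmonicT R).
Local Notation sqrtw := (@sqrtw R).

Section General.
Variables (J : Type) (D : J -> Prop) (L w : J -> R) (phi psi : J -> nat) (x y : J -> R).
Hypothesis L1 : forall j, D j -> 1 <= L j.
Hypothesis w0 : forall j, D j -> 0 <= w j.
Hypothesis phi0 : forall j, D j -> (0 < phi j)%N.
Hypothesis psi0 : forall j, D j -> (0 < psi j)%N.
Hypothesis Lphi : forall j, D j -> lscale R (phi j) <= L j.
Hypothesis Lpsi : forall j, D j -> lscale R (psi j) <= L j.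
Hypothesis wphi : forall j, D j -> sqrtw (phi j) <= w j.
Hypothesis wpsi : forall j, D j -> sqrtw (psi j) <= w j.
Hypothesis plog_x : plog D L (fun=> 1) x.
Hypothesis plog_y : plog D L (fun=> 1) y.
Hypothesis approx_x : plog D L w (fun j => H (phi j) - x j).
Hypothesis approx_y : plog D L w (fun j => H (psi j) - y j).

Let comp chi : (forall j, D j -> (0 < chi j)%N) ->
  (forall j, D j -> lscale R (chi j) <= L j) -> forall v F,
  (forall M, (0 < M)%N -> 0 <= v M) ->
  plog (fun M => (0 < M)%N) (@lscale R) v F ->
  plog D L (fun j => v (chi j)) (fun j => F (chi j)).
Proof.
move=> chi0 Lchi v F v0; apply: plog_comp => // j Dj; last by apply: v0; exact: chi0.
by rewrite lscale_ge0 Lchi.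
Qed.

Let approx chi z : (forall j, D j -> (0 < chi j)%N) ->
  (forall j, D j -> lscale R (chi j) <= L j) ->
  (forall j, D j -> sqrtw (chi j) <= w j) -> plog D L (fun=> 1) z ->
  plog D L w (fun j => H (chi j) - z j) -> forall m k, is_index k ->
  plog D L w (fun j => tzeta_m R (chi j) m k - (zeta_star_m R m k).[z j]).
Proof.
move=> chi0 Lchi wchi pz Hz m k ik.
have pH : plog D L (fun=> 1) (fun j => H (chi j)).
  exact: (comp chi0 Lchi (fun _ _ => ler01) (plog_harmonic R)).
apply: (plog_trans (G := fun j => (zeta_star_m R m k).[H (chi j)]) L1 w0).
  have := comp chi0 Lchi (@sqrtw_ge0 R) (zeta_star_m_approx R m ik).
  apply: (plog_weight L1 (C := 1)) => // [j Dj|j Dj].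
    exact/sqrtw_ge0/chi0.
  by rewrite mul1r wchi.
exact: plog_horner_sub.
Qed.

(** The harmonic numbers at the two cutoffs are approximated by arbitrary [x] and
    [y], because two different choices are of use below. *)
Lemma Ctrunc_approx k i m : is_index k ->
  plog D L w (fun j => Ctrunc R k i m (phi j) (psi j) - Cxy k i m (x j) (y j)).
Proof.
move=> ik.
have ikt : is_index (rev (take i k)).
  rewrite /is_index all_rev; apply/allP => a /mem_take; exact: (allP ik).
have ikd : is_index (drop i.+1 k) by apply/allP => a /mem_drop; exact: (allP ik).
apply: (eq_plog (F := fun j => \sum_(a < m.+1) (-1) ^+ (sumn (take i k) + a) *
  (tzeta_m R (phi j) a (rev (take i k)) * tzeta_m R (psi j) (m - a) (drop i.+1 k)
   - (zeta_star_m R a (rev (take i k))).[x j]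
     * (zeta_star_m R (m - a) (drop i.+1 k)).[y j]))).
  move=> j _; rewrite -sumrB; apply: eq_bigr => a _.
  by rewrite mulrBr !mulrA.
apply: plog_sum => // a _; apply: plogZ => //; apply: plog_mul_sub => //.
- exact: plog_horner.
- exact: (comp psi0 Lpsi (fun _ _ => ler01) (plog_tzeta_m R _ ikd)).
- exact: approx.
- exact: approx.
Qed.

End General.

(** The two-parameter error terms are indexed by the cutoff and the position
    of the pole. *)
Definition dom2 (p : nat * nat) := (p.2 < p.1)%N.
Definition lscale2 (p : nat * nat) : R := lscale R (2 * p.1).
(** [w0] measures the error of the logarithmic profiles [hside], and [w1] that
    of ignoring the position of the pole altogether. *)
Definition w0 (p : nat * nat) : R := Num.sqrt p.1%:R / (p.1 - p.2)%:R.
Definition w1 (p : nat * nat) : R := (p.2%:R + Num.sqrt p.1%:R) / (p.1 - p.2)%:R.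
Definition side (b : bool) (p : nat * nat) : nat :=
  if b then (p.1 + p.2)%N else (p.1 - p.2)%N.
(** The harmonic number of [side b p], with its logarithm made explicit. *)
Definition hside b p : R := H p.1 + ln ((side b p)%:R / p.1%:R).

Let L1 p : dom2 p -> 1 <= lscale2 p.
Proof. by move=> _; exact: lscale_ge1. Qed.

Lemma w0_ge0 p : dom2 p -> 0 <= w0 p.
Proof. by move=> _; rewrite divr_ge0 ?sqrtr_ge0. Qed.

Lemma w1_ge0 p : dom2 p -> 0 <= w1 p.
Proof. by move=> _; rewrite divr_ge0 ?addr_ge0 ?sqrtr_ge0. Qed.

Lemma w0_le_w1 p : w0 p <= w1 p.
Proof. by rewrite ler_wpM2r ?invr_ge0 // lerDr. Qed.

Lemma side_gt0 b p : dom2 p -> (0 < side b p)%N.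
Proof. by rewrite /dom2 /side; case: b; lia. Qed.

Let sub_gt0 p : dom2 p -> 0 < (p.1 - p.2)%:R :> R.
Proof. by move=> Dp; rewrite ltr0n subn_gt0. Qed.

Let p1_gt0 p : dom2 p -> (0 < p.1)%N.
Proof. by rewrite /dom2; lia. Qed.

Lemma sqrtw_side b p : dom2 p -> sqrtw (side b p) <= w0 p.
Proof.
move=> Dp; have d0 := sub_gt0 Dp.
have sd0 : 0 < Num.sqrt (p.1 - p.2)%:R :> R by rewrite sqrtr_gt0.
apply: (@le_trans _ _ (Num.sqrt (p.1 - p.2)%:R)^-1).
  rewrite lef_pV2 ?posrE ?sqrtr_gt0 ?ltr0n ?subn_gt0 ?side_gt0 //.
  by rewrite ler_wsqrtr // ler_nat /side; case: b; rewrite //; lia.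
rewrite /w0 -[X in _ <= _ * X^-1]sqrtn_sqr invfM mulrA ler_peMl ?invr_ge0 ?sqrtr_ge0 //.
rewrite ler_pdivlMr // mul1r ler_wsqrtr // ler_nat; exact: leq_subr.
Qed.

Lemma lscale_side b p : dom2 p -> lscale R (side b p) <= lscale2 p.
Proof. by move=> Dp; apply: lscale_le; move: Dp; rewrite /dom2 /side; case: b; lia. Qed.

Let sqrtN_ge1 p : dom2 p -> 1 <= Num.sqrt p.1%:R :> R.
Proof.
by move=> Dp; rewrite -[leLHS]sqrtr1 ler_wsqrtr // ler1n p1_gt0.
Qed.

Let inv_le_w0 p : dom2 p -> (p.1 - p.2)%:R^-1 <= w0 p.
Proof.
by move=> Dp; rewrite /w0 ler_peMl ?invr_ge0 ?sqrtN_ge1.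
Qed.

Lemma harmonic_side b p : dom2 p -> `|H (side b p) - H p.1| <= w1 p.
Proof.
have key M d : (0 < M)%N -> 0 <= H (M + d) - H M <= d%:R / M%:R.
  move=> M0; elim: d => [|d /andP[IH1 IH2]].
    by rewrite addn0 subrr mul0r lexx.
  have Md0 : (0 < M + d)%N by rewrite addn_gt0 M0.
  have h : (M + d)%:R^-1 <= M%:R^-1 :> R.
    by rewrite lef_pV2 ?posrE ?ltr0n // ler_nat leq_addr.
  have h0 : 0 <= (M + d)%:R^-1 :> R by rewrite invr_ge0.
  rewrite addnS harmonicS // -natr1 mulrDl mul1r.
  by apply/andP; split; move: IH1 IH2 h h0;
     move: (_^-1) (_^-1) (_ / _) (H _) (H _) => a c e f g; lra.
move=> Dp; have d0 := sub_gt0 Dp.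
apply: (@le_trans _ _ (p.2%:R / (p.1 - p.2)%:R)); last first.
  by rewrite ler_wpM2r ?invr_ge0 // lerDl sqrtr_ge0.
rewrite /side; case: b.
  have /andP[h0 h1] := key p.1 p.2 (p1_gt0 Dp).
  rewrite ger0_norm //; apply: (le_trans h1); rewrite ler_wpM2l //.
  by rewrite lef_pV2 ?posrE ?ltr0n ?subn_gt0 ?(p1_gt0 Dp) // ler_nat leq_subr.
have Dp' : (0 < p.1 - p.2)%N by rewrite subn_gt0.
have /andP[] := key (p.1 - p.2)%N p.2 Dp'.
by rewrite subnK ?(ltnW Dp) // => h0 h1; rewrite distrC ger0_norm.
Qed.

Lemma hside_approx b p : dom2 p -> `|H (side b p) - hside b p| <= w0 p.
Proof.
move=> Dp; have p0 := p1_gt0 Dp; have s0 := side_gt0 b Dp.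
rewrite /hside ln_div ?posrE ?ltr0n // opprD addrA opprB.
apply: le_trans (inv_le_w0 Dp).
case: b s0 => /= s0.
  have /andP[h0 h1] := harmonic_ln_diff R p0 (leq_addr p.2 p.1).
  have -> : H (p.1 + p.2) - H p.1 + (ln p.1%:R - ln (p.1 + p.2)%:R) =
    H (p.1 + p.2) - ln (p.1 + p.2)%:R - (H p.1 - ln p.1%:R) by ring.
  rewrite ger0_norm //; apply: (le_trans h1).
  apply: (@le_trans _ _ p.1%:R^-1); first by rewrite gerBl invr_ge0.
  by rewrite lef_pV2 ?posrE ?ltr0n ?subn_gt0 // ler_nat leq_subr.
have /andP[h0 h1] := harmonic_ln_diff R s0 (leq_subr p.2 p.1).
have -> : H (p.1 - p.2) - H p.1 + (ln p.1%:R - ln (p.1 - p.2)%:R) =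
    - (H p.1 - ln p.1%:R - (H (p.1 - p.2) - ln (p.1 - p.2)%:R)) by ring.
rewrite normrN ger0_norm //; apply: (le_trans h1).
by rewrite gerBl invr_ge0.
Qed.

Lemma plog_harmonic2 : plog dom2 lscale2 (fun=> 1) (fun p => H p.1).
Proof.
apply: (@plog_comp _ _ _ _ _ _ _ fst (fun=> 1) H _ _ _ (plog_harmonic R))
  => [p Dp|p Dp|p Dp]; last exact: ler01; first exact: (p1_gt0 Dp).
by rewrite lscale_ge0 lscale_le // leq_pmull.
Qed.

Lemma plog_hside b : plog dom2 lscale2 (fun=> 1) (hside b).
Proof.
apply: plogD => //; first exact: plog_harmonic2.
apply: (plogP L1 (C := 1) (c := 1)) => // p Dp; rewrite mul1r mulr1 expr1.
have p0 := p1_gt0 Dp; have s0 := side_gt0 b Dp.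
have N0 : (0 < 2 * p.1)%N by rewrite muln_gt0.
have h a : (0 < a)%N -> (a <= 2 * p.1)%N -> 0 <= ln (a%:R : R) <= lscale2 p.
  move=> a0 aN; rewrite ln_ge0 ?ler1n //=.
  apply: (@le_trans _ _ (ln (2 * p.1)%:R)).
    by rewrite ler_ln ?posrE ?ltr0n // ler_nat.
  by apply: (le_trans (harmonic_ge_ln R N0)); rewrite lerDr.
rewrite ln_div ?posrE ?ltr0n //.
have sN : (side b p <= 2 * p.1)%N.
  by move: Dp; rewrite /dom2 /side; case: b {s0}; lia.
have /andP[h1 h2] := h _ s0 sN.
have /andP[h3 h4] := h _ p0 (leq_pmull _ (ltn0Sn 1)).
by rewrite ler_norml; apply/andP; split; lra.
Qed.

(** Useful when the poles far from the origin carry little mass: the weight [w1]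
    grows linearly with the position of the pole. *)
Lemma Ctrunc_approx_center k j m b : is_index k ->
  plog dom2 lscale2 w1 (fun p => Ctrunc R k j m (side b p) (side (~~ b) p)
    - Cxy k j m (H p.1) (H p.1)).
Proof.
move=> ik; apply: Ctrunc_approx => //.
- exact: w1_ge0.
- exact: side_gt0.
- exact: side_gt0.
- exact: lscale_side.
- exact: lscale_side.
- by move=> p Dp; rewrite (le_trans (sqrtw_side _ Dp)) // w0_le_w1.
- by move=> p Dp; rewrite (le_trans (sqrtw_side _ Dp)) // w0_le_w1.
- exact: plog_harmonic2.
- exact: plog_harmonic2.
- apply: (plogP L1 (C := 1) (c := 0)) => [|p Dp]; first exact: w1_ge0.
  by rewrite expr0 !mul1r harmonic_side.
- apply: (plogP L1 (C := 1) (c := 0)) => [|p Dp]; first exact: w1_ge0.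
  by rewrite expr0 !mul1r harmonic_side.
Qed.

(** Useful for all poles: the weight [w0] is small except in the vicinity of the
    two ends of the summation range. *)
Lemma Ctrunc_approx_boundary k j m b : is_index k ->
  plog dom2 lscale2 w0 (fun p => Ctrunc R k j m (side b p) (side (~~ b) p)
    - Cxy k j m (hside b p) (hside (~~ b) p)).
Proof.
move=> ik; apply: Ctrunc_approx => //.
- exact: w0_ge0.
- exact: side_gt0.
- exact: side_gt0.
- exact: lscale_side.
- exact: lscale_side.
- exact: sqrtw_side.
- exact: sqrtw_side.
- exact: plog_hside.
- exact: plog_hside.
- apply: (plogP L1 (C := 1) (c := 0)) => [|p Dp]; first exact: w0_ge0.
  by rewrite expr0 !mul1r hside_approx.
- apply: (plogP L1 (C := 1) (c := 0)) => [|p Dp]; first exact: w0_ge0.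
  by rewrite expr0 !mul1r hside_approx.
Qed.

(** By partial fractions in [n]. *)
Lemma sum_inv_mul N : \sum_(1 <= n < N) (n%:R * (N - n)%:R)^-1 = 2 * H N / N%:R :> R.
Proof.
have e : \sum_(1 <= n < N) (N - n)%:R^-1 = H N.
  rewrite /harmonicT big_nat_rev; apply: eq_big_nat => n /andP[n1 nN].
  by congr (_%:R^-1); lia.
rewrite mulr2n mulrDl mul1r -{2}e /harmonicT -big_split /= mulr_suml.
apply: eq_big_nat => n /andP[n1 nN].
have nR : n%:R != 0 :> R by rewrite pnatr_eq0 -lt0n.
have dR : (N - n)%:R != 0 :> R by rewrite pnatr_eq0 -lt0n subn_gt0.
have NR : N%:R = n%:R + (N - n)%:R :> R by rewrite -natrD subnKC // ltnW.
have NR0 : N%:R != 0 :> R by rewrite pnatr_eq0 -lt0n (leq_trans _ nN).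
rewrite NR in NR0 *; field.
by rewrite NR0 nR dR.
Qed.

Lemma sum_w0 N : (0 < N)%N ->
  \sum_(1 <= n < N) n%:R^-1 * w0 (N, n) = 2 * H N * sqrtw N.
Proof.
move=> N0; have s0 : Num.sqrt N%:R != 0 :> R by rewrite gt_eqF ?sqrtn_gt0.
transitivity (Num.sqrt N%:R * (2 * H N / N%:R) : R).
  rewrite -sum_inv_mul mulr_sumr; apply: eq_bigr => n _.
  by rewrite /w0 /= invfM mulrCA.
by rewrite /sqrtw -[X in _ / X]sqrtn_sqr; field.
Qed.

Lemma sum_w1 N : (0 < N)%N ->
  w1 (N, 0%N) + \sum_(1 <= n < N) (n%:R ^+ 2)^-1 * w1 (N, n)
  <= 5 * lscale R (2 * N) * sqrtw N.
Proof.
move=> N0; have s0 := sqrtn_gt0 R N0.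
have sq0 : 0 <= sqrtw N by exact: sqrtw_ge0.
have e0 : w1 (N, 0%N) = sqrtw N.
  rewrite /w1 /= add0r subn0 /sqrtw -[X in _ / X]sqrtn_sqr; field.
  by rewrite gt_eqF.
have s1 : 1 <= Num.sqrt N%:R :> R by exact: (sqrtN_ge1 (p := (N, 0%N))).
have h : \sum_(1 <= n < N) (n%:R ^+ 2)^-1 * w1 (N, n)
   <= 2 * \sum_(1 <= n < N) n%:R^-1 * w0 (N, n).
  rewrite mulr_sumr big_nat [leRHS]big_nat; apply: ler_sum => n /andP[n1 nN].
  have nR : 1 <= n%:R :> R by rewrite ler1n.
  have dR : 0 < (N - n)%:R :> R by rewrite ltr0n subn_gt0.
  rewrite /w1 /w0 /= !mulrA ler_wpM2r ?invr_ge0 //.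
  rewrite ler_pdivrMl ?exprn_gt0 ?(lt_le_trans ltr01) // expr2.
  have -> : n%:R * n%:R * (2 / n%:R * Num.sqrt N%:R) = 2 * n%:R * Num.sqrt N%:R :> R.
    by field; rewrite gt_eqF // (lt_le_trans ltr01).
  by nra.
rewrite sum_w0 // in h.
have hH : H N <= H (2 * N) by rewrite harmonic_le // leq_pmull.
have := harmonic_ge0 R N; rewrite e0 /lscale.
by move: h hH sq0; set a := sqrtw N; set b := H N; set c := H _; nra.
Qed.

End CtruncApprox.

(** * Riemann sums of functions with a logarithmic singularity *)

Section Riemann.
Variable R : realType.
Notation mu := (@lebesgue_measure R).

Section Monotone.
Variables (h : R -> R) (C : R).
Hypothesis h_mono : forall x y : R, 0 <= x -> x <= y -> y < 1 -> h x <= h y.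
Hypothesis h_ge0 : forall x : R, 0 <= x -> x < 1 -> 0 <= h x.
Hypothesis C_ge0 : 0 <= C.
Hypothesis h_le : forall n : nat, (0 < n)%N -> h (1 - n%:R^-1) <= C * Num.sqrt n%:R.

Let h_meas : measurable_fun `[(0 : R), (1 : R)[%classic h.
Proof.
move=> _; apply: (measurability (@RGenCInfty.G R)) => [|/= _ [_] [r] -> <-|//].
  exact: RGenCInfty.measurableE.
apply: is_interval_measurable => s t /= [].
rewrite !in_itv /= !andbT => /andP[s0 _] hs [/andP[_ t1] _] u /andP[su ut].
split; rewrite /= in_itv /=; first by rewrite (le_trans s0 su) (le_lt_trans ut t1).
by rewrite andbT; apply: (le_trans hs); apply: h_mono => //; exact: le_lt_trans t1.
Qed.

Let I (a b : R) := (\int[mu]_(x in `[a, b[%classic) (h x)%:E)%E.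

Let sub01 (a b : R) : 0 <= a -> b <= 1 -> `[a, b[%classic `<=` `[(0 : R), (1 : R)[%classic.
Proof.
move=> a0 b1 x /=; rewrite !in_itv /= => /andP[ax xb].
by rewrite (le_trans a0 ax) (lt_le_trans xb b1).
Qed.

Let meas (a b : R) : 0 <= a -> b <= 1 ->
  measurable_fun `[a, b[%classic (EFin \o h).
Proof.
move=> a0 b1; apply/measurable_EFinP; apply: measurable_funS h_meas => //.
exact: sub01.
Qed.

Let nonneg (a b : R) : 0 <= a -> b <= 1 ->
  forall x, `[a, b[%classic x -> (0 <= (h x)%:E)%E.
Proof.
move=> a0 b1 x /(sub01 a0 b1) /=; rewrite in_itv /= lee_fin => /andP[x0 x1].
exact: h_ge0.
Qed.

Let I_ge0 (a b : R) : 0 <= a -> b <= 1 -> (0 <= I a b)%E.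
Proof. by move=> a0 b1; apply: integral_ge0; exact: nonneg. Qed.

Let cell_mu (a b r : R) : a <= b ->
  (\int[mu]_(x in `[a, b[%classic) r%:E = (r * (b - a))%:E)%E.
Proof.
move=> ab; rewrite (@integral_cst _ _ _ mu `[a, b[%classic) //=.
rewrite lebesgue_measure_itv /= lte_fin; move: ab; rewrite le_eqVlt => /predU1P[->|->].
  by rewrite ltxx mule0 subrr mulr0.
by rewrite -EFinD -EFinM.
Qed.

Let I_le (a b : R) : 0 <= a -> a <= b -> b < 1 -> (I a b <= (h b * (b - a))%:E)%E.
Proof.
move=> a0 ab b1; rewrite -(cell_mu _ ab); apply: ge0_le_integral => //=.
- by apply: nonneg; rewrite // ltW.
- by apply: meas; rewrite // ltW.
- move=> x; rewrite in_itv /= => /andP[ax xb]; rewrite lee_fin.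
  by apply: h_mono => //; [exact: le_trans ax|exact: ltW].
Qed.

Let I_ge (a b : R) : 0 <= a -> a <= b -> b <= 1 -> a < 1 ->
  ((h a * (b - a))%:E <= I a b)%E.
Proof.
move=> a0 ab b1 a1; rewrite -(cell_mu _ ab); apply: ge0_le_integral => //=.
- by move=> x _; rewrite lee_fin; apply: h_ge0.
- exact: meas.
- move=> x; rewrite in_itv /= => /andP[ax xb]; rewrite lee_fin.
  by apply: h_mono => //; exact: lt_le_trans b1.
Qed.

Let I_split (a b c : R) : 0 <= a -> a <= b -> b <= c -> c <= 1 ->
  (I a c = I a b + I b c)%E.
Proof.
move=> a0 ab bc c1.
have e : `[a, c[%classic = `[a, b[%classic `|` `[b, c[%classic.
  by rewrite (@itv_bndbnd_setU _ _ _ (BLeft b)) // bnd_simp.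
have m1 := meas a0 c1; have n1 := nonneg a0 c1; rewrite e in m1 n1.
rewrite /I e; apply: ge0_integral_setU => //.
by rewrite disj_set2E; apply/eqP; rewrite -subset0 => x /=;
   rewrite !in_itv /= => -[/andP[_ xb] /andP[bx _]]; move: (le_lt_trans bx xb); rewrite ltxx.
Qed.

Let inv_sub n : (0 < n)%N -> n%:R^-1 - n.+1%:R^-1 = (n%:R * n.+1%:R)^-1 :> R.
Proof.
move=> n0; have nR : n%:R != 0 :> R by rewrite pnatr_eq0 -lt0n.
have n1 : n%:R + 1 != 0 :> R by rewrite natr1 pnatr_eq0.
by rewrite -natr1; field; rewrite nR n1.
Qed.

(** The tails are controlled by cutting at the points [1 - 1 / n]. *)
Lemma mono_tail N : (0 < N)%N -> (I (1 - N%:R^-1) 1 <= (6 * C * sqrtw R N)%:E)%E.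
Proof.
move=> N0; pose F m := `[1 - (N + m)%:R^-1, 1 - (N + m).+1%:R^-1[%classic : set R.
have Npos m : (0 < N + m)%N by rewrite addn_gt0 N0.
have eF : `[1 - N%:R^-1, 1[%classic = \bigcup_m F m.
  apply/seteqP; split => x /=; rewrite ?in_itv /=.
    move=> /andP[xN x1]; have y0 : 0 < 1 - x by rewrite subr_gt0.
    have /(truncn_itv) /andP[tl tr] : 0 <= (1 - x)^-1 by rewrite invr_ge0 ltW.
    set t := Num.truncn _ in tl tr.
    have Nt : (N <= t)%N.
      rewrite -ltnS -(ltr_nat R); apply: le_lt_trans tr.
      by rewrite -[leLHS]invrK lef_pV2 ?posrE ?invr_gt0 ?ltr0n //; lra.
    have t0 : (0 < t)%N by exact: leq_trans Nt.
    (* [t] is the integer part of [1 / (1 - x)]. *)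
    exists (t - N)%N => //; rewrite /F /= subnKC // in_itv /=.
    apply/andP; split.
      rewrite lerBlDr -lerBlDl -[leLHS]invrK lef_pV2 ?posrE ?invr_gt0 ?ltr0n //.
    rewrite ltrBrDr -ltrBrDl -[ltRHS]invrK ltf_pV2 ?posrE ?invr_gt0 ?ltr0n //.
  move=> [m _]; rewrite /F /= in_itv /= => /andP[xl xr]; apply/andP; split.
    apply: le_trans xl; rewrite lerD2l lerN2 lef_pV2 ?posrE ?ltr0n //.
    by rewrite ler_nat leq_addr.
  by apply: (lt_trans xr); rewrite gtrBl invr_gt0 ltr0n.
have F01 m : F m `<=` `[(0 : R), (1 : R)[%classic.
  apply: sub01; rewrite ?subr_ge0 ?gerBl ?invr_ge0 //.
  by rewrite invf_le1 ?ltr0n // ler1n.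
have a0 : 0 <= 1 - N%:R^-1 :> R by rewrite subr_ge0 invf_le1 ?ltr0n // ler1n.
have m1 := meas a0 (lexx 1); have n1 := nonneg a0 (lexx 1); rewrite eF in m1 n1.
rewrite /I eF ge0_integral_bigcup //.
- apply: lime_le; first by apply: is_cvg_nneseries => m _ _; apply: integral_ge0 => x /F01;
    rewrite /= in_itv /= lee_fin => /andP[]; exact: h_ge0.
  apply: nearW => k.
  apply: (@le_trans _ _ (\sum_(0 <= m < k) (C * ((N + m)%:R * Num.sqrt (N + m)%:R)^-1)%:E)%E).
    apply: lee_sum => m _; set n := (N + m)%N.
    have n0 : (0 < n)%N by exact: Npos.
    have nR : 0 < n%:R :> R by rewrite ltr0n.
    have l1 : 1 - n%:R^-1 <= 1 - n.+1%:R^-1 :> R.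
      by rewrite lerD2l lerN2 lef_pV2 ?posrE ?ltr0n // ler_nat.
    apply: le_trans (I_le _ l1 _) _.
    + by rewrite subr_ge0 invf_le1 ?ltr0n // ler1n.
    + by rewrite gtrBl invr_gt0 ltr0n.
    rewrite lee_fin (_ : 1 - n.+1%:R^-1 - (1 - n%:R^-1) = (n%:R * n.+1%:R)^-1); last first.
      by rewrite -inv_sub //; ring.
    have s0 := sqrtn_gt0 R n0; have s1 := sqrtn_gt0 R (ltn0Sn n).
    apply: (@le_trans _ _ (C * Num.sqrt n.+1%:R * (n%:R * n.+1%:R)^-1)).
      by rewrite ler_wpM2r ?invr_ge0 ?mulr_ge0 // h_le.
    rewrite -mulrA ler_wpM2l //.
    have -> : Num.sqrt n.+1%:R * (n%:R * n.+1%:R)^-1 = (n%:R * Num.sqrt n.+1%:R)^-1 :> R.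
      move: (sqrtn_sqr R n.+1) s1; set q := Num.sqrt _ => <- q0.
      by field; rewrite !gt_eqF.
    rewrite lef_pV2 ?posrE ?mulr_gt0 // ler_pM2l // ler_wsqrtr // ler_nat //.
  rewrite sumEFin lee_fin -mulr_sumr [6 * C]mulrC -mulrA ler_wpM2l //.
  apply: le_trans (sum_inv_sqrt3 R N0 (leq_addr k N)).
  rewrite -{3}[N]add0n big_addn addKn.
  rewrite [leRHS](eq_bigr (fun m => ((N + m)%:R * Num.sqrt (N + m)%:R)^-1)) //.
  by move=> m _; rewrite addnC.
- by move=> m; exact: measurable_itv.
- apply: ltn_trivIset => i j ij; rewrite -subset0 => x /= []; rewrite /F /= !in_itv /=.
  move=> /andP[_ a] /andP[b _]; have := le_lt_trans b a.
  rewrite ltrD2l ltrN2 ltf_pV2 ?posrE ?ltr0n // ltr_nat ltnS leqNgt.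
  by rewrite ltn_add2l ij.
Qed.

Let mesh_ge0 N n : 0 <= n%:R / N%:R :> R.
Proof. by rewrite divr_ge0. Qed.

Let mesh_le N a b : (a <= b)%N -> a%:R / N%:R <= b%:R / N%:R :> R.
Proof. by move=> ab; rewrite ler_wpM2r ?invr_ge0 // ler_nat. Qed.

Let mesh_le1 N n : (0 < N)%N -> (n <= N)%N -> n%:R / N%:R <= 1 :> R.
Proof. by move=> N0 nN; rewrite ler_pdivrMr ?ltr0n // mul1r ler_nat. Qed.

Let mesh_lt1 N n : (n < N)%N -> n%:R / N%:R < 1 :> R.
Proof.
by move=> nN; rewrite ltr_pdivrMr ?ltr0n ?(leq_ltn_trans _ nN) // mul1r ltr_nat.
Qed.

Let mesh_sub N n : n.+1%:R / N%:R - n%:R / N%:R = N%:R^-1 :> R.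
Proof. by rewrite -mulrBl -natr1 addrAC subrr add0r mul1r. Qed.

Definition rsum N : R := \sum_(1 <= n < N) h (n%:R / N%:R) / N%:R.

Let rsum_upper N k : (k < N)%N ->
  (I 0 (k%:R / N%:R) <= (\sum_(1 <= n < k.+1) h (n%:R / N%:R) / N%:R)%:E)%E.
Proof.
elim: k => [|k IH] kN.
  rewrite mul0r big_geq // /I set_itvco0 integral_set0 //.
have kN' := ltnW kN.
rewrite (@I_split _ (k%:R / N%:R)) ?mesh_ge0 ?mesh_le ?mesh_le1 //; last first.
- exact: leq_trans kN.
rewrite big_nat_recr //= EFinD; apply: leeD; first exact: IH.
rewrite -[X in h _ * X](mesh_sub N k).
by apply: I_le; rewrite ?mesh_ge0 ?mesh_le ?mesh_lt1.
Qed.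

Let rsum_lower N k : (0 < k)%N -> (k <= N)%N ->
  ((\sum_(1 <= n < k) h (n%:R / N%:R) / N%:R)%:E <= I (1%:R / N%:R) (k%:R / N%:R))%E.
Proof.
case: k => // k _; elim: k => [|k IH] kN.
  by rewrite big_geq // I_ge0 ?mesh_ge0 // mesh_le1.
have N0 : (0 < N)%N by exact: leq_trans kN.
rewrite (@I_split _ (k.+1%:R / N%:R)) ?mesh_ge0 ?mesh_le ?mesh_le1 //.
rewrite big_nat_recr //= EFinD; apply: leeD; first by apply: IH; exact: ltnW.
rewrite -[X in h _ * X](mesh_sub N k.+1).
by apply: I_ge; rewrite ?mesh_ge0 ?mesh_le ?mesh_lt1 ?mesh_le1.
Qed.

Lemma mono_fin : (I 0 1 <= (6 * C)%:E)%E.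
Proof.
have := mono_tail (ltn0Sn 0); rewrite invr1 subrr.
by rewrite /sqrtw sqrtr1 invr1 mulr1.
Qed.

Let I01_fin : I 0 1 \is a fin_num.
Proof.
by rewrite ge0_fin_numE ?I_ge0 // (le_lt_trans mono_fin) ?ltry.
Qed.

Lemma mono_integrable : mu.-integrable `](0 : R), (1 : R)[%classic (EFin \o h).
Proof.
apply: (@integrableS _ _ _ mu `[(0 : R), (1 : R)[%classic) => //.
  by apply: subset_itvr; rewrite bnd_simp.
apply/integrableP; split; first exact/measurable_EFinP.
apply: (@le_lt_trans _ _ (I 0 1)); last by rewrite (le_lt_trans mono_fin) ?ltry.
apply: ge0_le_integral => //=.
- by do 2 apply: measurableT_comp => //.
- exact: meas.
- move=> x /(nonneg (lexx 0) (lexx 1)) /=.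
  by rewrite !lee_fin => h0; rewrite ger0_norm.
Qed.

(** Lower and upper sums of a monotone function differ by the integral over
    the last cell. *)
Theorem mono_riemann N : (0 < N)%N ->
  `|rsum N - \int[mu]_(x in `](0 : R), (1 : R)[) h x| <= 6 * C * sqrtw R N.
Proof.
move=> N0.
have -> : \int[mu]_(x in `](0 : R), (1 : R)[) h x = fine (I 0 1).
  by rewrite Rintegral_itv_obnd_cbnd //; exact: mono_integrable.
have N1 : 1%:R / N%:R <= 1 :> R by rewrite mesh_le1.
have e1 : N%:R / N%:R = 1 :> R by rewrite mulfV ?pnatr_eq0 -?lt0n.
have lo : rsum N <= fine (I 0 1).
  rewrite -lee_fin fineK //; apply: le_trans (rsum_lower N0 (leqnn N)) _.
  rewrite e1 (@I_split 0 (1%:R / N%:R)) ?mesh_ge0 //.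
  by apply: leeDr; apply: I_ge0; rewrite // mesh_le1.
have up : fine (I 0 1) <= rsum N + 6 * C * sqrtw R N.
  have Np : (N.-1 < N)%N by rewrite prednK.
  have e2 : N.-1%:R / N%:R = 1 - N%:R^-1 :> R.
    apply: (canRL (addrK _)); rewrite -[X in _ + X](mesh_sub N N.-1) prednK //.
    by rewrite e1 addrC subrK.
  rewrite -lee_fin fineK // (@I_split 0 (N.-1%:R / N%:R)) ?mesh_ge0 //; last first.
    by rewrite mesh_le1 // ltnW.
  rewrite EFinD; apply: leeD; last by rewrite e2; exact: mono_tail.
  by apply: le_trans (rsum_upper Np) _; rewrite prednK.
by rewrite ler_distlC; apply/andP; split; move: lo up; have := sqrtw_ge0 R N0; nra.
Qed.

End Monotone.

(** Integrability is part of the notion since the integral of a combination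
    splits only for integrable functions. *)
Definition riemann_good (h : R -> R) : Prop :=
  mu.-integrable `](0 : R), (1 : R)[%classic (EFin \o h) /\
  exists C : R, forall N, (0 < N)%N ->
    `|rsum h N - \int[mu]_(x in `](0 : R), (1 : R)[) h x| <= C * sqrtw R N.

Lemma eq_rsum (f g : R -> R) : {in `](0 : R), (1 : R)[, f =1 g} -> rsum f =1 rsum g.
Proof.
move=> fg N; apply: eq_big_nat => n /andP[n0 nN]; rewrite fg // in_itv /=.
have N0 : 0 < N%:R :> R by rewrite ltr0n (leq_ltn_trans _ nN).
by apply/andP; split; [rewrite divr_gt0 // ltr0n|rewrite ltr_pdivrMr // mul1r ltr_nat].
Qed.

Definition riemann_err (h : R -> R) N : R :=
  rsum h N - \int[mu]_(x in `](0 : R), (1 : R)[) h x.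

Lemma eq_riemann_err (f g : R -> R) :
  {in `](0 : R), (1 : R)[, f =1 g} -> riemann_err f =1 riemann_err g.
Proof.
move=> fg N; rewrite /riemann_err (eq_rsum fg); congr (_ - _).
by apply: eq_Rintegral => x /set_mem /= /fg ->.
Qed.

Lemma eq_riemann_good (f g : R -> R) :
  {in `](0 : R), (1 : R)[, f =1 g} -> riemann_good f -> riemann_good g.
Proof.
move=> fg [intf [C HC]]; split.
  by apply: eq_integrable intf => // x /set_mem /= /fg ->.
by exists C => N N0; rewrite -[X in `|X|](eq_riemann_err fg) HC.
Qed.

Lemma riemann_err_lin (f g : R -> R) (a b : R) N :
  riemann_good f -> riemann_good g ->
  riemann_err (fun x => a * f x + b * g x) N = a * riemann_err f N + b * riemann_err g N.
Proof.
move=> [intf _] [intg _]; rewrite /riemann_err.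
rewrite RintegralD //.
- rewrite !RintegralZl // !mulrBr.
  have -> : rsum (fun x => a * f x + b * g x) N = a * rsum f N + b * rsum g N.
    rewrite /rsum !mulr_sumr -big_split; apply: eq_bigr => n _ /=; ring.
  by ring.
- by apply: eq_integrable (integrableZl _ a intf) => // x _; rewrite /= EFinM.
- by apply: eq_integrable (integrableZl _ b intg) => // x _; rewrite /= EFinM.
Qed.

Lemma riemann_good_lin (f g : R -> R) (a b : R) :
  riemann_good f -> riemann_good g -> riemann_good (fun x => a * f x + b * g x).
Proof.
move=> gf gg; have [intf [C HC]] := gf; have [intg [C' HC']] := gg; split.
  have intaf : mu.-integrable `](0 : R), (1 : R)[%classic (EFin \o (fun x => a * f x)).
    by apply: eq_integrable (integrableZl _ a intf) => // x _; rewrite /= EFinM.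
  have intbg : mu.-integrable `](0 : R), (1 : R)[%classic (EFin \o (fun x => b * g x)).
    by apply: eq_integrable (integrableZl _ b intg) => // x _; rewrite /= EFinM.
  by apply: eq_integrable (integrableD _ intaf intbg) => // x _; rewrite /= EFinD.
exists (`|a| * C + `|b| * C') => N N0.
rewrite -/(riemann_err _ N) riemann_err_lin // mulrDl.
apply: (le_trans (ler_normD _ _)); rewrite !normrM -!mulrA.
by rewrite lerD // ler_wpM2l ?HC ?HC'.
Qed.

End Riemann.

Section LogMonomials.
Variable R : realType.
Notation mu := (@lebesgue_measure R).

(** By monotonicity the points [1 - 1 / n] suffice to express that the growth at
    [1] is logarithmic. *)
Definition mono_log (f : R -> R) : Prop :=
  [/\ forall x y : R, 0 <= x -> x <= y -> y < 1 -> f x <= f y,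
      forall x : R, 0 <= x -> x < 1 -> 0 <= f x &
      exists c : nat, forall n, (0 < n)%N ->
        f (1 - n%:R^-1) <= c%:R * lscale R n ^+ c].

Lemma mono_log_good f : mono_log f -> riemann_good f.
Proof.
move=> [fm f0 [c fc]]; have [C [C0 HC]] := lscale_exp_le_sqrt R c.
have C0' : 0 <= c%:R * C by rewrite mulr_ge0.
have fle n : (0 < n)%N -> f (1 - n%:R^-1) <= c%:R * C * Num.sqrt n%:R.
  by move=> n0; apply: (le_trans (fc n n0)); rewrite -mulrA ler_wpM2l // HC.
split; first exact: (mono_integrable fm f0 C0' fle).
by exists (6 * (c%:R * C)) => N N0; exact: (mono_riemann fm f0 C0' fle N0).
Qed.

Lemma mono_log1 : mono_log (fun=> 1).
Proof.
by split=> //; exists 1%N => n _; rewrite mul1r expr1 lscale_ge1.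
Qed.

Lemma mono_logM f g : mono_log f -> mono_log g -> mono_log (fun x => f x * g x).
Proof.
move=> [fm f0 [a fa]] [gm g0 [b gb]]; split.
- move=> x y x0 xy y1.
  by rewrite ler_pM ?fm ?gm ?f0 ?g0 ?(le_lt_trans xy y1).
- by move=> x x0 x1; rewrite mulr_ge0 ?f0 ?g0.
- exists (a * b + (a + b))%N => n n0.
  have h0 : 0 <= 1 - n%:R^-1 :> R by rewrite subr_ge0 invf_le1 ?ltr0n // ler1n.
  have h1 : 1 - n%:R^-1 < 1 :> R by rewrite gtrBl invr_gt0 ltr0n.
  apply: (le_trans (ler_pM (f0 _ h0 h1) (g0 _ h0 h1) (fa n n0) (gb n n0))).
  rewrite mulrACA -natrM -exprD.
  rewrite ler_pM ?exprn_ge0 ?lscale_ge0 ?ler_nat ?leq_addr //.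
  by rewrite ler_weXn2l ?lscale_ge1 ?leq_addl.
Qed.

Lemma mono_logX f n : mono_log f -> mono_log (fun x => f x ^+ n).
Proof.
move=> Hf; elim: n => [|n IH]; first exact: mono_log1.
by have := mono_logM Hf IH; under eq_fun do rewrite -exprS.
Qed.

(** Weighted concavity of the logarithm along segments starting at [1]. *)
Lemma ln_concave1 (w x : R) : 0 <= w <= 1 -> -1 < x -> w * ln (1 + x) <= ln (1 + w * x).
Proof.
move=> /andP[w0 w1] x1; have xp : 0 < 1 + x by lra.
have yp : 0 < 1 + w * x.
  move: w0; rewrite le_eqVlt => /predU1P[<-|wp]; first by rewrite mul0r addr0.
  by have := mulr_gt0 wp xp; rewrite mulrDr mulr1; lra.
have key z : 0 < z -> ln z - ln (1 + w * x) <= z / (1 + w * x) - 1.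
  move=> z0; rewrite -ln_div ?posrE //.
  have := @le_ln1Dx R (z / (1 + w * x) - 1); rewrite addrCA subrr addr0; apply.
  by rewrite ltrBrDl subrr divr_gt0.
have k1 := key _ xp; have := key _ ltr01; rewrite ln1 sub0r => k2.
have e : w * ((1 + x) / (1 + w * x) - 1) + (1 - w) * (1 / (1 + w * x) - 1) = 0.
  by field; rewrite gt_eqF.
have w1' : 0 <= 1 - w by lra.
have := ler_wpM2l w0 k1; have := ler_wpM2l w1' k2.
move: e; set a := _ / _; set b := _ / _; set L := ln (1 + w * x); set M := ln _.
lra.
Qed.

(** With these normalizations [A], [B], [Aq] and [Bq] are nonnegative and
    nondecreasing. *)
Let A (t : R) := ln (1 + t).
Let B (t : R) := - ln (1 - t).
Let Bq (t : R) := B t / t.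
Let Aq (t : R) := if t == 0 then 0 else 1 - A t / t.

Let c_bound (x : R) (n : nat) : x <= 1 -> x <= 1%:R * lscale R n ^+ 1.
Proof. by move=> x1; rewrite mul1r expr1 (le_trans x1) ?lscale_ge1. Qed.

Lemma mono_log_ln1p : mono_log (fun t : R => ln (1 + t)).
Proof.
split.
- move=> x y x0 xy y1; rewrite ler_ln ?posrE; lra.
- by move=> x x0 x1; rewrite ln_ge0 // lerDl.
- exists 1%N => n n0; apply: c_bound.
  have h : 0 <= 1 - n%:R^-1 :> R by rewrite subr_ge0 invf_le1 ?ltr0n // ler1n.
  apply: le_trans (le_ln1Dx _) _; first by lra.
  by rewrite gerBl invr_ge0.
Qed.

Let ln1mV n : (0 < n)%N -> B (1 - n%:R^-1) = ln n%:R.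
Proof.
by move=> n0; rewrite /B opprB addrCA subrr addr0 lnV ?opprK // posrE ltr0n.
Qed.

Lemma mono_log_ln1m : mono_log (fun t : R => - ln (1 - t)).
Proof.
split.
- move=> x y x0 xy y1; rewrite lerN2 ler_ln ?posrE; lra.
- move=> x x0 x1; rewrite oppr_ge0 ln_le0 //; lra.
- exists 1%N => n n0; rewrite mul1r expr1 -/(B _) ln1mV //.
  by rewrite (le_trans (harmonic_ge_ln R n0)) // lerDr.
Qed.

Let mono_Bq : mono_log Bq.
Proof.
have B0 x : 0 <= x -> x < 1 -> 0 <= B x by have [_ h _] := mono_log_ln1m; exact: h.
have B0q x : 0 <= x -> x < 1 -> 0 <= Bq x by move=> x0 x1; rewrite divr_ge0 ?B0.
split=> //.
- move=> x y x0 xy y1; have [->|xn0] := eqVneq x 0.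
    by rewrite {1}/Bq invr0 mulr0 B0q // (le_trans x0).
  have xp : 0 < x by rewrite lt_def xn0.
  have yp : 0 < y by exact: lt_le_trans xy.
  have hw : 0 <= x / y <= 1.
    by apply/andP; split; [rewrite divr_ge0 // ltW | rewrite ler_pdivrMr // mul1r].
  have := @ln_concave1 (x / y) (- y) hw; rewrite ltrN2 => /(_ y1).
  rewrite mulrN divfK ?gt_eqF // => h.
  rewrite /Bq ler_pdivrMr // /B.
  have -> : - ln (1 - y) / y * x = - (x / y * ln (1 - y)) by ring.
  by rewrite lerN2.
- exists 2 => n n0; rewrite /Bq ln1mV //.
  have ln0' : 0 <= ln n%:R :> R by rewrite ln_ge0 // ler1n.
  have lH := harmonic_ge_ln R n0.
  case: n n0 ln0' lH => [//|[|n]] _ ln0' lH.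
    by rewrite ln1 mul0r mulr_ge0 ?exprn_ge0 ?lscale_ge0.
  have h2 : n.+2%:R^-1 <= 2^-1 :> R by rewrite lef_pV2 ?posrE ?ltr0n // ler_nat.
  have h3 : 0 < n.+2%:R^-1 :> R by rewrite invr_gt0 ltr0n.
  move: h2 h3; move: n.+2%:R^-1 (lscale_ge1 R n.+2) => q L1 h2 h3.
  rewrite ler_pdivrMr; last by lra.
  apply: (@le_trans _ _ (lscale R n.+2)); first by rewrite (le_trans lH) // lerDr.
  move: L1; set L := lscale _ _ => L1.
  have h4 : 2^-1 <= 1 - q by lra.
  apply: (@le_trans _ _ (2%:R * L ^+ 2 * 2^-1)); last by rewrite ler_wpM2l // mulr_ge0 ?exprn_ge0 //; lra.
  by rewrite expr2; nra.
Qed.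

Let mono_Aq : mono_log Aq.
Proof.
have Aq0 x : 0 <= x -> x < 1 -> 0 <= Aq x.
  move=> x0 x1; rewrite /Aq; case: eqP => // /eqP xn0.
  have xp : 0 < x by rewrite lt_def xn0.
  by rewrite subr_ge0 ler_pdivrMr // mul1r /A le_ln1Dx //; lra.
split=> //.
- move=> x y x0 xy y1; rewrite {1}/Aq; have [_|xn0] := eqVneq x 0.
    by apply: Aq0; rewrite // (le_trans x0).
  have xp : 0 < x by rewrite lt_def xn0.
  have yp : 0 < y by exact: lt_le_trans xy.
  have hw : 0 <= x / y <= 1.
    by apply/andP; split; [rewrite divr_ge0 // ltW | rewrite ler_pdivrMr // mul1r].
  have := @ln_concave1 (x / y) y hw; rewrite divfK ?gt_eqF // => h.
  rewrite /Aq gt_eqF // lerD2l lerN2 ler_pdivlMr // /A.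
  have -> : ln (1 + y) / y * x = x / y * ln (1 + y) by ring.
  by apply: h; lra.
- exists 1%N => n n0; apply: c_bound.
  have h : 0 <= 1 - n%:R^-1 :> R by rewrite subr_ge0 invf_le1 ?ltr0n // ler1n.
  rewrite /Aq; case: eqP => // _; rewrite gerBl divr_ge0 //.
  by rewrite /A ln_ge0 // lerDl.
Qed.

Definition log_monomial (i l : nat) (t : R) : R := ln (1 + t) ^+ i * ln (1 - t) ^+ l / t.

(** With a factor [ln (1 - t)], dividing that factor by [t] keeps it monotone up
    to sign. Otherwise [ln (1 + t) / t] decreases, and one writes it as [1 - Aq]
    to get a difference of two monotone functions. *)
Lemma log_monomial_good i l : (0 < i + l)%N -> riemann_good (log_monomial i l).
Proof.
case: l => [|l] il.
  case: i il => // i _.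
  have g1 := mono_log_good (mono_logX i mono_log_ln1p).
  have g2 := mono_log_good (mono_logM (mono_logX i mono_log_ln1p) mono_Aq).
  apply: eq_riemann_good (riemann_good_lin 1 (-1) g1 g2) => t.
  rewrite in_itv /= => /andP[t0 t1]; rewrite /Aq gt_eqF // /log_monomial /A exprS.
  by field; rewrite gt_eqF.
have g := mono_log_good (mono_logM (mono_logM (mono_logX i mono_log_ln1p)
  (mono_logX l mono_log_ln1m)) mono_Bq).
apply: eq_riemann_good (riemann_good_lin ((-1) ^+ l.+1) 0 g g) => t.
rewrite in_itv /= => /andP[t0 t1]; rewrite /Bq /log_monomial /B mul0r addr0.
set b := - ln (1 - t); have -> : ln (1 - t) = - b by rewrite opprK.
by rewrite [(- b) ^+ _]exprNn [b ^+ l.+1]exprSr; ring.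
Qed.

(** * The constant term *)

Local Notation H := (harmonicT R).

(** The Taylor coefficients at [X] of the summand [a] of [Cxy]. *)
Definition Cxy_taylor (k : seq nat) (j m a i l : nat) (X : R) : R :=
  (-1) ^+ (sumn (take j k) + a)
  * ((zeta_star_m R a (rev (take j k)))^`N(i)).[X]
  * ((zeta_star_m R (m - a) (drop j.+1 k))^`N(l)).[X].

Lemma Cxy_taylorE k j m (X u v : R) : Cxy k j m (X + u) (X + v)
  = \sum_(a < m.+1) \sum_(i < size (zeta_star_m R a (rev (take j k))))
      \sum_(l < size (zeta_star_m R (m - a) (drop j.+1 k)))
      Cxy_taylor k j m a i l X * (u ^+ i * v ^+ l).
Proof.
apply: eq_bigr => a _; rewrite !nderiv_taylor; try exact: mulrC.
rewrite -mulrA mulr_suml mulr_sumr; apply: eq_bigr => i _.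
rewrite mulr_sumr mulr_sumr; apply: eq_bigr => l _.
by rewrite /Cxy_taylor; ring.
Qed.

(** At [i = l = 0] the pole at the origin disappears only from this
    difference. *)
Definition log_antisym (i l : nat) (t : R) : R :=
  log_monomial i l t - (ln (1 - t) ^+ i * ln (1 + t) ^+ l / t).

Lemma riemann_good0 : riemann_good (fun=> 0 : R).
Proof.
have g := mono_log_good mono_log1.
by apply: eq_riemann_good (riemann_good_lin 0 0 g g) => x _; rewrite !mul0r addr0.
Qed.

Lemma log_antisym_good i l : riemann_good (log_antisym i l).
Proof.
have [/eqP il|il] := posnP (i + l).
  apply: eq_riemann_good riemann_good0 => t _.
  move: il; rewrite addn_eq0 => /andP[/eqP-> /eqP->].
  by rewrite /log_antisym /log_monomial !expr0 subrr.
have il' : (0 < l + i)%N by rewrite addnC.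
have g1 := log_monomial_good il; have g2 := log_monomial_good il'.
apply: eq_riemann_good (riemann_good_lin 1 (-1) g1 g2) => t _.
by rewrite /log_antisym /log_monomial mul1r mulN1r [X in _ = _ - X / t]mulrC.
Qed.

Definition C0_integrand (k : seq nat) (X t : R) : R :=
  (calR k (X + ln (1 + t)) (X + ln (1 - t))
   - calR k (X + ln (1 - t)) (X + ln (1 + t))) / t.

Lemma C0_integrandE k X t : C0_integrand k X t
  = \sum_(j < size k) \sum_(a < (nth 0%N k j).-1.+1)
    \sum_(i < size (zeta_star_m R a (rev (take j k))))
    \sum_(l < size (zeta_star_m R ((nth 0%N k j).-1 - a) (drop j.+1 k)))
      Cxy_taylor k j (nth 0%N k j).-1 a i l X * log_antisym i l t.
Proof.
rewrite /C0_integrand /calR -sumrB mulr_suml; apply: eq_bigr => j _.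
rewrite !Cxy_taylorE -sumrB mulr_suml; apply: eq_bigr => a _.
rewrite -sumrB mulr_suml; apply: eq_bigr => i _.
rewrite -sumrB mulr_suml; apply: eq_bigr => l _.
by rewrite /log_antisym /log_monomial; ring.
Qed.

Local Notation plogn := (plog (fun M => (0 < M)%N) (@lscale R)).

(** The function may vary with the number of cells, as the base point of
    [C0_integrand] does. *)
Definition riemann_family (f : nat -> R -> R) : Prop :=
  (forall N, riemann_good (f N)) /\
  plogn (@sqrtw R) (fun N => riemann_err (f N) N).

Let L1 M : (0 < M)%N -> 1 <= lscale R M. Proof. by move=> _; exact: lscale_ge1. Qed.
Let s0 M : (0 < M)%N -> 0 <= sqrtw R M. Proof. exact: sqrtw_ge0. Qed.

Lemma eq_riemann_family (f g : nat -> R -> R) :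
  (forall N x, f N x = g N x) -> riemann_family f -> riemann_family g.
Proof.
move=> fg [Hf Ef]; split=> [N|]; first by apply: eq_riemann_good (Hf N) => x _.
apply: eq_plog Ef => N _; exact: eq_riemann_err.
Qed.

Lemma riemann_family_lin (f g : nat -> R -> R) (c d : nat -> R) :
  plogn (fun=> 1) c -> plogn (fun=> 1) d ->
  riemann_family f -> riemann_family g ->
  riemann_family (fun N x => c N * f N x + d N * g N x).
Proof.
move=> pc pd [Hf Ef] [Hg Eg]; split=> [N|]; first exact: riemann_good_lin.
have := plogD L1 s0 (plogMl L1 s0 pc Ef) (plogMl L1 s0 pd Eg).
by apply: eq_plog => N _; rewrite riemann_err_lin.
Qed.

Lemma riemann_family_cst (f : R -> R) : riemann_good f -> riemann_family (fun=> f).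
Proof.
move=> gf; split=> //; have [_ [C HC]] := gf.
by apply: (plogP L1 (C := C) (c := 0)) => // N N0; rewrite expr0 mulr1 HC.
Qed.

Lemma riemann_family_sum (J : Type) (r : seq J) (f : J -> nat -> R -> R) :
  (forall j, riemann_family (f j)) ->
  riemann_family (fun N x => \sum_(j <- r) f j N x).
Proof.
move=> Hf; elim: r => [|j r IH].
  by apply: eq_riemann_family (riemann_family_cst riemann_good0) => N x; rewrite big_nil.
have p1 := plog_cst L1 1.
apply: eq_riemann_family (riemann_family_lin p1 p1 (Hf j) IH) => N x.
by rewrite big_cons !mul1r.
Qed.

(** By Taylor expansion the integrand is a combination of finitely many fixed
    functions whose coefficients are polynomials in the harmonic number. *)
Lemma C0_riemann k : is_index k -> plogn (@sqrtw R)
  (fun N => rsum (C0_integrand k (H N)) N - C0 k (H N)).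
Proof.
move=> ik; suff [_ ] : riemann_family (fun N => C0_integrand k (H N)) by [].
have pH := plog_harmonic R.
apply: (eq_riemann_family (f := fun N t => \sum_(j < size k) \sum_(a < (nth 0%N k j).-1.+1)
    \sum_(i < size (zeta_star_m R a (rev (take j k))))
    \sum_(l < size (zeta_star_m R ((nth 0%N k j).-1 - a) (drop j.+1 k)))
      (Cxy_taylor k j (nth 0%N k j).-1 a i l (H N) * log_antisym i l t
       + 0 * log_antisym i l t))).
  move=> N t; rewrite C0_integrandE.
  do 4 (apply: eq_bigr => ? _); by rewrite mul0r addr0.
do 4 (apply: riemann_family_sum => ?).
apply: riemann_family_lin; [|exact: plog_cst|exact/riemann_family_cst/log_antisym_good..].
apply: plogMl => //; last exact: plog_horner.
by apply: plogZ => //; exact: plog_horner.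
Qed.

End LogMonomials.

(** * Complex norm and trigonometric functions *)

Section ComplexNorm.
Variable R : realType.
Notation C := R[i].

(** A real-valued norm: the values of the norm of [C] are themselves complex. *)
Definition cnorm (z : C) : R := ComplexField.Normc.normc z.

Lemma normrC (z : C) : `|z| = (cnorm z)%:C.
Proof. by []. Qed.

Lemma cnormM z w : cnorm (z * w) = cnorm z * cnorm w.
Proof. exact: ComplexField.Normc.normcM. Qed.

Lemma cnormV z : cnorm z^-1 = (cnorm z)^-1.
Proof. exact: ComplexField.Normc.normcV. Qed.

Lemma cnorm0 : cnorm 0 = 0. Proof. exact: ComplexField.Normc.normc0. Qed.
Lemma cnorm1 : cnorm 1 = 1. Proof. exact: ComplexField.Normc.normc1. Qed.

Lemma cnorm_ge0 z : 0 <= cnorm z.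
Proof. by case: z => a b; apply: sqrtr_ge0. Qed.

Lemma cnormD z w : cnorm (z + w) <= cnorm z + cnorm w.
Proof. by rewrite -lecR rmorphD /= -!normrC ler_normD. Qed.

Lemma cnormN z : cnorm (- z) = cnorm z.
Proof. by apply: complexI; rewrite -!normrC normrN. Qed.

Lemma cnormB z w : cnorm (z - w) <= cnorm z + cnorm w.
Proof. by rewrite -(cnormN w) cnormD. Qed.

Lemma cnormX z n : cnorm (z ^+ n) = cnorm z ^+ n.
Proof.
by elim: n => [|n IH]; rewrite ?expr0 ?cnorm1 // !exprS cnormM IH.
Qed.

Lemma cnorm_eq0 z : (cnorm z == 0) = (z == 0).
Proof.
apply/eqP/eqP => [|->]; last exact: cnorm0.
exact: ComplexField.Normc.eq0_normc.
Qed.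

Lemma cnorm_gt0 z : (0 < cnorm z) = (z != 0).
Proof. by rewrite lt_def cnorm_eq0 cnorm_ge0 andbT. Qed.

Lemma cnorm_real (x : R) : cnorm x%:C = `|x|.
Proof. by rewrite /cnorm /= expr0n /= addr0 sqrtr_sqr. Qed.

Lemma cnorm_nat n : cnorm n%:R = n%:R.
Proof. by rewrite -(rmorph_nat (real_complex R)) cnorm_real ger0_norm. Qed.

Lemma cnorm_Re z : `|complex.Re z| <= cnorm z.
Proof. by rewrite -lecR -normrC normc_ge_Re. Qed.

Lemma cnorm_le_sum (a b : R) : cnorm (a +i* b) <= `|a| + `|b|.
Proof.
rewrite /cnorm /= -[leRHS]ger0_norm ?addr_ge0 // -sqrtr_sqr ler_wsqrtr //.
rewrite sqrrD !real_normK ?num_real // lerD2r lerDl mulrn_wge0 // mulr_ge0 //.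
Qed.

Lemma cnorm_sum (J : Type) (r : seq J) (P : pred J) (F : J -> C) :
  cnorm (\sum_(j <- r | P j) F j) <= \sum_(j <- r | P j) cnorm (F j).
Proof.
elim/big_rec2: _ => [|j x y _ xy]; first by rewrite cnorm0.
by apply: (le_trans (cnormD _ _)); rewrite lerD2l.
Qed.

End ComplexNorm.

Section ComplexTrig.
Variable R : realType.
Notation C := R[i].
Notation I := (iC R).
Implicit Types z w : C.

Lemma expCD (z w : C) : expC (z + w) = expC z * expC w.
Proof.
case: z w => [a b] [c d]; apply/eqP; rewrite eq_complex /= expRD cosD sinD.
by apply/andP; split; apply/eqP; ring.
Qed.

Lemma expC0 : expC (0 : C) = 1.
Proof. by rewrite /expC /= expR0 cos0 sin0 mulr0 mulr1. Qed.

Lemma expC_neq0 (z : C) : expC z != 0.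
Proof.
have h : expC (- z) * expC z = 1 by rewrite -expCD addNr expC0.
by apply: contra_eq_neq h => ->; rewrite mulr0 eq_sym oner_neq0.
Qed.

Lemma expCN (z : C) : expC (- z) = (expC z)^-1.
Proof.
by apply: (mulIf (expC_neq0 z)); rewrite -expCD addNr expC0 mulVf ?expC_neq0.
Qed.

Definition cis (z : C) : C := expC (I * z).

Lemma cisD z w : cis (z + w) = cis z * cis w.
Proof. by rewrite /cis mulrDr expCD. Qed.

Lemma cisN z : cis (- z) = (cis z)^-1.
Proof. by rewrite /cis mulrN expCN. Qed.

Lemma cis_neq0 z : cis z != 0.
Proof. exact: expC_neq0. Qed.

Lemma cisE x y : cis (x +i* y) = (expR (- y) * cos x) +i* (expR (- y) * sin x).
Proof. by rewrite /cis /iC /expC /= !mul0r !mul1r sub0r add0r. Qed.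

Lemma cis_pi : cis (pi : R)%:C = -1.
Proof.
by rewrite cisE oppr0 expR0 cospi sinpi mulr0 mul1r; apply/eqP; rewrite eq_complex /= oppr0 !eqxx.
Qed.

Lemma iC_sqr : I * I = -1.
Proof. by apply/eqP; rewrite eq_complex /= !(mul0r, mulr0, mulr1) sub0r addr0 oppr0 !eqxx. Qed.

Lemma iC_neq0 : I != 0.
Proof. by rewrite eq_complex /= negb_and oner_neq0 orbT. Qed.

Lemma two_iC_neq0 : 2 * I != 0.
Proof. by rewrite mulf_neq0 ?iC_neq0 // pnatr_eq0. Qed.

Lemma sinCE z : sinC z = (cis z - (cis z)^-1) / (2 * I).
Proof. by rewrite /sinC -mulrN -/(cis _) -/(cis (- z)) cisN. Qed.

Lemma cosCE z : cosC z = (cis z + (cis z)^-1) / 2.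
Proof. by rewrite /cosC -mulrN -/(cis _) -/(cis (- z)) cisN. Qed.

Lemma sinCD z w : sinC (z + w) = sinC z * cosC w + cosC z * sinC w.
Proof.
rewrite !sinCE !cosCE cisD; field.
by rewrite !cis_neq0 ?iC_neq0 ?pnatr_eq0.
Qed.

Lemma cosCD z w : cosC (z + w) = cosC z * cosC w - sinC z * sinC w.
Proof.
rewrite !sinCE !cosCE cisD.
have := cis_neq0 z; have := cis_neq0 w; move: (cis z) (cis w) => x y y0 x0.
have -> : (x - x^-1) / (2 * I) * ((y - y^-1) / (2 * I))
   = - ((x - x^-1) / 2 * ((y - y^-1) / 2)).
  rewrite mulf_div mulrACA iC_sqr mulf_div; field.
  by rewrite x0 y0 ?pnatr_eq0.
by field; rewrite x0 y0 ?pnatr_eq0.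
Qed.

Lemma sinC_pi : sinC (pi : R)%:C = 0.
Proof. by rewrite sinCE cis_pi invrN1 subrr mul0r. Qed.

Lemma cosC_pi : cosC (pi : R)%:C = -1.
Proof. by rewrite cosCE cis_pi invrN1; field. Qed.

Lemma sinCDpi z : sinC (z + (pi : R)%:C) = - sinC z.
Proof. by rewrite sinCD sinC_pi cosC_pi mulr0 addr0 mulrN1. Qed.

Lemma cosCDpi z : cosC (z + (pi : R)%:C) = - cosC z.
Proof. by rewrite cosCD sinC_pi cosC_pi mulr0 subr0 mulrN1. Qed.

Lemma cotCDpi z : cotC (z + (pi : R)%:C) = cotC z.
Proof. by rewrite /cotC sinCDpi cosCDpi invrN mulrNN. Qed.

Definition chR (y : R) : R := (expR y + expR (- y)) / 2.
Definition shR (y : R) : R := (expR y - expR (- y)) / 2.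

Lemma sinC_xy x y : sinC (x +i* y) = (chR y * sin x) +i* (shR y * cos x).
Proof.
have e : cis (x +i* y) - (cis (x +i* y))^-1 = 2 * I * ((chR y * sin x) +i* (shR y * cos x)).
  rewrite -cisN -[- (x +i* y)]/((- x) +i* (- y)) !cisE opprK cosN sinN /chR /shR.
  have -> : 2 * I = 0 +i* 2 :> C.
    by rewrite /iC -[2]/(2%:R) -(rmorph_nat (real_complex R)); apply/eqP; rewrite eq_complex /= !(mul0r, mulr0, mulr1) subrr addr0 !eqxx.
  apply/eqP; rewrite eq_complex /=; apply/andP; split; apply/eqP; by field.
by rewrite sinCE e mulrAC mulfV ?two_iC_neq0 // mul1r.
Qed.

Lemma cosC_xy x y : cosC (x +i* y) = (chR y * cos x) +i* (- (shR y * sin x)).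
Proof.
have e : cis (x +i* y) + (cis (x +i* y))^-1 = 2 * ((chR y * cos x) +i* (- (shR y * sin x))).
  rewrite -cisN -[- (x +i* y)]/((- x) +i* (- y)) !cisE opprK cosN sinN /chR /shR.
  have -> : 2 = 2 +i* 0 :> C by rewrite -[2 : C]/(2%:R) -(rmorph_nat (real_complex R)).
  apply/eqP; rewrite eq_complex /=; apply/andP; split; apply/eqP; by field.
by rewrite cosCE e mulrAC mulfV ?pnatr_eq0 ?mul1r.
Qed.

Lemma chR_ge1 y : 1 <= chR y.
Proof.
have := expR_ge1Dx y; have := expR_ge1Dx (- y).
by rewrite /chR ler_pdivlMr // mul1r; lra.
Qed.

Lemma sinC_ge z : `|sin (complex.Re z)| <= cnorm (sinC z).
Proof.
case: z => x y; rewrite sinC_xy; apply: le_trans (cnorm_Re _); rewrite /= normrM.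
by rewrite ler_peMl // ger0_norm ?chR_ge1 // (le_trans ler01) ?chR_ge1.
Qed.

Lemma sin_mvt (t : R) : 0 <= t -> exists2 c, 0 <= c <= t & sin t = t * cos c.
Proof.
rewrite le_eqVlt => /predU1P[<-|t0].
  by exists 0; rewrite ?lexx // sin0 mul0r.
have [|c] := @MVT R sin cos 0 t t0 (fun x _ => is_derive_sin x).
  by apply: continuous_subspaceT; exact: continuous_sin.
rewrite in_itv /= => /andP[c0 ct]; rewrite sin0 !subr0 mulrC => e.
by exists c; rewrite ?e // !ltW.
Qed.

Lemma sin_le (t : R) : `|sin t| <= `|t|.
Proof.
wlog t0 : t / 0 <= t => [H|].
  have [t0|/ltW t0] := leP 0 t; first exact: H.
  by rewrite -[leLHS]normrN -sinN -[leRHS]normrN H // oppr_ge0.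
by have [c _ ->] := sin_mvt t0; rewrite normrM ler_piMr // cos_max.
Qed.

(** A weak form of Jordan's inequality. *)
Lemma sin_ge_half (t : R) : `|t| <= pi / 2 -> `|t| / 2 <= `|sin t|.
Proof.
wlog t0 : t / 0 <= t => [H|].
  have [t0|/ltW t0] := leP 0 t; first exact: H.
  by have := H (- t); rewrite oppr_ge0 t0 sinN !normrN; apply.
rewrite ger0_norm // => tp.
have h0 : 0 <= t / 2 by rewrite divr_ge0.
have [c /andP[c0 ct] e] := sin_mvt h0.
have pi0 := pi_gt0 R.
have cc : cos (t / 2) <= cos c.
  move: ct; rewrite le_eqVlt => /predU1P[->//|ct].
  rewrite ltW // ltr_cos // in_itv /=; apply/andP; split; lra.
have c2 : 0 <= cos (t / 2) by rewrite cos_ge0_pihalf //; apply/andP; split; lra.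
have ct0 : 0 <= cos t by rewrite cos_ge0_pihalf //; apply/andP; split; lra.
have et : t = (t / 2) *+ 2 by rewrite mulr2n; field.
have es : sin t = cos (t / 2) * sin (t / 2) *+ 2 by rewrite {1}et sin_mulr2n.
have ec : cos t = cos (t / 2) ^+ 2 *+ 2 - 1 by rewrite {1}et cos_mulr2n.
have st : t / 2 <= sin t.
  rewrite es e; move: ec ct0 cc c2 h0; set a := cos (t / 2); set b := cos c; set u := t / 2.
  rewrite !mulr2n expr2 => -> ct0 cc c2 h0; have h1 : a * a <= a * b by rewrite ler_wpM2l.
  have h2 := ler_wpM2l h0 h1; nra.
by rewrite ger0_norm // (le_trans _ st).
Qed.

End ComplexTrig.

(** * The partial fractions of the cotangent *)

Section SmallArguments.
Variable R : realType.
Notation C := R[i].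

Lemma sin_sub_le (x : R) : `|x| <= 1 -> `|sin x - x| <= x ^+ 2.
Proof.
wlog x0 : x / 0 <= x => [H|] x1.
  have [x0|/ltW x0] := leP 0 x; first exact: H.
  have := H (- x); rewrite oppr_ge0 x0 normrN => /(_ isT x1).
  by rewrite sinN -opprD normrN sqrrN.
have [c /andP[c0 cx] ->] := sin_mvt x0.
have cc : 1 - cos c <= c.
  have := sin_le (c / 2); have -> : cos c = 1 - (sin (c / 2) ^+ 2) *+ 2.
    have -> : cos c = cos ((c / 2) *+ 2) by congr cos; rewrite mulr2n; field.
    by rewrite cos_mulr2n sin2cos2 mulrnBl; ring.
  have h0 : 0 <= c / 2 by lra.
  rewrite [X in _ <= X -> _](ger0_norm h0) => h.
  have : sin (c / 2) ^+ 2 <= (c / 2) ^+ 2.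
    by rewrite -[leLHS]real_normK ?num_real // lerXn2r ?nnegrE.
  rewrite ger0_norm // in x1.
  have c2 : c * c <= c by rewrite ler_piMr // (le_trans cx).
  by rewrite !expr2; lra.
have c1 := cos_le1 c.
rewrite -[X in _ * _ - X]mulr1 -mulrBr normrM ger0_norm // ler0_norm ?subr_le0 //.
by rewrite opprB expr2 ler_wpM2l // (le_trans cc).
Qed.

Lemma cos_sub_le (x : R) : `|x| <= 1 -> `|cos x - 1| <= x ^+ 2.
Proof.
move=> x1; have c1 := cos_le1 x.
rewrite ler0_norm ?subr_le0 // opprB.
have -> : cos x = 1 - (sin (x / 2) ^+ 2) *+ 2.
  have -> : cos x = cos ((x / 2) *+ 2) by congr cos; rewrite mulr2n; field.
  by rewrite cos_mulr2n sin2cos2 mulrnBl; ring.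
have : sin (x / 2) ^+ 2 <= (x / 2) ^+ 2.
  rewrite -[leLHS]real_normK ?num_real // -[leRHS]real_normK ?num_real //.
  by rewrite lerXn2r ?nnegrE // sin_le.
by have := sqr_ge0 x; rewrite !expr2; lra.
Qed.

Lemma expR_sub_le (y : R) : `|y| <= 2^-1 -> `|expR y - (1 + y)| <= 2 * y ^+ 2.
Proof.
rewrite ler_norml => /andP[y1 y2].
have h1 := expR_ge1Dx y; have h2 := expR_ge1Dx (- y).
have e := expRxMexpNx_1 y; have p := expR_gt0 y.
rewrite ger0_norm ?subr_ge0 // expr2.
have h3 : expR y * (1 - y) <= 1 by rewrite -[leRHS]e ler_wpM2l // ltW.
have h4 : 0 <= y * y by rewrite -expr2 sqr_ge0.
have h5 : expR y <= 2 by nra.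
by nra.
Qed.

Lemma chR_sub_le (y : R) : `|y| <= 2^-1 -> `|chR y - 1| <= 2 * y ^+ 2.
Proof.
move=> y1; have := expR_sub_le y1.
have := @expR_sub_le (- y); rewrite normrN sqrrN => /(_ y1).
by rewrite /chR !ler_norml => /andP[? ?] /andP[? ?]; apply/andP; split; lra.
Qed.

Lemma shR_sub_le (y : R) : `|y| <= 2^-1 -> `|shR y - y| <= 2 * y ^+ 2.
Proof.
move=> y1; have := expR_sub_le y1.
have := @expR_sub_le (- y); rewrite normrN sqrrN => /(_ y1).
by rewrite /shR !ler_norml => /andP[? ?] /andP[? ?]; apply/andP; split; lra.
Qed.

Let xy_le (x y : R) : (`|x| <= cnorm (x +i* y)) * (`|y| <= cnorm (x +i* y)).
Proof.
split; first exact: (cnorm_Re (x +i* y)).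
by rewrite /cnorm /= -[leLHS]sqrtr_sqr ler_wsqrtr // lerDr sqr_ge0.
Qed.

Lemma sinC_sub_le (z : C) : cnorm z <= 4^-1 -> cnorm (sinC z - z) <= 8 * cnorm z ^+ 2.
Proof.
case: z => x y; set r := cnorm _ => r4.
have [xr yr] := xy_le x y; rewrite -/r in xr yr.
have r0 : 0 <= r by exact: cnorm_ge0.
have x1 : `|x| <= 1 by lra.
have y1 : `|y| <= 2^-1 by lra.
rewrite sinC_xy -[_ - _]/((chR y * sin x - x) +i* (shR y * cos x - y)).
apply: (le_trans (cnorm_le_sum _ _)).
have sx := sin_sub_le x1; have cx := cos_sub_le x1.
have cy := chR_sub_le y1; have sy := shR_sub_le y1.
have x2 : x ^+ 2 <= r ^+ 2 by rewrite -[leLHS]real_normK ?num_real // lerXn2r ?nnegrE.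
have y2 : y ^+ 2 <= r ^+ 2 by rewrite -[leLHS]real_normK ?num_real // lerXn2r ?nnegrE.
have l1 : `|chR y * sin x - x| <= 3 * r ^+ 2.
  have -> : chR y * sin x - x = (chR y - 1) * sin x + (sin x - x) by ring.
  apply: (le_trans (ler_normD _ _)); rewrite normrM.
  have := ler_pM (normr_ge0 _) (normr_ge0 _) cy (sin_max x); rewrite mulr1; lra.
have l2 : `|shR y * cos x - y| <= 3 * r ^+ 2.
  have -> : shR y * cos x - y = (shR y - y) * cos x + y * (cos x - 1) by ring.
  apply: (le_trans (ler_normD _ _)); rewrite !normrM.
  have := ler_pM (normr_ge0 _) (normr_ge0 _) sy (cos_max x); rewrite mulr1.
  have y1' : `|y| <= 1 by lra.
  have := ler_pM (normr_ge0 _) (normr_ge0 _) y1' cx; rewrite mul1r; lra.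
by have := sqr_ge0 r; lra.
Qed.

Lemma cosC_sub_le (z : C) : cnorm z <= 4^-1 -> cnorm (cosC z - 1) <= 6 * cnorm z.
Proof.
case: z => x y; set r := cnorm _ => r4.
have [xr yr] := xy_le x y; rewrite -/r in xr yr.
have r0 : 0 <= r by exact: cnorm_ge0.
have x1 : `|x| <= 1 by lra.
have y1 : `|y| <= 2^-1 by lra.
rewrite cosC_xy -[_ - _]/((chR y * cos x - 1) +i* (- (shR y * sin x) - 0)).
apply: (le_trans (cnorm_le_sum _ _)); rewrite subr0 normrN.
have cx := cos_sub_le x1.
have cy := chR_sub_le y1; have sy := shR_sub_le y1.
have x2 : x ^+ 2 <= r ^+ 2 by rewrite -[leLHS]real_normK ?num_real // lerXn2r ?nnegrE.
have y2 : y ^+ 2 <= r ^+ 2 by rewrite -[leLHS]real_normK ?num_real // lerXn2r ?nnegrE.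
have r2 : r ^+ 2 <= r by rewrite expr2; nra.
have l1 : `|chR y * cos x - 1| <= 3 * r.
  have -> : chR y * cos x - 1 = (chR y - 1) * cos x + (cos x - 1) by ring.
  apply: (le_trans (ler_normD _ _)); rewrite normrM.
  have := ler_pM (normr_ge0 _) (normr_ge0 _) cy (cos_max x); rewrite mulr1; lra.
have l2 : `|shR y * sin x| <= 3 * r.
  rewrite normrM.
  have sy' : `|shR y| <= 3 * r.
    have -> : shR y = (shR y - y) + y by ring.
    by apply: (le_trans (ler_normD _ _)); lra.
  by have := ler_pM (normr_ge0 _) (normr_ge0 _) sy' (sin_max x); rewrite mulr1.
lra.
Qed.

Lemma cvg_cnorm (u : nat -> C^o) (a : C^o) (K : R) (t : nat -> R) :
  t @ \oo --> 0 -> (\forall n \near \oo, cnorm (u n - a) <= K * t n) ->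
  u @ \oo --> a.
Proof.
move=> t0 ut; apply/cvgrPdist_lt => e e0.
have er : e = (complex.Re e)%:C by rewrite RRe_real // ger0_real // ltW.
have r0 : 0 < complex.Re e by rewrite -ltcR -er.
have Kt0 : (fun n => K * t n) @ \oo --> 0.
  by rewrite -[X in _ --> X](mulr0 K); apply: cvgMr.
near=> n.
rewrite distrC normrC er ltcR; apply: (@le_lt_trans _ _ (K * t n)).
  by near: n.
have : `|K * t n| < complex.Re e.
  rewrite -normrN -sub0r; near: n; move/cvgrPdist_lt: Kt0; exact.
by apply: le_lt_trans; rewrite ler_norm.
Unshelve. all: by end_near.
Qed.

Lemma cnorm_lim_le (u : nat -> C^o) (a : C^o) (K : R) :
  u @ \oo --> a -> (\forall n \near \oo, cnorm (u n) <= K) -> cnorm a <= K.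
Proof.
move=> /cvgrPdist_lt ua uK; apply/ler_addgt0Pr => e e0.
have e0C : 0 < e%:C :> C by rewrite ltcR.
near \oo => n.
have h1 : cnorm (a - u n) < e.
  rewrite -ltcR -normrC; near: n; exact: ua.
have h2 : cnorm (u n) <= K by near: n.
rewrite -[a](subrK (u n)); apply: (le_trans (cnormD _ _)).
lra.
Unshelve. all: by end_near.
Qed.

End SmallArguments.

Section CotExpansion.
Variable R : realType.
Notation C := R[i].
Local Notation Pi := ((pi : R)%:C).

Lemma sinC_pihalf : sinC ((pi / 2 : R)%:C) = 1.
Proof. by rewrite sinC_xy sin_pihalf cos_pihalf mulr0 /chR oppr0 expR0; congr (_ +i* _); field. Qed.

Lemma cosC_pihalf : cosC ((pi / 2 : R)%:C) = 0.
Proof.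
by rewrite cosC_xy sin_pihalf cos_pihalf mulr0 /shR oppr0 expR0 subrr mul0r mul0r oppr0.
Qed.

Lemma cotC_double (u : C) : sinC (u + u) != 0 ->
  cotC (u + u) = (cotC u + cotC (u + (pi / 2 : R)%:C)) / 2.
Proof.
rewrite /cotC !sinCD !cosCD sinC_pihalf cosC_pihalf !(mulr0, mulr1, add0r, addr0, sub0r).
move: (cosC u) (sinC u) => c s h.
have s0 : s != 0 by apply: contraNneq h => ->; rewrite mulr0 mul0r addr0.
have c0 : c != 0 by apply: contraNneq h => ->; rewrite mulr0 mul0r addr0.
field.
by rewrite c0 s0 h.
Qed.

Lemma sinC_pow2_eq0 (u : C) n : sinC u = 0 -> sinC ((2 ^ n)%:R * u) = 0.
Proof.
move=> u0; elim: n => [|n IH]; first by rewrite mul1r.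
by rewrite expnS mul2n -addnn natrD mulrDl sinCD IH mul0r mulr0 addr0.
Qed.

Lemma sinCDpi_nat_eq0 (u : C) k : (sinC (u + k%:R * Pi) == 0) = (sinC u == 0).
Proof.
elim: k => [|k <-]; first by rewrite mul0r addr0.
by rewrite -natr1 mulrDl mul1r addrA sinCDpi oppr_eq0.
Qed.

(** Iterated bisection of the argument. *)
Lemma cotC_pow2 (z : C) n : sinC z != 0 ->
  cotC z = (2 ^ n)%:R^-1 * \sum_(0 <= k < 2 ^ n) cotC ((z + k%:R * Pi) / (2 ^ n)%:R).
Proof.
move=> z0; elim: n => [|n IH].
  by rewrite expn0 big_nat1 mul0r addr0 invr1 mul1r mulr1.
have n0 : (2 ^ n)%:R != 0 :> C by rewrite pnatr_eq0 expn_eq0.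
have e2 : (2 ^ n.+1)%:R = (2 ^ n)%:R + (2 ^ n)%:R :> C.
  by rewrite expnS mul2n -addnn natrD.
have n2 : (2 ^ n)%:R + (2 ^ n)%:R != 0 :> C by rewrite -e2 pnatr_eq0 expn_eq0.
rewrite {1}IH [in RHS](@big_cat_nat _ _ _ (2 ^ n)) //=; last by rewrite leq_exp2l.
have -> : \sum_(2 ^ n <= k < 2 ^ n.+1) cotC ((z + k%:R * Pi) / (2 ^ n.+1)%:R)
  = \sum_(0 <= k < 2 ^ n) cotC ((z + (k + 2 ^ n)%:R * Pi) / (2 ^ n.+1)%:R).
  by rewrite -{1}[(2 ^ n)%N]add0n big_addn expnS mul2n -addnn addnK.
rewrite -big_split /= !mulr_sumr; apply: eq_bigr => k _.
set u := (z + k%:R * Pi) / (2 ^ n.+1)%:R.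
have e : (z + k%:R * Pi) / (2 ^ n)%:R = u + u.
  by rewrite /u e2; field; rewrite n0 n2.
have -> : (z + (k + 2 ^ n)%:R * Pi) / (2 ^ n.+1)%:R = u + (pi / 2 : R)%:C.
  rewrite /u e2 natrD rmorphM fmorphV rmorph_nat /=; field.
  by rewrite n2 ?pnatr_eq0.
rewrite e cotC_double; last first.
  rewrite -e; apply: contraNneq z0 => /(@sinC_pow2_eq0 _ n).
  by rewrite mulrC divfK // => /eqP; rewrite sinCDpi_nat_eq0.
rewrite e2; field.
by rewrite n0 n2.
Qed.

(** By periodicity the shifts by [k] and by [2 ^ n.+1 - k] are opposite shifts;
    the sum of two cotangents at opposite shifts decays quadratically in [k],
    while single terms decay too slowly to be summed. *)
Lemma cotC_pairing (z : C) n : sinC z != 0 ->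
  cotC z = (2 ^ n.+1)%:R^-1 *
    (cotC (z / (2 ^ n.+1)%:R) + cotC (z / (2 ^ n.+1)%:R + (pi / 2 : R)%:C)
     + \sum_(1 <= k < 2 ^ n) (cotC ((z + k%:R * Pi) / (2 ^ n.+1)%:R)
                             + cotC ((z - k%:R * Pi) / (2 ^ n.+1)%:R))).
Proof.
move=> z0; rewrite {1}(cotC_pow2 n.+1 z0); congr (_ * _).
have m0 : (0 < 2 ^ n)%N by rewrite expn_gt0.
have e2 : (2 ^ n.+1 = 2 ^ n + 2 ^ n)%N by rewrite expnS mul2n addnn.
have N0 : (2 ^ n.+1)%:R != 0 :> C by rewrite pnatr_eq0 expn_eq0.
rewrite (@big_cat_nat _ _ _ (2 ^ n)) //=; last by rewrite e2 leq_addr.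
rewrite big_ltn // [X in _ + X]big_ltn; last by rewrite e2 -[ltnLHS]addn0 ltn_add2l.
rewrite mul0r addr0 big_split /=.
have -> : (z + (2 ^ n)%:R * Pi) / (2 ^ n.+1)%:R = z / (2 ^ n.+1)%:R + (pi / 2 : R)%:C.
  rewrite mulrDl; congr (_ + _); rewrite rmorphM fmorphV rmorph_nat /= e2 natrD.
  have n0 : (2 ^ n)%:R != 0 :> C by rewrite pnatr_eq0 expn_eq0.
  by field; rewrite -natrD -e2 N0 ?pnatr_eq0.
have -> : \sum_((2 ^ n).+1 <= k < 2 ^ n.+1) cotC ((z + k%:R * Pi) / (2 ^ n.+1)%:R)
  = \sum_(1 <= k < 2 ^ n) cotC ((z - k%:R * Pi) / (2 ^ n.+1)%:R).
  have [c ec] : exists c, c = (2 ^ n.+1)%N by exists (2 ^ n.+1)%N.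
  rewrite (@big_nat_reflect _ _ _ c) //; last first.
  - by rewrite ec; lia.
  - by rewrite e2; lia.
  have -> : (c.+1 - 2 ^ n.+1 = 1)%N by lia.
  have -> : (c.+1 - (2 ^ n).+1 = 2 ^ n)%N by lia.
  apply: eq_big_nat => k /andP[k1 kn].
  have -> : (z + (c - k)%:R * Pi) / (2 ^ n.+1)%:R = (z - k%:R * Pi) / (2 ^ n.+1)%:R + Pi.
    rewrite natrB; last by lia.
    by rewrite ec; field.
  by rewrite cotCDpi.
by rewrite [LHS](AC (2*2) ((1*3)*(2*4))).
Qed.

End CotExpansion.

Section CotSeries.
Variable R : realType.
Notation C := R[i].
Local Notation Pi := ((pi : R)%:C).

(** At level [n] of the pairing formula for [pi * s] the arguments are
    [tau n * (s + k)], and [tau n] is also [pi] times the leading factor. *)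
Definition tau (n : nat) : R := pi / (2 ^ n.+1)%:R.

Let tau_gt0 n : 0 < tau n.
Proof. by rewrite divr_gt0 ?pi_gt0 // ltr0n expn_gt0. Qed.

Let tauE n : tau n = pi / (2 ^ n.+1)%:R.
Proof. by []. Qed.

Local Opaque tau.

Let tau_cvg0 : tau @ \oo --> 0.
Proof.
have h : (fun n => pi * harmonic n) @ \oo --> (0 : R).
  by rewrite -[X in _ --> X](mulr0 pi); apply: cvgMr; exact: cvg_harmonic.
apply: squeeze_cvgr (@cvg_cst _ _ _ _ _) h; apply: nearW => n.
rewrite (ltW (tau_gt0 n)) /= tauE ler_wpM2l ?pi_ge0 // lef_pV2 ?posrE ?ltr0n ?expn_gt0 //.
by rewrite ler_nat; apply: (@leq_trans n.+1) => //; exact/ltnW/ltn_expl.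
Qed.

Let tauC_neq0 n : (tau n)%:C != 0 :> C.
Proof. by rewrite eq_complex /= eqxx andbT gt_eqF. Qed.

Let cnorm_tau n (w : C) : cnorm ((tau n)%:C * w) = tau n * cnorm w.
Proof. by rewrite cnormM cnorm_real ger0_norm // ltW. Qed.

Let near_small (B : R) : \forall n \near \oo, tau n * B <= 4^-1.
Proof.
have h : (fun n => tau n * B) @ \oo --> (0 : R).
  by rewrite -[X in _ --> X](mul0r B); apply: cvgMl.
near=> n; apply: ltW; apply: le_lt_trans (ler_norm _) _.
rewrite -normrN -sub0r; near: n; move/cvgrPdist_lt: h; apply.
by rewrite invr_gt0.
Unshelve. all: by end_near.
Qed.

Let cos_cvg (w : C) : (fun n => cosC ((tau n)%:C * w) : C^o) @ \oo --> (1 : C^o).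
Proof.
apply: (cvg_cnorm (K := 6 * cnorm w) tau_cvg0).
near=> n; rewrite -mulrA [cnorm w * _]mulrC -cnorm_tau; apply: cosC_sub_le.
by rewrite cnorm_tau; near: n; exact: near_small.
Unshelve. all: by end_near.
Qed.

Let sin_cvg (w : C) : (fun n => sinC ((tau n)%:C * w) / (tau n)%:C : C^o) @ \oo --> (w : C^o).
Proof.
apply: (cvg_cnorm (K := 8 * cnorm w ^+ 2) tau_cvg0).
near=> n; set u := (tau n)%:C * w.
have -> : sinC u / (tau n)%:C - w = (sinC u - u) / (tau n)%:C.
  by rewrite mulrBl /u [_ * w]mulrC mulfK.
rewrite cnormM cnormV cnorm_real (ger0_norm (ltW (tau_gt0 n))) ler_pdivrMr //.
apply: (le_trans (sinC_sub_le _)).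
  by rewrite cnorm_tau; near: n; exact: near_small.
by rewrite cnorm_tau le_eqVlt; apply/orP; left; apply/eqP; ring.
Unshelve. all: by end_near.
Qed.

Let tauC_cvg : (fun n => (tau n)%:C : C^o) @ \oo --> (0 : C^o).
Proof.
apply: (cvg_cnorm (K := 1) tau_cvg0); apply: nearW => n.
by rewrite subr0 cnorm_real mul1r ger0_norm // ltW.
Qed.

Let cot_cvg (w : C) : w != 0 ->
  (fun n => (tau n)%:C * cotC ((tau n)%:C * w) : C^o) @ \oo --> (w^-1 : C^o).
Proof.
move=> w0.
have e n : (tau n)%:C * cotC ((tau n)%:C * w)
    = cosC ((tau n)%:C * w) * (sinC ((tau n)%:C * w) / (tau n)%:C)^-1.
  have gen (a b c : C) : c * (a / b) = a * (b / c)^-1 by rewrite invf_div mulrCA.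
  exact: gen.
under eq_fun do rewrite e.
suff h : (fun n => cosC ((tau n)%:C * w) * (sinC ((tau n)%:C * w) / (tau n)%:C)^-1 : C^o)
    @ \oo --> (1 * w^-1 : C^o) by rewrite mul1r in h.
have c2 : (fun n => (sinC ((tau n)%:C * w) / (tau n)%:C)^-1 : C^o) @ \oo --> (w^-1 : C^o).
  pose f n : C := sinC ((tau n)%:C * w) / (tau n)%:C.
  apply: (@cvgV _ _ _ _ f w w0); exact: sin_cvg.
exact: (cvgM (cos_cvg w) c2).
Qed.

Let tan_cvg (w : C) :
  (fun n => (tau n)%:C * cotC ((tau n)%:C * w + (pi / 2 : R)%:C) : C^o) @ \oo --> (0 : C^o).
Proof.
have e n : (tau n)%:C * cotC ((tau n)%:C * w + (pi / 2 : R)%:C)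
    = (tau n)%:C * (- ((tau n)%:C * (sinC ((tau n)%:C * w) / (tau n)%:C)))
      * (cosC ((tau n)%:C * w))^-1.
  rewrite /cotC sinCD cosCD sinC_pihalf cosC_pihalf !(mulr0, mulr1, add0r, sub0r).
  have gen (a c : C) : c != 0 -> c * (a / c) = a by move=> c0; rewrite mulrC divfK.
  by rewrite gen // mulrA.
under eq_fun do rewrite e.
suff h : (fun n => (tau n)%:C * (- ((tau n)%:C * (sinC ((tau n)%:C * w) / (tau n)%:C)))
      * (cosC ((tau n)%:C * w))^-1 : C^o) @ \oo --> (0 * (- (0 * w)) * 1^-1 : C^o).
  by rewrite !mul0r in h.
apply: cvgM; last by apply: cvgV; [exact: oner_neq0|exact: cos_cvg].
apply: cvgM; first exact: tauC_cvg.
by apply: cvgN; apply: cvgM; [exact: tauC_cvg|exact: sin_cvg].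
Qed.

Lemma Re_shift (s : C) (n : nat) (b : bool) :
  complex.Re (s + (-1) ^+ b * n%:R) = complex.Re s + (-1) ^+ b * n%:R.
Proof.
rewrite raddfD /= -(rmorph_nat (real_complex R)) -(rmorph_sign (real_complex R)).
by rewrite -rmorphM.
Qed.

Lemma Re_shift_ge (s : C) (n : nat) (b : bool) : `|complex.Re s| < 1 / 2 -> (0 < n)%N ->
  n%:R / 2 <= `|complex.Re (s + (-1) ^+ b * n%:R)|.
Proof.
move=> hs n0; rewrite Re_shift.
have nR : 1 <= n%:R :> R by rewrite ler1n.
move: hs; rewrite ltr_norml => /andP[h1 h2].
case: b; rewrite ?expr1 ?expr0 ?mulN1r ?mul1r.
  by rewrite ler0_norm; lra.
by rewrite ger0_norm; lra.
Qed.

Lemma shift_norm_ge (s : C) (n : nat) (b : bool) : `|complex.Re s| < 1 / 2 -> (0 < n)%N ->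
  n%:R / 2 <= cnorm (s + (-1) ^+ b * n%:R).
Proof. by move=> hs n0; apply: le_trans (cnorm_Re _); exact: Re_shift_ge. Qed.

Lemma Re_scale (r : R) (w : C) : complex.Re (r%:C * w) = r * complex.Re w.
Proof. by case: w => a b /=; rewrite mul0r subr0. Qed.

Lemma sinC_pi_neq0 (s : C) : `|complex.Re s| < 1 / 2 -> s != 0 -> sinC (Pi * s) != 0.
Proof.
move=> hs s0; have p0 := pi_gt0 R.
have [r0|r0] := eqVneq (complex.Re s) 0; last first.
  rewrite -cnorm_gt0; apply: lt_le_trans (sinC_ge _); rewrite Re_scale.
  apply: lt_le_trans (sin_ge_half _); rewrite normrM (ger0_norm (ltW p0)).
    by rewrite divr_gt0 // mulr_gt0 // normr_gt0.
  by rewrite ler_wpM2l ?ltW // -div1r.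
case: s hs s0 r0 => a b _ s0 /= a0; subst a.
have b0 : b != 0 by apply: contraNneq s0 => ->.
have -> : Pi * (0 +i* b) = 0 +i* (pi * b) :> C.
  by apply/eqP; rewrite eq_complex /= !mul0r mulr0 subr0 addr0 !eqxx.
rewrite sinC_xy sin0 cos0 mulr0 mulr1 eq_complex /= eqxx /= /shR.
rewrite mulf_neq0 ?invr_neq0 ?pnatr_eq0 // subr_eq0 (inj_eq (@expR_inj R)).
apply: contraNneq b0 => h; apply/eqP.
have : pi * b = 0 by lra.
by move/eqP; rewrite mulf_eq0 gt_eqF //= => /eqP.
Qed.

Lemma sinC_le (u : C) : cnorm u <= 4^-1 -> cnorm (sinC u) <= 3 * cnorm u.
Proof.
move=> u4; have := sinC_sub_le u4; rewrite expr2 => h.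
have -> : sinC u = (sinC u - u) + u by rewrite subrK.
apply: (le_trans (cnormD _ _)); have := cnorm_ge0 u; nra.
Qed.

(** The absolute value of the real part of the argument lies between
    [tau n * k / 2] and [pi / 2], where [sin_ge_half] applies. *)
Let sin_shift_ge n k (s : C) (b : bool) : `|complex.Re s| < 1 / 2 ->
  (1 <= k < 2 ^ n)%N ->
  tau n * k%:R / 4 <= cnorm (sinC ((tau n)%:C * (s + (-1) ^+ b * k%:R))).
Proof.
move=> hs /andP[k1 kn]; have t0 := tau_gt0 n; have p0 := pi_gt0 R.
have kR : 1 <= k%:R :> R by rewrite ler1n.
have knR : k%:R + 1 <= (2 ^ n)%:R :> R by rewrite natr1 ler_nat.
apply: le_trans (sinC_ge _); rewrite Re_scale.
have lo := Re_shift_ge b hs k1; rewrite Re_shift in lo *.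
set x := complex.Re s in hs lo *.
have hi : `|x + (-1) ^+ b * k%:R| <= k%:R + 1 / 2.
  apply: (le_trans (ler_normD _ _)); rewrite normrM normr_sign mul1r.
  by rewrite (ger0_norm (ler0n _ k)); move: (ltW hs); lra.
have te : tau n * (2 ^ n)%:R = pi / 2.
  rewrite tauE expnS natrM; field.
  by rewrite pnatr_eq0 expn_eq0.
apply: le_trans (sin_ge_half _); rewrite normrM (ger0_norm (ltW t0)).
  have := ler_wpM2l (ltW t0) lo; lra.
rewrite -te ler_wpM2l ?(ltW t0) //; lra.
Qed.

Let cot_sum_ratio (u v : C) : sinC u != 0 -> sinC v != 0 ->
  cotC u + cotC v = sinC (u + v) / (sinC u * sinC v).
Proof. by move=> u0 v0; rewrite /cotC sinCD; field; rewrite u0 v0. Qed.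

(** The numerator of [cot_sum_ratio] is the sine of [2 * s * tau n], hence of
    the order of [tau n] independently of [k]. The constant is [3 * 2 * 4 * 4]:
    two for the doubled argument, three for the sine, four for each of the
    sines in the denominator. *)
Let pair_le n k (s : C) (B : R) : `|complex.Re s| < 1 / 2 -> cnorm s <= B ->
  tau n * (2 * B) <= 4^-1 -> (1 <= k < 2 ^ n)%N ->
  cnorm ((tau n)%:C * (cotC ((tau n)%:C * (s + k%:R)) + cotC ((tau n)%:C * (s - k%:R))))
    <= 96 * B * (k%:R ^+ 2)^-1.
Proof.
move=> hs sB tB kn; have t0 := tau_gt0 n.
have kR : 1 <= k%:R :> R by case/andP: kn => k1 _; rewrite ler1n.
have h1 := @sin_shift_ge n k s false hs kn; rewrite expr0 mul1r in h1.
have h2 := @sin_shift_ge n k s true hs kn; rewrite expr1 mulN1r in h2.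
have d0 : 0 < tau n * k%:R / 4.
  by rewrite divr_gt0 // mulr_gt0 // (lt_le_trans ltr01).
rewrite cot_sum_ratio -?cnorm_gt0 ?(lt_le_trans d0) //.
have -> : (tau n)%:C * (s + k%:R) + (tau n)%:C * (s - k%:R) = (tau n)%:C * (2 * s).
  by rewrite -mulrDr; congr (_ * _); ring.
have gen (x y v : C) : cnorm ((tau n)%:C * (x / (y * v))) = tau n * (cnorm x / (cnorm y * cnorm v)).
  by rewrite cnorm_tau cnormM cnormV cnormM.
rewrite gen.
have s2 : cnorm (2 * s) <= 2 * B by rewrite cnormM cnorm_nat ler_wpM2l.
have h3 : cnorm (sinC ((tau n)%:C * (2 * s))) <= 3 * (tau n * (2 * B)).
  apply: le_trans (sinC_le _) _; rewrite cnorm_tau.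
    by apply: le_trans tB; rewrite ler_wpM2l // ltW.
  by rewrite ler_wpM2l // ler_wpM2l // ltW.
have B0 : 0 <= B by rewrite (le_trans (cnorm_ge0 s)).
set a := cnorm _ in h1 *; set b := cnorm _ in h2 *; set c := cnorm _ in h3 *.
have a0 : 0 < a by exact: lt_le_trans h1.
have b0 : 0 < b by exact: lt_le_trans h2.
have hab : (tau n * k%:R / 4) * (tau n * k%:R / 4) <= a * b.
  by rewrite ler_pM // ltW.
rewrite mulrA ler_pdivrMr ?mulr_gt0 //.
apply: (@le_trans _ _ (tau n * (3 * (tau n * (2 * B))))).
  by rewrite ler_wpM2l // ltW.
apply: (@le_trans _ _ (96 * B * (k%:R ^+ 2)^-1 * ((tau n * k%:R / 4) * (tau n * k%:R / 4)))).
  have -> : 96 * B * (k%:R ^+ 2)^-1 * (tau n * k%:R / 4 * (tau n * k%:R / 4))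
     = tau n * (3 * (tau n * (2 * B))).
    by move: (tau n) => t; field; rewrite gt_eqF // (lt_le_trans ltr01).
  exact: lexx.
by rewrite ler_wpM2l // mulr_ge0 ?mulr_ge0 ?invr_ge0 ?exprn_ge0.
Qed.

Let inv_sqr_le (x : R) : 1 <= x -> (x ^+ 2)^-1 <= 2 / (x * (x + 1)).
Proof.
move=> x1; have xx : x <= x * x by rewrite ler_peMr // (le_trans ler01 x1).
have p : 0 < x * x by lra.
have p' : 0 < x * (x + 1) by lra.
by rewrite expr2 -[leLHS]mul1r ler_pdivrMr // mulrAC ler_pdivlMr //; lra.
Qed.

Lemma sum_inv_sqr (M N : nat) : (0 < M)%N ->
  \sum_(M <= k < N) (k%:R ^+ 2)^-1 <= 2 / M%:R :> R.
Proof.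
move=> M0; have [NM|MN] := leqP N M; first by rewrite big_geq // divr_ge0.
suff : \sum_(M <= k < N) (k%:R ^+ 2)^-1 <= 2 * (M%:R^-1 - N%:R^-1) :> R.
  by move=> h; apply: (le_trans h); rewrite ler_wpM2l // gerBl invr_ge0.
rewrite -(subnKC (ltnW MN)); elim: (N - M)%N => [|d IH].
  by rewrite addn0 big_geq // subrr mulr0.
rewrite addnS big_nat_recr ?leq_addr //=.
have Md0 : (0 < M + d)%N by rewrite addn_gt0 M0.
set q := (M + d)%N in Md0 IH *.
have qR : 1 <= q%:R :> R by rewrite ler1n.
have : (q%:R ^+ 2)^-1 <= 2 * (q%:R^-1 - q.+1%:R^-1) :> R.
  rewrite -[q.+1%:R]natr1.
  have -> : 2 * (q%:R^-1 - (q%:R + 1)^-1) = 2 / (q%:R * (q%:R + 1)) :> R.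
    by field; rewrite !gt_eqF //; lra.
  exact: inv_sqr_le.
by move=> h; apply: (le_trans (lerD IH h)); rewrite -mulrDr addrA subrK.
Qed.

(** As the level tends to infinity in the pairing formula, the first [M] pairs
    tend to those of the statement, and the later ones are bounded by
    [pair_le] uniformly in the level. *)
Theorem cot_expansion (B : R) : exists K : R, 0 <= K /\
  forall s : C, `|complex.Re s| < 1 / 2 -> s != 0 -> cnorm s <= B ->
  forall M, (0 < M)%N ->
  cnorm (Pi * cotC (Pi * s) - (s^-1 + \sum_(1 <= k < M) ((s + k%:R)^-1 + (s - k%:R)^-1)))
    <= K / M%:R.
Proof.
exists (192 * Num.max B 0); split; first by rewrite mulr_ge0 // le_max lexx orbT.
move=> s hs s0 sB M M0; set X := Pi * cotC (Pi * s).
have sB' : cnorm s <= Num.max B 0 by rewrite (le_trans sB) // le_max lexx.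
have B0 : 0 <= Num.max B 0 by rewrite le_max lexx orbT.
set B' := Num.max B 0 in sB' B0 *.
have snz k (b : bool) : (0 < k)%N -> s + (-1) ^+ b * k%:R != 0.
  move=> k0; rewrite -cnorm_gt0; apply: lt_le_trans (shift_norm_ge b hs k0).
  by rewrite divr_gt0 ?ltr0n.
pose p n k := (tau n)%:C * (cotC ((tau n)%:C * (s + k%:R)) + cotC ((tau n)%:C * (s - k%:R))).
pose u n := (tau n)%:C * cotC ((tau n)%:C * s)
  + (tau n)%:C * cotC ((tau n)%:C * s + (pi / 2 : R)%:C) + \sum_(1 <= k < M) p n k.
have ucvg : (fun n => X - u n : C^o) @ \oo -->
   (X - (s^-1 + 0 + \sum_(1 <= k < M) ((s + k%:R)^-1 + (s - k%:R)^-1)) : C^o).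
  apply: cvgB; first exact: cvg_cst.
  apply: cvgD; first by apply: cvgD; [exact: cot_cvg|exact: tan_cvg].
  have sum_cvg (r : seq nat) : all (leq 1) r ->
      (fun n => \sum_(k <- r) p n k : C^o) @ \oo -->
      (\sum_(k <- r) ((s + k%:R)^-1 + (s - k%:R)^-1) : C^o).
    elim: r => [_|k r IHr /= /andP[k1 /IHr hr]].
      by rewrite big_nil; under eq_fun do rewrite big_nil; exact: cvg_cst.
    rewrite big_cons; under eq_fun do rewrite big_cons.
    apply: cvgD hr; under eq_fun do rewrite /p mulrDr.
    apply: cvgD; apply: cot_cvg.
      by have := snz k false k1; rewrite expr0 mul1r.
    by have := snz k true k1; rewrite expr1 mulN1r.
  by apply: sum_cvg; apply/allP => k; rewrite mem_index_iota => /andP[].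
rewrite addr0 in ucvg; apply: (cnorm_lim_le ucvg).
near=> n.
have Mn : (M <= 2 ^ n)%N.
  apply: (@leq_trans n); last exact/ltnW/ltn_expl.
  by near: n; exact: nbhs_infty_ge.
have -> : X - u n = \sum_(M <= k < 2 ^ n) p n k.
  apply/eqP; rewrite subr_eq addrC /u -addrA -big_cat_nat //=.
  rewrite /X (cotC_pairing n (sinC_pi_neq0 hs s0)).
  have N0 : (2 ^ n.+1)%:R != 0 :> C by rewrite pnatr_eq0 expn_eq0.
  have tE : (tau n)%:C = Pi / (2 ^ n.+1)%:R by rewrite tauE rmorphM fmorphV rmorph_nat.
  rewrite [Pi * (_ * _)]mulrA -tE !mulrDr.
  have -> : Pi * s / (2 ^ n.+1)%:R = (tau n)%:C * s by rewrite tE mulrAC.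
  apply/eqP; congr (_ + _); rewrite mulr_sumr; apply: eq_bigr => k _.
  rewrite /p tE; congr (_ * (cotC _ + cotC _)); by field.
apply: (le_trans (cnorm_sum _ _ _)).
apply: (@le_trans _ _ (\sum_(M <= k < 2 ^ n) 96 * B' * (k%:R ^+ 2)^-1)).
  rewrite big_nat [leRHS]big_nat; apply: ler_sum => k /andP[Mk kn].
  apply: pair_le => //; last by rewrite kn (leq_trans M0 Mk).
  by near: n; exact: near_small.
rewrite -mulr_sumr; have := sum_inv_sqr (2 ^ n) M0 => h.
apply: (le_trans (ler_wpM2l (mulr_ge0 (ler0n R 96) B0) h)).
by rewrite le_eqVlt; apply/orP; left; apply/eqP; ring.
Unshelve. all: by end_near.
Qed.

End CotSeries.

(** * Bilateral sums and compact sets *)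

Section Bilateral.
Variable R : realType.
Notation C := R[i].

Lemma shift_inv_le (s : C) (n e : nat) (b : bool) : `|complex.Re s| < 1 / 2 ->
  (0 < n)%N -> cnorm ((s + (-1) ^+ b * n%:R) ^- e) <= 2 ^+ e / n%:R ^+ e.
Proof.
move=> hs n0; have h := shift_norm_ge b hs n0.
have nR : 0 < n%:R :> R by rewrite ltr0n.
have -> : 2 ^+ e / n%:R ^+ e = ((n%:R / 2) ^+ e)^-1 :> R.
  by rewrite -expr_div_n -[2 / _]invf_div exprVn.
rewrite cnormV cnormX lef_pV2 ?posrE ?exprn_gt0 ?(lt_le_trans _ h) ?divr_gt0 //.
by rewrite lerXn2r // nnegrE ?cnorm_ge0 // divr_ge0.
Qed.

Lemma shift_inv_sqr_le (s : C) (n e : nat) (b : bool) : `|complex.Re s| < 1 / 2 ->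
  (1 < e)%N -> (0 < n)%N ->
  cnorm ((s + (-1) ^+ b * n%:R) ^- e) <= 2 ^+ e * (n%:R ^+ 2)^-1.
Proof.
move=> hs e1 n0; apply: (le_trans (shift_inv_le e b hs n0)).
rewrite ler_wpM2l ?exprn_ge0 // lef_pV2 ?posrE ?exprn_gt0 ?ltr0n //.
by apply: ler_weXn2l; rewrite ?ler1n.
Qed.

Lemma real_series_cvg (v : nat -> R) (A : R) :
  (forall n, (0 < n)%N -> `|v n| <= A * (n%:R ^+ 2)^-1) -> cvgn (series v).
Proof.
move=> vA; apply: normed_cvg; apply: nondecreasing_is_cvgn.
  by apply: nondecreasing_series => n _ _; exact: normr_ge0.
exists (`|v 0%N| + A * 2) => _ [n _ <-].
rewrite -[leLHS]/(\sum_(0 <= i < n) `|v i|).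
have A0 : 0 <= A by have := vA 1%N isT; rewrite expr1n invr1 mulr1; exact/le_trans.
case: n => [|n]; first by rewrite big_geq // addr_ge0 ?mulr_ge0.
rewrite big_ltn // lerD2l.
apply: (@le_trans _ _ (\sum_(1 <= k < n.+1) A * (k%:R ^+ 2)^-1)).
  by rewrite big_nat [leRHS]big_nat; apply: ler_sum => k /andP[k1 _]; exact: vA.
rewrite -mulr_sumr ler_wpM2l //.
by have := sum_inv_sqr R n.+1 (ltn0Sn 0); rewrite divr1.
Qed.

Lemma complex_series_tail (v : nat -> C) (A : R) :
  (forall n, (0 < n)%N -> cnorm (v n) <= A * (n%:R ^+ 2)^-1) ->
  forall M, (0 < M)%N ->
  cnorm (limn (series (fun n => v n : C^o)) - \sum_(0 <= k < M) v k) <= A * 2 / M%:R.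
Proof.
move=> vA M M0.
have A0 : 0 <= A by have := vA 1%N isT; rewrite expr1n invr1 mulr1; exact/le_trans/cnorm_ge0.
have cR : cvgn (series (fun n => complex.Re (v n))).
  by apply: (@real_series_cvg _ A) => n n0; apply: (le_trans (cnorm_Re _)); exact: vA.
have cI : cvgn (series (fun n => complex.Im (v n))).
  apply: (@real_series_cvg _ A) => n n0; apply: le_trans (vA n n0).
  by case: (v n) => a b /=; rewrite /cnorm /= -[leLHS]sqrtr_sqr ler_wsqrtr // lerDr sqr_ge0.
set a := limn (series (fun n => complex.Re (v n))).
set b := limn (series (fun n => complex.Im (v n))).
have SE n : series (fun n => v n : C^o) n =
    (series (fun n => complex.Re (v n)) n) +i* (series (fun n => complex.Im (v n)) n).
  rewrite /series /=; elim: n => [|n IH]; first by rewrite !big_geq.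
  by rewrite !big_nat_recr //= IH; case: (v n).
have Scvg : series (fun n => v n : C^o) @ \oo --> (a +i* b : C^o).
  have d0 : (fun n => `|series (fun n => complex.Re (v n)) n - a|
      + `|series (fun n => complex.Im (v n)) n - b|) @ \oo --> (0 : R).
    rewrite -[X in _ --> X](addr0 0); apply: cvgD.
      by apply/norm_cvg0P/subr_cvg0.
    by apply/norm_cvg0P/subr_cvg0.
  apply: (cvg_cnorm (K := 1) d0); apply: nearW => n.
  by rewrite mul1r SE; exact: (cnorm_le_sum (_ - a) (_ - b)).
have Sd : (fun n => series (fun n => v n : C^o) n - \sum_(0 <= k < M) v k : C^o) @ \oo -->
    ((a +i* b) - \sum_(0 <= k < M) v k : C^o).
  by apply: cvgB => //; exact: cvg_cst.
rewrite (cvg_lim _ Scvg) //.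
apply: (cnorm_lim_le Sd); near=> n.
have Mn : (M <= n)%N by near: n; exact: nbhs_infty_ge.
rewrite /series /= (@big_cat_nat _ _ _ M 0 n) //= addrAC subrr add0r.
apply: (le_trans (cnorm_sum _ _ _)).
apply: (@le_trans _ _ (\sum_(M <= k < n) A * (k%:R ^+ 2)^-1)).
  rewrite big_nat [leRHS]big_nat; apply: ler_sum => k /andP[Mk _].
  by apply: vA; exact: leq_trans Mk.
by rewrite -mulr_sumr -mulrA ler_wpM2l // sum_inv_sqr.
Unshelve. all: by end_near.
Qed.

(** Around each point the bounds hold with a locally constant integer; finitely
    many of these neighbourhoods suffice. *)
Lemma compact_bounds (K : set C^o) : compact K -> (forall s : C, K s -> s != 0) ->
  exists B : R, 0 < B /\ forall s : C, K s -> cnorm s <= B /\ B^-1 <= cnorm s.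
Proof.
move=> cK K0.
have /compact_near_coveringP/(_ nat \oo
   (fun n y => cnorm y <= n%:R /\ 1 <= n%:R * cnorm y)) := cK.
case=> [x Kx|N _ HN]; last first.
  exists N.+1%:R; split=> [|s Ks]; first by rewrite ltr0n.
  have [h1 h2] := HN N.+1 (leqnSn N) s Ks; split=> //.
  by rewrite -div1r ler_pdivrMr ?ltr0n // mulrC.
have x0 : 0 < cnorm x by rewrite cnorm_gt0 K0.
have m0 : 0 < (Num.min 1 (cnorm x / 2))%:C :> C by rewrite ltcR lt_min ltr01 divr_gt0.
near=> y n => /=.
have d : cnorm (x - y) < Num.min 1 (cnorm x / 2).
  rewrite -ltcR -normrC; near: y.
  by have := @nbhsx_ballx _ C^o x _ m0; rewrite -ball_normE.
have n1 : cnorm x + 1 <= n%:R by near: n; exact: nbhs_infty_ger.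
have n2 : 2 / cnorm x <= n%:R by near: n; exact: nbhs_infty_ger.
move: d; rewrite lt_min => /andP[d1 d2].
have e1 : cnorm y <= cnorm x + cnorm (x - y).
  by rewrite -[y in leLHS](subKr x) cnormB.
have e2 : cnorm x <= cnorm y + cnorm (x - y).
  by rewrite -[x in leLHS](subrK y) addrC cnormD.
split; first by lra.
have h : cnorm x / 2 <= cnorm y by lra.
apply: (@le_trans _ _ (2 / cnorm x * (cnorm x / 2))).
  by rewrite mulrA divfK ?gt_eqF // divff // pnatr_eq0.
by rewrite ler_pM // ltW ?divr_gt0.
Unshelve. all: by end_near.
Qed.

End Bilateral.

(** * Summation of the partial fractions *)

Section Assembly.
Variable R : realType.
Notation C := R[i].
Local Notation H := (harmonicT R).

Lemma monotangent_tail (e : nat) (s : C) (N : nat) : (1 < e)%N ->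
  `|complex.Re s| < 1 / 2 -> (0 < N)%N ->
  cnorm (monotangent e s
    - (s ^- e + \sum_(1 <= n < N) ((s + n%:R) ^- e + (s - n%:R) ^- e)))
  <= 2 ^+ e * 5 / N%:R.
Proof.
move=> e1 hs N0; rewrite /monotangent gtn_eqF // /bilateral_sum.
pose v (n : nat) : C := (n%:~R + s) ^- e.
pose u (n : nat) : C := ((- n.+1%:Z)%:~R + s) ^- e.
have uE n : u n = (s - n.+1%:R) ^- e by rewrite /u mulrNz addrC.
have vE n : v n = (s + n%:R) ^- e by rewrite /v addrC.
have vA n : (0 < n)%N -> cnorm (v n) <= 2 ^+ e * (n%:R ^+ 2)^-1.
  by move=> n0; have := shift_inv_sqr_le false hs e1 n0; rewrite expr0 mul1r vE.
have uA' n : cnorm (u n) <= 2 ^+ e * (n.+1%:R ^+ 2)^-1.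
  have := shift_inv_sqr_le true hs e1 (ltn0Sn n).
  by rewrite expr1 mulN1r uE.
have uA n : (0 < n)%N -> cnorm (u n) <= 2 ^+ e * (n%:R ^+ 2)^-1.
  move=> n0; apply: (le_trans (uA' n)).
  rewrite ler_wpM2l ?exprn_ge0 // lef_pV2 ?posrE ?exprn_gt0 ?ltr0n //.
  by rewrite lerXn2r ?nnegrE // ler_nat.
have := complex_series_tail vA N0; have := complex_series_tail uA N0.
rewrite -[limn (series (fun n => u n : C^o))]/(limn (series (fun n : nat => ((- n.+1%:Z)%:~R + s) ^- e : C^o))).
rewrite -[limn (series (fun n => v n : C^o))]/(limn (series (fun n : nat => (n%:~R + s) ^- e : C^o))).
set b := limn _; set a := limn _ => hu hv.
have -> : a + b - (s ^- e + \sum_(1 <= n < N) ((s + n%:R) ^- e + (s - n%:R) ^- e))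
   = (a - \sum_(0 <= k < N) v k) + (b - \sum_(0 <= k < N) u k) + u N.-1.
  rewrite big_split /= [\sum_(0 <= k < N) v k]big_ltn //.
  have -> : \sum_(0 <= k < N) u k = \sum_(1 <= n < N) (s - n%:R) ^- e + u N.-1.
    case: N N0 {hu hv} => // N _; rewrite big_nat_recr //= big_add1 /=; congr (_ + _).
    by apply: eq_bigr => n _; rewrite uE.
  have -> : \sum_(1 <= k < N) v k = \sum_(1 <= n < N) (s + n%:R) ^- e.
    by apply: eq_bigr => n _; rewrite vE.
  by rewrite vE addr0; ring.
apply: (le_trans (cnormD _ _)); apply: (le_trans (lerD (cnormD _ _) (lexx _))).
have hl : cnorm (u N.-1) <= 2 ^+ e / N%:R.
  apply: (le_trans (uA' _)); rewrite prednK // ler_wpM2l ?exprn_ge0 //.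
  by rewrite lef_pV2 ?posrE ?exprn_gt0 ?ltr0n // expr2 ler_peMl // ler1n.
move: hu hv hl; have : 0 < N%:R^-1 :> R by rewrite invr_gt0 ltr0n.
by move: (2 ^+ e) (N%:R^-1) => x y ? ? ? ?; lra.
Qed.

Lemma big_center (t : nat -> C) d :
  \sum_(n < d.*2.+1) t n = t d + \sum_(1 <= n < d.+1) (t (d + n)%N + t (d - n)%N).
Proof.
rewrite -(big_mkord xpredT) (@big_cat_nat _ _ _ d.+1) //=; last by rewrite -addnn; lia.
rewrite big_nat_recr // big_split /=.
rewrite -addrA addrCA; congr (_ + _); rewrite addrC; congr (_ + _); last first.
  by rewrite big_nat_rev [RHS]big_add1 /=; apply: eq_big_nat => n nd; congr t; lia.
rewrite -{1}(add0n d.+1) big_addn big_add1 /=.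
have -> : (d.*2.+1 - d.+1 = d)%N by rewrite -addnn; lia.
by apply: eq_bigr => n _; congr t; lia.
Qed.

(** Opposite poles are kept together since only their joint contribution is
    summable for simple poles. *)
Lemma trunc_multitangent_paired N k s : is_index k -> (0 < size k)%N ->
  (0 < N)%N -> (forall n, (n < (2 * N).-1)%N -> (shift_int N n)%:~R + s != 0) ->
  let c (j m : nat) (b : bool) n := (Ctrunc R k j m (side b (N, n)) (side (~~ b) (N, n)))%:C in
  trunc_multitangent N k s = \sum_(j < size k) \sum_(m < nth 0%N k j)
    (c j m true 0%N * s ^- (nth 0%N k j - m)
     + \sum_(1 <= n < N) (c j m true n * (s + n%:R) ^- (nth 0%N k j - m)
                          + c j m false n * (s - n%:R) ^- (nth 0%N k j - m))).
Proof.
move=> ik k0 N0 hs c; rewrite trunc_multitangent_expansion //.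
apply: eq_bigr => j _; apply: eq_bigr => m _.
case: N N0 hs @c => // d _ _ c; set e := (_ - m)%N.
have eN : (2 * d.+1).-1 = d.*2.+1 by rewrite -addnn; lia.
rewrite eN (big_center (fun n => (Ctrunc R k j m n.+1 (d.*2.+1 - n))%:C
  * ((shift_int d.+1 n)%:~R + s) ^- e)); congr (_ + _).
  rewrite /c /shift_int /side /= addn0 subn0; congr ((Ctrunc _ _ _ _ _ _)%:C * _).
    by rewrite -addnn; lia.
  by rewrite subrr add0r.
apply: eq_big_nat => n /andP[n1 nd]; rewrite ltnS in nd; congr (_ + _).
  rewrite /c /shift_int /side /=; congr ((Ctrunc _ _ _ _ _ _)%:C * _ ^- _).
    by rewrite -addnn; lia.
  rewrite addrC; congr (_ + _); rewrite -addSn PoszD addrAC subrr add0r.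
  by [].
rewrite /c /shift_int /side /=; congr ((Ctrunc _ _ _ _ _ _)%:C * _ ^- _).
- by rewrite subSn.
- by rewrite -addnn; lia.
rewrite addrC; congr (_ + _); rewrite -subSn // -subzn; last exact: leqW.
by rewrite addrAC subrr add0r mulrNz.
Qed.

End Assembly.

(** * Uniform asymptotics *)

Section Asymptotics.
Variables (R : realType) (B : R).
Hypothesis B_gt0 : 0 < B.
Notation C := R[i].
Local Notation H := (harmonicT R).
Local Notation sqrtw := (@sqrtw R).
Local Notation ev := (fun N => (0 < N)%N).
Local Notation L2 := (fun N => lscale R (2 * N)).

(** Every compact subset of the strip without the origin lies in such a set, for
    some [B]. *)
Definition punctured_strip (s : C) :=
  [/\ `|complex.Re s| < 1 / 2, s != 0, cnorm s <= B & B^-1 <= cnorm s].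

Let dom (p : nat * C) := (0 < p.1)%N /\ punctured_strip p.2.

Let L2_ge1 N : 1 <= L2 N. Proof. exact: lscale_ge1. Qed.

(** Uniformly on the punctured strip; [negligible_lt] says why such errors tend
    to [0]. *)
Definition negligible (F : nat -> C -> C) :=
  plog dom (fun p => L2 p.1) (fun p => sqrtw p.1) (fun p => cnorm (F p.1 p.2)).

Let w_ge0 p : dom p -> 0 <= sqrtw p.1.
Proof. by case=> N0 _; exact: sqrtw_ge0. Qed.

Lemma eq_negligible F G : (forall N s, (0 < N)%N -> punctured_strip s -> F N s = G N s) ->
  negligible F -> negligible G.
Proof. by move=> FG; apply: eq_plog => -[N s] [N0 Ks] /=; rewrite FG. Qed.

Lemma negligibleD F G : negligible F -> negligible G ->
  negligible (fun N s => F N s + G N s).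
Proof.
move=> hF hG; have := plogD (fun p _ => L2_ge1 p.1) w_ge0 hF hG.
by apply: plog_le => p _; rewrite !ger0_norm ?addr_ge0 ?cnorm_ge0 ?cnormD.
Qed.

Lemma negligible_sum n (F : 'I_n -> nat -> C -> C) :
  (forall j, negligible (F j)) -> negligible (fun N s => \sum_(j < n) F j N s).
Proof.
move=> hF; have := plog_sum (fun p _ => L2_ge1 p.1) (index_enum 'I_n) (P := xpredT)
  w_ge0 (fun j _ => hF j).
apply: plog_le => p _; rewrite !ger0_norm ?cnorm_ge0 ?sumr_ge0 ?cnorm_sum //.
by move=> j _; exact: cnorm_ge0.
Qed.

Lemma negligible_dominated (F : nat -> C -> C) (G : nat -> R) (A : R) :
  plog ev L2 sqrtw G ->
  (forall N s, (0 < N)%N -> punctured_strip s -> cnorm (F N s) <= A * `|G N|) ->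
  negligible F.
Proof.
move=> [c hG] FG; apply: (@plogP _ _ dom _ (fun p _ => L2_ge1 p.1) _ _
  (`|A| * c%:R) c w_ge0) => -[N s] [N0 Ks] /=.
rewrite ger0_norm ?cnorm_ge0 // (le_trans (FG N s N0 Ks)) //.
rewrite (le_trans (ler_wpM2r (normr_ge0 _) (ler_norm A))) //.
by rewrite -!mulrA ler_wpM2l // !mulrA hG.
Qed.

Lemma negligible_real (G : nat -> R) : plog ev L2 sqrtw G ->
  negligible (fun N _ => (G N)%:C).
Proof.
by move=> hG; apply: (negligible_dominated (A := 1) hG) => N s _ _; rewrite cnorm_real mul1r.
Qed.

(** A power of the logarithm with one logarithm more is still absorbed by the
    square root; the additional logarithm gives the limit [0]. *)
Lemma negligible_lt F (e : R) : negligible F -> 0 < e ->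
  \forall N \near \oo, forall s, punctured_strip s -> cnorm (F N s) < e.
Proof.
move=> [c hF] e0; have [A [A0 hA]] := lscale_exp_le_sqrt R c.+1.
pose D := c%:R * (A * Num.sqrt 2).
have D0 : 0 <= D by rewrite !mulr_ge0 ?sqrtr_ge0.
near=> N => s Ks.
have N0 : (0 < N)%N by near: N; exact: nbhs_infty_gt.
have := hF (N, s) (conj N0 Ks); rewrite /= ger0_norm ?cnorm_ge0 // => /le_lt_trans; apply.
have NN : (0 < 2 * N)%N by rewrite muln_gt0.
have L0 : 0 < L2 N by rewrite (lt_le_trans ltr01).
have sN := sqrtn_gt0 R N0.
(* The scale is unbounded, being at least [ln N]. *)
have hL : D / e < L2 N.
  apply: (@lt_le_trans _ _ (1 + ln (2 * N)%:R)); last by rewrite lerD2l harmonic_ge_ln.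
  apply: (@le_lt_trans _ _ (ln (2 * N)%:R)); last by rewrite ltrDr.
  rewrite -[leLHS]expRK ler_ln ?posrE ?expR_gt0 ?ltr0n //.
  apply: (@le_trans _ _ N%:R); last by rewrite ler_nat leq_pmull.
  by near: N; exact: nbhs_infty_ger.
have h : L2 N ^+ c * sqrtw N * L2 N <= A * Num.sqrt 2.
  rewrite mulrAC -exprSr ler_pdivrMr // -mulrA -sqrtrM //.
  by have := hA _ NN; rewrite natrM.
rewrite ltr_pdivrMr // in hL.
rewrite -(ltr_pM2r L0).
have -> : c%:R * L2 N ^+ c * sqrtw N * L2 N = c%:R * (L2 N ^+ c * sqrtw N * L2 N) by ring.
apply: (@le_lt_trans _ _ D); last by rewrite mulrC.
by rewrite ler_wpM2l.
Unshelve. all: by end_near.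
Qed.

(** The quadratic decay of the kernels compensates the growth of the weight of
    [Ctrunc_approx_center]. *)
Let plog_sum_center (F : nat * nat -> R) : plog dom2 (@lscale2 R) (@w1 R) F ->
  plog ev L2 sqrtw (fun N => `|F (N, 0%N)| + \sum_(1 <= n < N) (n%:R ^+ 2)^-1 * `|F (N, n)|).
Proof.
move=> [c hF]; apply: (@plogP _ _ _ _ (fun N _ => L2_ge1 N) _ _ (c%:R * 5) c.+1).
  exact: sqrtw_ge0.
move=> N N0; have p0 (n : nat) : 0 <= (n%:R ^+ 2)^-1 :> R by rewrite invr_ge0 exprn_ge0.
rewrite ger0_norm; last by rewrite addr_ge0 ?sumr_ge0 // => n _; rewrite mulr_ge0.
apply: (@le_trans _ _ (c%:R * L2 N ^+ c
   * (w1 R (N, 0%N) + \sum_(1 <= n < N) (n%:R ^+ 2)^-1 * w1 R (N, n)))).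
  rewrite mulrDr lerD ?hF // mulr_sumr big_nat [leRHS]big_nat.
  apply: ler_sum => n /andP[_ nN]; rewrite [leRHS]mulrCA ler_wpM2l //.
  exact: (hF (N, n)).
apply: (le_trans (ler_wpM2l _ (sum_w1 R N0))).
  by rewrite mulr_ge0 // exprn_ge0 // lscale_ge0.
by rewrite exprSr le_eqVlt; apply/orP; left; apply/eqP; ring.
Qed.

(** For the weight of [Ctrunc_approx_boundary] the decay [1 / n] is enough. *)
Let plog_sum_boundary (F : nat * nat -> R) : plog dom2 (@lscale2 R) (@w0 R) F ->
  plog ev L2 sqrtw (fun N => \sum_(1 <= n < N) F (N, n) / n%:R).
Proof.
move=> [c hF]; apply: (@plogP _ _ _ _ (fun N _ => L2_ge1 N) _ _ (c%:R * 2) c.+1).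
  exact: sqrtw_ge0.
move=> N N0; apply: (le_trans (ler_norm_sum _ _ _)).
apply: (@le_trans _ _ (c%:R * L2 N ^+ c * \sum_(1 <= n < N) n%:R^-1 * w0 R (N, n))).
  rewrite mulr_sumr big_nat [leRHS]big_nat; apply: ler_sum => n /andP[_ nN].
  rewrite normrM normfV normr_nat mulrC mulrCA ler_wpM2l ?invr_ge0 //.
  exact: (hF (N, n)).
have -> : c%:R * 2 * L2 N ^+ c.+1 * sqrtw N = c%:R * L2 N ^+ c * (2 * L2 N * sqrtw N).
  by rewrite exprSr; ring.
rewrite sum_w0 // ler_wpM2l ?mulr_ge0 ?exprn_ge0 ?lscale_ge0 //.
rewrite ler_wpM2r ?sqrtw_ge0 // ler_wpM2l //.
apply: (@le_trans _ _ (H (2 * N))); first by rewrite harmonic_le // leq_pmull.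
by rewrite /lscale lerDr.
Qed.

(** The coefficients at the poles close to the origin dominate when the kernels
    decay quadratically, and these are all close to [X]. *)
Let center_sum (c : bool -> nat * nat -> R) (X : nat -> R) (v0 : C -> C)
    (v : bool -> nat -> C -> C) (A : R) : 0 <= A ->
  (forall b, plog dom2 (@lscale2 R) (@w1 R) (fun p => c b p - X p.1)) ->
  (forall s, punctured_strip s -> cnorm (v0 s) <= A) ->
  (forall b n s, punctured_strip s -> (0 < n)%N -> cnorm (v b n s) <= A * (n%:R ^+ 2)^-1) ->
  negligible (fun N s => (c true (N, 0%N))%:C * v0 s
    + \sum_(1 <= n < N) ((c true (N, n))%:C * v true n s + (c false (N, n))%:C * v false n s)
    - (X N)%:C * (v0 s + \sum_(1 <= n < N) (v true n s + v false n s))).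
Proof.
move=> A0 hc hv0 hv; pose F b p := c b p - X p.1.
have h b := plog_sum_center (hc b).
pose S b N := `|F b (N, 0%N)| + \sum_(1 <= n < N) (n%:R ^+ 2)^-1 * `|F b (N, n)|.
have S0 b N : 0 <= S b N.
  by rewrite /S addr_ge0 // sumr_ge0 // => n _; rewrite mulr_ge0 ?invr_ge0 ?exprn_ge0.
have hS : plog ev L2 sqrtw (fun N => S true N + S false N).
  exact: (plogD (fun N _ => L2_ge1 N) (@sqrtw_ge0 R) (h true) (h false)).
apply: (negligible_dominated (A := A) hS) => N s N0 Ks.
rewrite ger0_norm; last exact: addr_ge0.
have -> : (c true (N, 0%N))%:C * v0 s
    + \sum_(1 <= n < N) ((c true (N, n))%:C * v true n s + (c false (N, n))%:C * v false n s)
    - (X N)%:C * (v0 s + \sum_(1 <= n < N) (v true n s + v false n s))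
  = (F true (N, 0%N))%:C * v0 s + \sum_(1 <= n < N)
      ((F true (N, n))%:C * v true n s + (F false (N, n))%:C * v false n s).
  rewrite mulrDr opprD addrACA -mulrBl -rmorphB mulr_sumr -sumrB; congr (_ + _).
  by apply: eq_bigr => n _; rewrite /F !rmorphB /=; ring.
apply: (@le_trans _ _ (A * (`|F true (N, 0%N)| + \sum_(1 <= n < N)
   ((n%:R ^+ 2)^-1 * `|F true (N, n)| + (n%:R ^+ 2)^-1 * `|F false (N, n)|)))).
  apply: (le_trans (cnormD _ _)); rewrite mulrDr lerD //.
    by rewrite cnormM cnorm_real mulrC ler_wpM2r ?hv0.
  apply: (le_trans (cnorm_sum _ _ _)); rewrite mulr_sumr big_nat [leRHS]big_nat.
  apply: ler_sum => n /andP[n1 nN]; apply: (le_trans (cnormD _ _)).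
  by rewrite mulrDr lerD // cnormM cnorm_real mulrC mulrA ler_wpM2r ?hv.
rewrite ler_wpM2l // big_split /= /S addrA lerD2l.
by rewrite lerDr.
Qed.

Variable (k : seq nat).
Hypothesis ik : is_index k.
Let c (j m : nat) (b : bool) (p : nat * nat) : R :=
  Ctrunc R k j m (side b p) (side (~~ b) p).
Let X (j m : nat) (N : nat) : R := Cxy k j m (H N) (H N).

Let plog_X j m : plog ev L2 (fun=> 1) (X j m).
Proof.
have hH : plog ev L2 (fun=> 1) H.
  apply: (@plog_comp _ _ _ _ _ _ _ id (fun=> 1) H _ _ _ (plog_harmonic R)) => // N N0.
  by rewrite lscale_ge0 lscale_le // leq_pmull.
rewrite /X /Cxy; apply: plog_sum => // a _.
apply: plogMl => //; last exact: plog_horner.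
by apply: plogMl => //; [exact: plog_cst|exact: plog_horner].
Qed.

Let norm_inv s e : punctured_strip s -> cnorm (s ^- e) <= B ^+ e.
Proof.
case=> _ s0 _ sB; have ss : 0 < cnorm s by rewrite cnorm_gt0.
rewrite cnormV cnormX -exprVn lerXn2r ?nnegrE ?invr_ge0 ?cnorm_ge0 ?(ltW B_gt0) //.
by rewrite -[leRHS]invrK lef_pV2 ?posrE ?invr_gt0.
Qed.

Let c_center j m b : plog dom2 (@lscale2 R) (@w1 R) (fun p => c j m b p - X j m p.1).
Proof. exact: Ctrunc_approx_center. Qed.

Let multiple_pole j m e : (1 < e)%N -> negligible (fun N s =>
  (c j m true (N, 0%N))%:C * s ^- e + \sum_(1 <= n < N)
     ((c j m true (N, n))%:C * (s + n%:R) ^- e + (c j m false (N, n))%:C * (s - n%:R) ^- e)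
  - (X j m N)%:C * monotangent e s).
Proof.
move=> e1; pose v (b : bool) n (s : C) := (s + (-1) ^+ (~~ b) * n%:R) ^- e.
have hs : negligible (fun N s => (c j m true (N, 0%N))%:C * s ^- e
    + \sum_(1 <= n < N) ((c j m true (N, n))%:C * v true n s + (c j m false (N, n))%:C * v false n s)
    - (X j m N)%:C * (s ^- e + \sum_(1 <= n < N) (v true n s + v false n s))).
  apply: (center_sum (A := Num.max (2 ^+ e) (B ^+ e))) => [|||b n s [hs _ _ _] n0].
  - by rewrite le_max exprn_ge0.
  - exact: c_center.
  - by move=> s Ks; rewrite le_max norm_inv ?orbT.
  - rewrite /v; apply: (le_trans (shift_inv_sqr_le (~~ b) hs e1 n0)).
    by rewrite ler_wpM2r ?invr_ge0 ?exprn_ge0 // le_max lexx.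
have ht : negligible (fun N s => (X j m N)%:C * (s ^- e
    + \sum_(1 <= n < N) (v true n s + v false n s) - monotangent e s)).
  have hX : plog ev L2 sqrtw (fun N => X j m N * sqrtw N).
    apply: plogMl => //; first exact: sqrtw_ge0.
    apply: (plogP _ (C := 1) (c := 0)) => // N N0; first exact: sqrtw_ge0.
    by rewrite ger0_norm ?sqrtw_ge0 // expr0 !mul1r.
  apply: (negligible_dominated (A := 2 ^+ e * 5) hX) => N s N0 [hs' _ _ _].
  rewrite cnormM cnorm_real normrM [leRHS]mulrCA ler_wpM2l //.
  rewrite -cnormN opprB (ger0_norm (sqrtw_ge0 R N0)) /v expr0 expr1 /=.
  under eq_bigr do rewrite mul1r mulN1r.
  apply: (le_trans (monotangent_tail e1 hs' N0)).
  rewrite ler_wpM2l ?mulr_ge0 ?exprn_ge0 // -[N%:R]sqrtn_sqr invfM.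
  by rewrite ler_piMr ?sqrtw_ge0 ?sqrtw_le1.
apply: eq_negligible (negligibleD hs ht) => N s N0 Ks.
rewrite mulrBr addrA subrK; congr (_ + _ - _).
by apply: eq_bigr => n _; rewrite /v expr0 expr1 mul1r mulN1r.
Qed.

Let odd_part j m N : R :=
  \sum_(1 <= n < N) (c j m true (N, n) - c j m false (N, n)) / n%:R.

(** For simple poles the kernels decay quadratically only once the constant
    terms [1 / n] and [- 1 / n] are removed; what they contribute involves the
    difference of the coefficients at opposite poles. *)
Let simple_pole j m : negligible (fun N s =>
  (c j m true (N, 0%N))%:C * s^-1 + \sum_(1 <= n < N)
     ((c j m true (N, n))%:C * (s + n%:R)^-1 + (c j m false (N, n))%:C * (s - n%:R)^-1)
  - (odd_part j m N)%:C - (X j m N)%:C * ((pi : R)%:C * cotC ((pi : R)%:C * s))).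
Proof.
pose v (b : bool) n (s : C) := (s + (-1) ^+ (~~ b) * n%:R)^-1 - (-1) ^+ (~~ b) / n%:R.
have vE s n : v true n s + v false n s = (s + n%:R)^-1 + (s - n%:R)^-1.
  by rewrite /v expr0 expr1 mul1r mulN1r mulNr addrACA subrr addr0.
have hs : negligible (fun N s => (c j m true (N, 0%N))%:C * s^-1
    + \sum_(1 <= n < N) ((c j m true (N, n))%:C * v true n s + (c j m false (N, n))%:C * v false n s)
    - (X j m N)%:C * (s^-1 + \sum_(1 <= n < N) (v true n s + v false n s))).
  apply: (center_sum (A := B * 2)) => [|||b n s [hs s0 sB sB'] n0].
  - by rewrite mulr_ge0 // ltW.
  - exact: c_center.
  - move=> s Ks; have := norm_inv 1 Ks; rewrite !expr1 => /le_trans; apply.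
    by rewrite ler_peMr ?ler1n // ltW.
  have d0 : s + (-1) ^+ (~~ b) * n%:R != 0.
    rewrite -cnorm_gt0; apply: lt_le_trans (shift_norm_ge (~~ b) hs n0).
    by rewrite divr_gt0 ?ltr0n.
  have nC : n%:R != 0 :> C by rewrite pnatr_eq0 -lt0n.
  (* [1 / (s + n) - 1 / n = - s / (n (s + n))], and similarly for [- n]. *)
  have -> : v b n s = - (-1) ^+ (~~ b) * (s * (n%:R^-1 * (s + (-1) ^+ (~~ b) * n%:R)^-1)).
    rewrite /v; case: b d0; rewrite /= ?expr0 ?expr1 ?mul1r ?mulN1r => d0; field;
    by rewrite d0 nC.
  rewrite !cnormM cnormN cnormX cnormN cnorm1 expr1n mul1r cnormV cnorm_nat.
  apply: (@le_trans _ _ (B * (n%:R^-1 * (2 / n%:R)))); last first.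
    rewrite le_eqVlt; apply/orP; left; apply/eqP; field.
    by rewrite pnatr_eq0 -lt0n.
  rewrite ler_pM ?mulr_ge0 ?invr_ge0 ?cnorm_ge0 // ler_wpM2l ?invr_ge0 //.
  by have := shift_inv_le 1 (~~ b) hs n0; rewrite !expr1.
have ht : negligible (fun N s => (X j m N)%:C * (s^-1
    + \sum_(1 <= n < N) (v true n s + v false n s)
    - (pi : R)%:C * cotC ((pi : R)%:C * s))).
  have hX : plog ev L2 sqrtw (fun N => X j m N * sqrtw N).
    apply: plogMl => //; first exact: sqrtw_ge0.
    apply: (plogP _ (C := 1) (c := 0)) => // N N0; first exact: sqrtw_ge0.
    by rewrite ger0_norm ?sqrtw_ge0 // expr0 !mul1r.
  have [K [K0 hK]] := cot_expansion B.
  apply: (negligible_dominated (A := K) hX) => N s N0 [hs' s0 sB _].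
  rewrite cnormM cnorm_real normrM [leRHS]mulrCA ler_wpM2l //.
  rewrite -cnormN opprB (ger0_norm (sqrtw_ge0 R N0)).
  under eq_bigr do rewrite vE.
  apply: (le_trans (hK s hs' s0 sB N N0)).
  rewrite ler_wpM2l // -[N%:R]sqrtn_sqr invfM.
  by rewrite ler_piMr ?sqrtw_ge0 ?sqrtw_le1.
apply: eq_negligible (negligibleD hs ht) => N s N0 Ks.
rewrite mulrBr addrA subrK; congr (_ - _); rewrite -addrA; congr (_ + _).
rewrite /odd_part rmorph_sum -sumrB; apply: eq_bigr => n _.
rewrite /v expr0 expr1 mul1r mulN1r fmorph_div rmorphB rmorph_nat /=; ring.
Qed.

(** Here poles at all distances contribute. As [side b (N, n)] divided by [N] is
    [1 + n / N] or [1 - n / N], the logarithmic profiles are samples of the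
    integrand of [C0] at [t = n / N]. *)
Let odd_part_C0 : plog ev L2 sqrtw
  (fun N => \sum_(j < size k) odd_part j (nth 0%N k j).-1 N - C0 k (H N)).
Proof.
pose Y (j : nat) (b : bool) (p : nat * nat) : R :=
  Cxy k j (nth 0%N k j).-1 (hside R b p) (hside R (~~ b) p).
pose F (j : nat) b p := c j (nth 0%N k j).-1 b p - Y j b p.
have hF j b : plog dom2 (@lscale2 R) (@w0 R) (F j b) by exact: Ctrunc_approx_boundary.
have hR : plog ev L2 sqrtw (fun N => rsum (C0_integrand k (H N)) N - C0 k (H N)).
  apply: (@plog_comp _ _ _ _ _ _ _ id sqrtw _ _ _ _ (C0_riemann R ik)) => // N N0;
    last exact: sqrtw_ge0.
  by rewrite lscale_ge0 lscale_le // leq_pmull.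
have hS : plog ev L2 sqrtw (fun N => \sum_(j < size k)
    \sum_(1 <= n < N) (F j true (N, n) - F j false (N, n)) / n%:R).
  apply: plog_sum => // [N N0|j _]; first exact: sqrtw_ge0.
  apply: (plog_sum_boundary (F := fun p => F j true p - F j false p)).
  by apply: plogB => // p; [move=> _; exact: lscale_ge1|exact: w0_ge0].
apply: eq_plog (plogD (fun N _ => L2_ge1 N) (@sqrtw_ge0 R) hS hR) => N N0.
rewrite addrA; congr (_ - _).
have -> : rsum (C0_integrand k (H N)) N =
   \sum_(j < size k) \sum_(1 <= n < N) (Y j true (N, n) - Y j false (N, n)) / n%:R.
  rewrite exchange_big /=; apply: eq_big_nat => n /andP[n1 nN].
  have nR : n%:R != 0 :> R by rewrite pnatr_eq0 -lt0n.
  have NR : N%:R != 0 :> R by rewrite pnatr_eq0 -lt0n.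
  rewrite -mulr_suml sumrB /C0_integrand /calR.
  have e1 : 1 + n%:R / N%:R = (N + n)%:R / N%:R :> R by rewrite natrD; field.
  have e2 : 1 - n%:R / N%:R = (N - n)%:R / N%:R :> R by rewrite natrB 1?ltnW //; field.
  by rewrite e1 e2 -mulrA -invfM divfK.
rewrite -big_split /=; apply: eq_bigr => j _; rewrite -big_split /=.
by apply: eq_bigr => n _; rewrite /F; ring.
Qed.

Let int_shift_neq0 (s : C) (z : int) : punctured_strip s -> z%:~R + s != 0.
Proof.
case=> hs s0 _ _; rewrite addrC -cnorm_gt0.
case: z => [[|n]|n]; first by rewrite addr0 cnorm_gt0.
  have := shift_norm_ge false hs (ltn0Sn n); rewrite expr0 mul1r.
  by apply: lt_le_trans; rewrite divr_gt0 ?ltr0n.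
have := shift_norm_ge true hs (ltn0Sn n); rewrite expr1 mulN1r NegzE mulrNz.
by apply: lt_le_trans; rewrite divr_gt0 ?ltr0n.
Qed.

(** All the contributions together: the multiple poles give the monotangents of
    weight at least two, the even part of the simple poles gives the cotangent
    with coefficient [C1], and their odd part gives [C0]. *)
Lemma trunc_multitangent_asymptotics : (0 < size k)%N -> negligible (fun N s =>
  trunc_multitangent N k s
  - ((C0 k (H N))%:C + (C1 k (H N))%:C * monotangent 1 s
     + \sum_(j < size k) \sum_(m < (nth 0%N k j).-1)
         (C_ k j m (H N))%:C * monotangent (nth 0%N k j - m) s)).
Proof.
move=> k0.
pose P (j m : nat) (e : nat) N (s : C) := (c j m true (N, 0%N))%:C * s ^- e
  + \sum_(1 <= n < N) ((c j m true (N, n))%:C * (s + n%:R) ^- e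
                       + (c j m false (N, n))%:C * (s - n%:R) ^- e).
have hm : negligible (fun N s => \sum_(j < size k) \sum_(m < (nth 0%N k j).-1)
    (P j m (nth 0%N k j - m)%N N s - (X j m N)%:C * monotangent (nth 0%N k j - m) s)).
  apply: negligible_sum => j; apply: negligible_sum => m; apply: multiple_pole.
  by have := ltn_ord m; lia.
have hs : negligible (fun N s => \sum_(j < size k)
    (P j (nth 0%N k j).-1 1%N N s - (odd_part j (nth 0%N k j).-1 N)%:C
     - (X j (nth 0%N k j).-1 N)%:C * monotangent 1 s)).
  by apply: negligible_sum => j; exact: simple_pole.
have ho := negligible_real odd_part_C0.
apply: eq_negligible (negligibleD (negligibleD hm hs) ho) => N s N0 Ks.
rewrite trunc_multitangent_paired // => [|n _]; last exact: int_shift_neq0.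
have kj (j : 'I_(size k)) : (0 < nth 0%N k j)%N by apply: (allP ik); exact: mem_nth.
have split_last n (G : nat -> C) : (0 < n)%N ->
    \sum_(m < n) G m = \sum_(m < n.-1) G m + G n.-1.
  by case: n => // n _; rewrite big_ord_recr.
transitivity (\sum_(j < size k) (\sum_(m < (nth 0%N k j).-1) P j m (nth 0%N k j - m)%N N s
    + P j (nth 0%N k j).-1 1%N N s)
  - ((C0 k (H N))%:C + (C1 k (H N))%:C * monotangent 1 s
     + \sum_(j < size k) \sum_(m < (nth 0%N k j).-1)
         (C_ k j m (H N))%:C * monotangent (nth 0%N k j - m) s)); last first.
  congr (_ - _); apply: eq_bigr => j _.
  rewrite [RHS](split_last _ (fun m => P j m (nth 0%N k j - m)%N N s)) //=.
  by congr (_ + P _ _ _ _ _); have := kj j; lia.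
have -> : (C1 k (H N))%:C = \sum_(j < size k) (X j (nth 0%N k j).-1 N)%:C.
  by rewrite -rmorph_sum.
rewrite rmorphB rmorph_sum /= mulr_suml big_split /=.
under eq_bigr do rewrite sumrB.
rewrite !sumrB sumrN [in RHS]big_split /= /C_ /X; ring.
Qed.

End Asymptotics.

Theorem theorem5p9 (R : realType) (k : seq nat) (K : set R[i]^o)
  (k_index : is_index k) (k_nonempty : (1 <= size k)%N)
  (K_compact : compact K)
  (K_sub : forall s : R[i], K s -> `|complex.Re s| < 1 / 2 /\ s != 0) :
  forall e : R, 0 < e ->
  \forall N \near \oo, forall s : R[i], K s ->
    `| trunc_multitangent N k s
       - ((C0 k (harmonicT R N))%:C
          + (C1 k (harmonicT R N))%:C * monotangent 1 s
          + \sum_(j < size k) \sum_(m < (nth 0%N k j).-1)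
              (C_ k j m (harmonicT R N))%:C
                * monotangent (nth 0%N k j - m) s) | < e%:C.
Proof.
move=> e e0.
have [B [B0 hB]] := compact_bounds K_compact (fun s Ks => (K_sub s Ks).2).
have KB s : K s -> punctured_strip B s.
  by move=> Ks; have [? ?] := K_sub s Ks; have [? ?] := hB s Ks.
have := negligible_lt (trunc_multitangent_asymptotics B0 k_index k_nonempty) e0.
apply: filterS => N hN s Ks; rewrite normrC ltcR.
exact/hN/KB.
Qed.
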